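(* Let $r\in[0,\frac12]$, $0<\gamma\le 1$, and assume the regularity, capacity and noise assumptions described in the context. If the number $l=l_n\le n$ of subsampled points satisfies $$l_n\gtrsim n^\beta,\qquad \beta\ge\frac{1+\gamma}{2r+1+\gamma},$$ then the choice $$\lambda_n\simeq\Big(\frac1n\Big)^{\frac1{2r+1+\gamma}}$$ leads, for the plain Nyström kernel regularized least squares estimator $\hat f_{n,l}^{\lambda}$, to the error bound $$\mathbb E\big[\mathcal E(\hat f_{n,l_n}^{\lambda_n})-\mathcal E(f_\rho)\big]\;\lesssim\;R^2\Big(\frac1n\Big)^{\frac{2r+1}{2r+1+\gamma}}.$$
   Context: Notation. For positive sequences, $a_n\lesssim b_n$ means $a_n\le Cb_n$ for a constant $C<\infty$ not depending on $n$ (it may depend on the fixed model parameters $r,\gamma,\kappa,\sigma,M,R$ and constants in the assumptions); $a_n\gtrsim b_n$ means $b_n\lesssim a_n$; $a_n\simeq b_n$ means both. $f\otimes f$ is the operator $h\mapsto\langle h,f\rangle f$. Setting. $\mathcal X$ is a standard Borel space, $\rho$ a probability measure on $\mathcal X\times\mathbb R$ with marginal $\nu$ on $\mathcal X$ and conditional distributions $\rho(\cdot|x)$; $\mathcal E(f)=\int(f(x)-y)^2d\rho(x,y)$ and $f_\rho(x)=\int y\,d\rho(y|x)$. $\mathcal H$ is a separable RKHS on $\mathcal X$ with measurable positive semi-definite kernel $K$, bounded: $\kappa^2=\sup_{x,x'}K(x,x')<\infty$; $K_x=K(x,\cdot)$. Covariance operator $T=\mathbb E_{X\sim\nu}[K_X\otimes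 K_X]$; effective dimension $\mathcal N(T,\lambda)=\mathrm{Trace}[(T+\lambda)^{-1}T]$. Regularity: $f_\rho\in\mathcal H$ and $\|T^{-r}f_\rho\|_{\mathcal H}\le R<\infty$ (i.e. $f_\rho=T^rh$ with $\|h\|_{\mathcal H}\le R$). Capacity: $\mathcal N(T,\lambda)\lesssim\lambda^{-\gamma}$ (constant uniform in $\lambda$). Noise (Bernstein): for some $\sigma,M>0$ and all integers $k\ge2$, $\mathbb E[|Y-f_\rho(X)|^k\,|\,X]\le\frac12k!\sigma^2M^{k-2}$ $\nu$-a.s. Estimator. Given i.i.d. data $(x_1,y_1),\dots,(x_n,y_n)$ from $\rho$, sample $l\le n$ points $\tilde x_1,\dots,\tilde x_l$ uniformly at random without replacement from $x_1,\dots,x_n$. For $\lambda>0$, $\hat f^\lambda_{n,l}=\sum_{j=1}^l\alpha_jK(\tilde x_j,\cdot)$ with $$\alpha=(\mathbf K_{nl}^*\mathbf K_{nl}+n\lambda\mathbf K_{ll})^\dagger\mathbf K_{nl}^*\mathbf y,$$ where $(\mathbf K_{nl})_{ij}=K(x_i,\tilde x_j)$, $(\mathbf K_{ll})_{kj}=K(\tilde x_k,\tilde x_j)$, $\mathbf y=(y_1,\dots,y_n)$ and $A^\dagger$ is the generalized (Moore–Penrose) inverse. It minimizes $\frac1n\sum_{j=1}^n(f(x_j)-y_j)^2+\lambda\|f\|_{\mathcal H}^2$ over $f\in\mathrm{span}\{K(\tilde x_1,\cdot),\dots,K(\tilde x_l,\cdot)\}$. The expectation is over the data and the subsampling. *)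

(* Defs.v *)
From HB Require Import structures.
From mathcomp Require Import all_boot all_order all_algebra.
From mathcomp Require Import all_classical all_reals all_analysis.

Set Implicit Arguments.
Unset Strict Implicit.
Unset Printing Implicit Defensive.

Import Order.TTheory GRing.Theory Num.Theory.
Import numFieldNormedType.Exports.

Local Open Scope classical_set_scope.
Local Open Scope ring_scope.

Definition separable_space (E : topologicalType) : Prop :=
  exists D : set E, countable D /\ dense D.

(* Borel isomorphic to a Polish space. *)
Definition standard_borel (R : realType) (d : measure_display)
    (X : measurableType d) : Prop :=
  exists P : completePseudoMetricType R,
    [/\ hausdorff_space P, separable_space P &
      exists2 f : X -> P, bijective f &
        forall A : set X, measurable A <-> <<s @open P >> (f @` A)].

(* A real Hilbert space of functions on [X]: [rkhs_fun] reads an element as a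
   function, [rkhs_sec x] is the representer of evaluation at [x], so that
   the reproducing kernel is [K x y = rkhs_fun (rkhs_sec x) y]. Symmetry and
   positive semi-definiteness of [K] follow. *)
Record rkhs (R : realType) (X : Type) := RKHS {
  rkhs_space :> completeNormedModType R;
  rkhs_dot : {dot rkhs_space for idfun};
  rkhs_fun : rkhs_space -> X -> R;
  rkhs_sec : X -> rkhs_space;
  rkhs_norm : forall f : rkhs_space, `|f| ^+ 2 = rkhs_dot f f;
  rkhs_fun_linear : forall (a : R) (f g : rkhs_space) (x : X),
    rkhs_fun (a *: f + g) x = a * rkhs_fun f x + rkhs_fun g x;
  rkhs_fun_inj : injective rkhs_fun;
  rkhs_reproducing : forall (f : rkhs_space) (x : X),
    rkhs_fun f x = rkhs_dot f (rkhs_sec x)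
}.

Definition rkhs_kernel (R : realType) (X : Type) (H : rkhs R X) (x y : X) : R :=
  rkhs_fun (rkhs_sec H x) y.

Definition rkhs_measurable (R : realType) (d : measure_display)
    (X : measurableType d) (H : rkhs R X) : Prop :=
  measurable_fun [set: X * X] (fun z => rkhs_kernel H z.1 z.2).

Definition kernel_bound (R : realType) (X : Type) (H : rkhs R X)
    (kappa : R) : Prop :=
  let values := [set a | exists x y : X, a = rkhs_kernel H x y] in
  has_ubound values /\ kappa ^+ 2 = sup values.

Section operators.
Context {R : realType} {X : Type} {H : rkhs R X}.
Implicit Types (A T : H -> H) (f g h : H) (e : nat -> H).

Local Notation "''[' f , g ]" := (rkhs_dot H f g) : ring_scope.

Definition tensor g f : H -> H := fun h => '[h, f] *: g.

(* The index set is always [nat]; vectors [e i] are allowed to vanish, so that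
   finite-dimensional spaces are covered too. *)
Definition orthonormal_basis e : Prop :=
  [/\ forall i j, i != j -> '[e i, e j] = 0,
      forall i, e i = 0 \/ `|e i| = 1 &
      forall f, series (fun i => '[f, e i] *: e i) @ \oo --> f].

(* For a positive operator the sum is the same for all orthonormal bases. *)
Definition optrace A : \bar R :=
  ereal_sup [set (\sum_(0 <= i <oo) ('[A (e i), e i])%:E)%E
            | e in orthonormal_basis].

(* The inverse when [A] is bijective, as [T + lambda] is for [lambda > 0]. *)
Definition opinv A : H -> H := fun g => xget 0 [set f | A f = g].

Definition effective_dim T (lambda : R) : \bar R :=
  optrace (opinv (fun f => T f + lambda *: f) \o T).

Definition eigenbasis T e (mu : nat -> R) : Prop :=
  [/\ orthonormal_basis e, forall i, 0 <= mu i &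
      forall i, T (e i) = mu i *: e i].

(* [g = T^r h], by spectral calculus: as [0 `^ 0 = 1], [T^0] is the identity,
   and as [0 `^ r = 0] for [r != 0], [T^r] vanishes on the kernel of [T] when
   [r > 0]. The value [g] does not depend on the eigenbasis. *)
Definition is_oppow T (r : R) h g : Prop :=
  exists e mu, eigenbasis T e mu /\
    series (fun i => (mu i `^ r * '[h, e i]) *: e i) @ \oo --> g.

End operators.

Section learning.
Context {R : realType} {d : measure_display} {X : measurableType d}.
Implicit Types (rho : probability (X * R)%type R) (k : R.-pker X ~> R)
  (nu : probability X R) (H : rkhs R X).

Definition is_marginal rho nu : Prop :=
  forall A : set X, measurable A -> nu A = rho (A `*` [set: R]).

(* [k x] is [rho(. | x)]. *)
Definition is_conditional rho nu k : Prop :=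
  forall (A : set X) (B : set R), measurable A -> measurable B ->
    rho (A `*` B) = (\int[nu]_(x in A) k x B)%E.

Definition regression k : X -> R := fun x => (\int[k x]_y y)%R.

Definition risk rho (f : X -> R) : \bar R :=
  (\int[rho]_z ((f z.1 - z.2) ^+ 2)%:E)%E.

(* [T = E[K_x (x) K_x]], as a weak (Pettis) integral. *)
Definition is_covariance nu H (T : H -> H) : Prop :=
  forall f g : H, rkhs_dot H (T f) g =
    (\int[nu]_x rkhs_dot H (tensor (rkhs_sec H x) (rkhs_sec H x) f) g)%R.

(* [k] is only determined up to a [nu]-null set, hence the a.e. equality. *)
Definition regularity nu k H (T : H -> H) (r Rad : R) : Prop :=
  exists f h : H, [/\ {ae nu, forall x, regression k x = rkhs_fun f x},
    is_oppow T r h f & `|h| <= Rad].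

Definition capacity H (T : H -> H) (gamma Q : R) : Prop :=
  forall lambda : R, 0 < lambda ->
    (effective_dim T lambda <= (Q * lambda `^ (- gamma))%:E)%E.

Definition bernstein_noise nu k (sigma M : R) : Prop :=
  {ae nu, forall x, forall m : nat, (2 <= m)%N ->
    (\int[k x]_y (`|y - regression k x| ^+ m)%:E <=
      (2^-1 * m`!%:R * sigma ^+ 2 * M ^+ (m - 2))%:E)%E}.

(* [Z] is an i.i.d. sample from [rho]; [S], independent of [Z], is a uniform
   draw of [l] of the [n] indices without replacement, kept in drawing order. *)
Definition nystrom_sampling rho (d' : measure_display)
    (Omega : measurableType d') (P : probability Omega R) (n l : nat)
    (Z : 'I_n -> Omega -> X * R) (S : Omega -> {ffun 'I_l -> 'I_n}) : Prop :=
  let draws := [set s : {ffun 'I_l -> 'I_n} | injectiveb s]%SET in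
  [/\ (forall i, measurable_fun [set: Omega] (Z i)) /\
        (forall s, measurable (S @^-1` [set s])),
      forall A : 'I_n -> set (X * R), (forall i, measurable (A i)) ->
        P (\bigcap_(i in [set: 'I_n]) (Z i @^-1` A i)) = (\prod_(i < n) rho (A i))%E,
      forall s, P (S @^-1` [set s]) =
        (if s \in draws then #|draws|%:R^-1 else 0)%:E &
      forall (A : 'I_n -> set (X * R)) s, (forall i, measurable (A i)) ->
        P (\bigcap_(i in [set: 'I_n]) (Z i @^-1` A i) `&` S @^-1` [set s]) =
        (P (\bigcap_(i in [set: 'I_n]) (Z i @^-1` A i)) * P (S @^-1` [set s]))%E].

End learning.

Section pseudo_inverse.
Context {R : realType}.

Definition is_mpinv m n (A : 'M[R]_(m, n)) (B : 'M[R]_(n, m)) : Prop :=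
  [/\ A *m B *m A = A, B *m A *m B = B,
      (A *m B)^T = A *m B & (B *m A)^T = B *m A].

Definition mpinv m n (A : 'M[R]_(m, n)) : 'M[R]_(n, m) := xget 0 (is_mpinv A).

Lemma is_mpinv_uniq m n (A : 'M[R]_(m, n)) B1 B2 :
  is_mpinv A B1 -> is_mpinv A B2 -> B1 = B2.
Proof.
move=> [a1 b1 c1 d1] [a2 b2 c2 d2].
have e1 : A *m B1 = A *m B2.
  rewrite -c1 -{1}a2 -mulmxA trmx_mul c1 c2.
  by rewrite mulmxA a1.
have e2 : B1 *m A = B2 *m A.
  rewrite -d1 -{1}a2 -(mulmxA A) mulmxA trmx_mul d2 d1.
  by rewrite -mulmxA (mulmxA A) a1.
by rewrite -b1 -mulmxA e1 mulmxA e2 b2.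
Qed.

Lemma gram_unitmx m n (A : 'M[R]_(m, n)) :
  row_free A -> A *m A^T \in unitmx.
Proof.
move=> fA; rewrite -row_free_unit -kermx_eq0; apply/rowV0P => u.
move=> /sub_kermxP uAA; apply: (row_free_inj fA).
rewrite mul0mx; set v := u *m A.
have vv : v *m v^T = 0 by rewrite /v trmx_mul mulmxA -(mulmxA u) uAA mul0mx.
apply/rowP => j; rewrite !mxE -/(v).
have /eqP := congr1 (fun M : 'M[R]_1 => M 0 0) vv.
rewrite !mxE psumr_eq0; last by move=> i _; rewrite !mxE -expr2 sqr_ge0.
move=> /allP /(_ j (mem_index_enum _)) /=.
by rewrite !mxE mulf_eq0 orbb => /eqP.
Qed.

Lemma is_mpinv_mul m n p (C : 'M[R]_(m, p)) (D : 'M[R]_(p, n)) :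
  row_full C -> row_free D ->
  is_mpinv (C *m D)
    (D^T *m invmx (D *m D^T) *m invmx (C^T *m C) *m C^T).
Proof.
move=> fC fD.
have uD : D *m D^T \in unitmx by exact: gram_unitmx.
have uC : C^T *m C \in unitmx.
  by rewrite -{2}[C]trmxK; apply: gram_unitmx; rewrite /row_free mxrank_tr.
set B := (X in is_mpinv _ X).
have AB : C *m D *m B = C *m invmx (C^T *m C) *m C^T.
  by rewrite /B !mulmxA -(mulmxA C D) -(mulmxA C _ (invmx _)) mulmxV// mulmx1.
have BA : B *m (C *m D) = D^T *m invmx (D *m D^T) *m D.
  rewrite /B !mulmxA -(mulmxA _ C^T C) -(mulmxA _ _ (C^T *m C)).
  by rewrite mulVmx// mulmx1.
split.
- rewrite AB !mulmxA -(mulmxA _ C^T C) -(mulmxA C _ (C^T *m C)).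
  by rewrite mulVmx// mulmx1.
- rewrite BA /B !mulmxA -(mulmxA _ D D^T) -(mulmxA D^T _ (D *m D^T)).
  by rewrite mulVmx// mulmx1.
- by rewrite AB !trmx_mul trmx_inv !trmx_mul !trmxK !mulmxA.
- by rewrite BA !trmx_mul trmx_inv !trmx_mul !trmxK !mulmxA.
Qed.

Lemma mpinvP m n (A : 'M[R]_(m, n)) : is_mpinv A (mpinv A).
Proof.
apply: (xgetPex 0); have := is_mpinv_mul (col_base_full A) (row_base_free A).
by rewrite mulmx_base; eexists; eassumption.
Qed.

End pseudo_inverse.

(* Plain Nystrom estimator for inputs [x], labels [y] and subsampled inputs
   [x (s j)]. *)
Definition nystrom (R : realType) (X : Type) (K : X -> X -> R) (n l : nat)
    (lambda : R) (x : 'I_n -> X) (y : 'I_n -> R) (s : 'I_l -> 'I_n) : X -> R :=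
  let Knl := \matrix_(i < n, j < l) K (x i) (x (s j)) in
  let Kll := \matrix_(i < l, j < l) K (x (s i)) (x (s j)) in
  let alpha := mpinv (Knl^T *m Knl + (n%:R * lambda) *: Kll) *m Knl^T
               *m \col_i y i in
  fun t => \sum_(j < l) alpha j 0 * K (x (s j)) t.

Definition expected_excess_risk (R : realType) (d d' : measure_display)
    (X : measurableType d) (rho : probability (X * R)%type R)
    (k : R.-pker X ~> R) (H : rkhs R X)
    (Omega : measurableType d') (P : probability Omega R) (n l : nat)
    (Z : 'I_n -> Omega -> X * R) (S : Omega -> {ffun 'I_l -> 'I_n})
    (lambda : R) : \bar R :=
  (\int[P]_w
    (risk rho (nystrom (rkhs_kernel H) lambda
                 (fun i => (Z i w).1) (fun i => (Z i w).2) (S w))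
     - risk rho (regression k)))%E.

(* Main.v *)
(* Let T_n and T_l be the empirical covariances of the sample and of the subsample,
   A = T + lambda, g = f_rho, and let Y_J be the squared Hilbert-Schmidt norm of
   A^(-1/2) (T - T_J), divided by lambda. By Cauchy-Schwarz and absorption,
   <A v, v> <= (2 + Y_J) <(T_J + lambda) v, v> for every v and every value of Y_J.
   Applied with T_l, whose form vanishes on the part of g orthogonal to the
   subsampled sections, this controls the projection error; applied with T_n in the
   normal equations of the estimator, it controls the rest. Altogether, with q the
   squared norm of A^(-1/2) applied to the empirical noise and using g = T^r h,
     E(fhat) - E(g) <~ lambda^(2r+1) (1 + Y_l^2) + lambda (Y_n^2 + Y_n Y_l) + (2 + Y_n)^2 q
   holds surely, so that only moments are needed and no logarithm is lost to a
   concentration inequality. Y_J is a quadratic form of independent variables with a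
   degenerate positive semi-definite kernel, so the expectation of Y_J^2 is of order
   (N(T, lambda) / (lambda |J|))^2 plus a smaller term; q is a quadratic form of the
   noise, and Y_n^2 q is treated by leaving one observation out. *)
Require Import Defs.
From HB Require Import structures.
From mathcomp Require Import all_boot all_order all_algebra.
From mathcomp Require Import all_classical all_reals all_analysis.
From mathcomp Require Import measurable_realfun ring lra.

Import Order.TTheory GRing.Theory Num.Theory.
Import numFieldNormedType.Exports.

Local Open Scope classical_set_scope.
Local Open Scope ring_scope.

Set Implicit Arguments.
Unset Strict Implicit.
Unset Printing Implicit Defensive.

(** * Deterministic error bound *)

(** For [r > 0] the quantity [lambda |g|^2] alone exceeds the target [lambda^(2r+1)], so it must
    always carry a factor [Y_n]. Hence the two regimes of the deterministic bound: for [Y_n <= 1/4]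
    the deviation is absorbed and the source condition alone measures [g]; for [Y_n >= 1/4]
    constants are dominated by multiples of [Y_n]. With [t = n^(-1/p)] and [p = 2r+1+gamma],
    [N(T, lambda) / (lambda n)] is of order at most [t^(2r)], while the condition on [l] only makes
    [N(T, lambda) / (lambda l)] bounded. The product [Y_n Y_l], whose factors share sample points,
    is split by a weighted AM-GM inequality; the weight [t^(2r)] makes both halves of order
    [t^(2r)]. No square root of [A] is formed: [A^(-1/2)] enters through sums over [N] eigenvectors
    weighted by [(mu + lambda)^-1]. These increase with [N], and expectations pass to the limit by
    Fatou. The draw is fixed throughout the moment estimates: an injective [s] selects an i.i.d.
    sample of size [l], and the bound is uniform in [s]. *)

Section hilbert.
Context {R : realType} {X : Type} (H : rkhs R X).
Implicit Types (f g h u v w : H) (e : nat -> H) (T : H -> H).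
Local Notation "''[' f , g ]" := (rkhs_dot H f g) : ring_scope.

Lemma dotC f g : '[f, g] = '[g, f].
Proof. by rewrite hermC expr0 mul1r. Qed.

Lemma dotDl f g h : '[f + g, h] = '[f, h] + '[g, h].
Proof. exact: linearDl. Qed.
Lemma dotZl a f h : '[a *: f, h] = a * '[f, h].
Proof. exact: linearZl_LR. Qed.
Lemma dotNl f h : '[- f, h] = - '[f, h].
Proof. exact: linearNl. Qed.
Lemma dotBl f g h : '[f - g, h] = '[f, h] - '[g, h].
Proof. exact: linearBl. Qed.
Lemma dot0l h : '[0, h] = 0.
Proof. exact: linear0l. Qed.
Lemma dot_suml (I : Type) (s : seq I) (P : pred I) (F : I -> H) h :
  '[\sum_(i <- s | P i) F i, h] = \sum_(i <- s | P i) '[F i, h].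
Proof. exact: linear_sumlz. Qed.

Lemma dotDr f g h : '[h, f + g] = '[h, f] + '[h, g].
Proof. by rewrite !(dotC h) dotDl. Qed.
Lemma dotZr a f h : '[h, a *: f] = a * '[h, f].
Proof. by rewrite !(dotC h) dotZl. Qed.
Lemma dotNr f h : '[h, - f] = - '[h, f].
Proof. by rewrite !(dotC h) dotNl. Qed.
Lemma dotBr f g h : '[h, f - g] = '[h, f] - '[h, g].
Proof. by rewrite !(dotC h) dotBl. Qed.
Lemma dot0r h : '[h, 0] = 0.
Proof. by rewrite dotC dot0l. Qed.
Lemma dot_sumr (I : Type) (s : seq I) (P : pred I) (F : I -> H) h :
  '[h, \sum_(i <- s | P i) F i] = \sum_(i <- s | P i) '[h, F i].
Proof. by rewrite dotC dot_suml; apply: eq_bigr => i _; rewrite dotC. Qed.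

Lemma dot_ge0 f : 0 <= '[f, f].
Proof. by rewrite -rkhs_norm sqr_ge0. Qed.

Lemma dot_eq0 f : '[f, f] = 0 -> f = 0.
Proof. by rewrite -rkhs_norm => /eqP; rewrite sqrf_eq0 normr_eq0 => /eqP. Qed.

(** Source of the Cauchy-Schwarz inequalities below. The forms may be degenerate, hence the case
    [c = 0], where a nonzero [b] would let the polynomial reach [-1]. *)
Lemma psd_disc (a b c : R) : 0 <= c -> (forall t : R, 0 <= a + 2 * t * b + t ^+ 2 * c) ->
  b ^+ 2 <= a * c.
Proof.
rewrite le_eqVlt => /predU1P[<- P|c0 P].
  rewrite mulr0 leNgt; apply/negP => b2.
  have b0 : b != 0 by move: b2; rewrite lt0r sqrf_eq0 => /andP[].
  have := P (- (a + 1) / (2 * b)).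
  have -> : a + 2 * (- (a + 1) / (2 * b)) * b + (- (a + 1) / (2 * b)) ^+ 2 * 0 = -1.
    by field.
  by rewrite ler0N1.
have := P (- b / c).
have -> : a + 2 * (- b / c) * b + (- b / c) ^+ 2 * c = (a * c - b ^+ 2) / c.
  by field; rewrite gt_eqF.
by rewrite pmulr_lge0 ?invr_gt0// subr_ge0.
Qed.

Lemma dot_CS2 f g : '[f, g] ^+ 2 <= '[f, f] * '[g, g].
Proof.
apply: psd_disc; first exact: dot_ge0.
move=> t; have := dot_ge0 (f + t *: g).
rewrite dotDl !dotDr !dotZl !dotZr (dotC g f); congr (_ <= _); ring.
Qed.

Lemma dot_CS f g : `|'[f, g]| <= `|f| * `|g|.
Proof.
rewrite -ler_sqr ?nnegrE ?mulr_ge0// exprMn !rkhs_norm real_normK ?num_real//.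
exact: dot_CS2.
Qed.

Lemma dot_cvg (u : nat -> H) f g : u @ \oo --> f ->
  (fun n => '[u n, g]) @ \oo --> '[f, g].
Proof.
move=> uf; apply/subr_cvg0; apply: norm_cvg0.
have unf : (fun n => `|u n - f| * `|g|) @ \oo --> (0 : R).
  rewrite -(mul0r `|g|); apply: cvgMr_tmp.
  by apply/norm_cvg0P/subr_cvg0.
apply: (squeeze_cvgr _ (cvg_cst _) unf).
by near=> n; rewrite normr_ge0 -dotBl dot_CS.
Unshelve. all: by end_near. Qed.

Lemma sum_CS (N : nat) (m x y : nat -> R) : (forall a, 0 < m a) ->
  (\sum_(a < N) x a * y a) ^+ 2 <=
  (\sum_(a < N) m a * x a ^+ 2) * (\sum_(a < N) (m a)^-1 * y a ^+ 2).
Proof.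
move=> m0; apply: psd_disc.
  by apply: sumr_ge0 => a _; rewrite mulr_ge0 ?sqr_ge0// invr_ge0 ltW.
move=> t; rewrite !mulr_sumr -!big_split/=; apply: sumr_ge0 => a _.
have -> : m a * x a ^+ 2 + 2 * t * (x a * y a) + t ^+ 2 * ((m a)^-1 * y a ^+ 2)
   = m a * (x a + t * y a / m a) ^+ 2 by field; rewrite gt_eqF.
by rewrite mulr_ge0 ?sqr_ge0// ltW.
Qed.

Section positive_operator.
Variables (T : H -> H) (e : nat -> H) (mu : nat -> R) (lam : R).
Hypothesis Tsym : forall f g, '[T f, g] = '[f, T g].
Hypothesis Tpos : forall f, 0 <= '[T f, f].
Hypothesis eb : eigenbasis T e mu.
Hypothesis lam0 : 0 < lam.

Let Tlin a f g h : '[T (a *: f + g), h] = a * '[T f, h] + '[T g, h].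
Proof. by rewrite Tsym dotDl dotZl -!Tsym. Qed.

(** The quadratic form of [A = T + lam]; it stands for the squared norm of [A^(1/2) f]. *)
Definition energy f := '[T f, f] + lam * '[f, f].

Lemma energy_ge0 f : 0 <= energy f.
Proof. by rewrite addr_ge0// mulr_ge0 ?dot_ge0// ltW. Qed.

Lemma energy_ge f : lam * '[f, f] <= energy f.
Proof. by rewrite lerDr. Qed.

Let weight_gt0 a : 0 < mu a + lam.
Proof. by case: eb => _ mu0 _; rewrite ltr_wpDl. Qed.

(** Basis vectors may vanish: [<e a, e a>] is 0 or 1, and a coefficient along [e a] absorbs it in
    both cases. *)
Lemma basis_dot f a : '[f, e a] * '[e a, e a] = '[f, e a].
Proof.
case: eb => -[_ /(_ a)[->|ea] _] _ _; first by rewrite !dot0r mul0r.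
by rewrite -rkhs_norm ea expr1n mulr1.
Qed.

Definition basis_proj N f := \sum_(a < N) '[f, e a] *: e a.

Lemma basis_proj_cvg f : (fun N => basis_proj N f) @ \oo --> f.
Proof.
case: eb => -[_ _ /(_ f) ef] _ _.
rewrite (_ : (fun N => _) = series (fun i => '[f, e i] *: e i))//.
by apply/funext => N; rewrite /basis_proj /series/= big_mkord.
Qed.

Lemma basis_proj_dot N f a : (a < N)%N -> '[basis_proj N f, e a] = '[f, e a].
Proof.
move=> aN; case: (eb) => -[orth _ _] _ _.
rewrite /basis_proj dot_suml (bigD1 (Ordinal aN))//= big1 ?addr0.
  by rewrite dotZl basis_dot.
by move=> i /eqP ia; rewrite dotZl orth ?mulr0//; apply/eqP => iE; apply: ia; exact/val_inj.
Qed.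

(** The energy of the residual [w - basis_proj N w] is nonnegative. As the [e a] are eigenvectors,
    the cross terms and the energy of the projection both reduce to the sum on the left. *)
Lemma bessel_energy N w :
  \sum_(a < N) (mu a + lam) * '[w, e a] ^+ 2 <= energy w.
Proof.
have TP h : '[T (basis_proj N w), h] = \sum_(a < N) mu a * ('[w, e a] * '[h, e a]).
  rewrite Tsym dot_suml; apply: eq_bigr => a _.
  by case: (eb) => _ _ Te; rewrite dotZl -Tsym Te dotZl (dotC (e a)) mulrCA.
have Ph h : '[basis_proj N w, h] = \sum_(a < N) ('[w, e a] * '[h, e a]).
  by rewrite dot_suml; apply: eq_bigr => a _; rewrite dotZl (dotC (e a)).
have PP (F : nat -> R) : \sum_(a < N) F a * ('[w, e a] * '[basis_proj N w, e a])
    = \sum_(a < N) F a * ('[w, e a] * '[w, e a]).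
  by apply: eq_bigr => a _; rewrite basis_proj_dot.
have := energy_ge0 (w - basis_proj N w); rewrite /energy.
have -> : w - basis_proj N w = (-1) *: basis_proj N w + w by rewrite scaleN1r addrC.
rewrite Tlin dotDl !dotDr !dotZl !dotZr (Tsym w) (dotC w (T _)) (dotC w (basis_proj N w)).
rewrite !TP !Ph PP.
rewrite (_ : \sum_(a < N) '[w, e a] * '[basis_proj N w, e a] =
             \sum_(a < N) '[w, e a] * '[w, e a]); last first.
  by apply: eq_bigr => a _; rewrite basis_proj_dot.
have -> : \sum_(a < N) (mu a + lam) * '[w, e a] ^+ 2 =
   \sum_(a < N) mu a * ('[w, e a] * '[w, e a]) + lam * \sum_(a < N) '[w, e a] * '[w, e a].
  by rewrite mulr_sumr -big_split/=; apply: eq_bigr => a _; rewrite mulrDl expr2.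
lra.
Qed.

(* The norm dual to [energy], computed in the eigenbasis. *)
Lemma dual_energy c w B :
  (forall N, \sum_(a < N) (mu a + lam)^-1 * '[c, e a] ^+ 2 <= B) ->
  '[c, w] ^+ 2 <= B * energy w.
Proof.
move=> cB.
have cv : (fun N => '[basis_proj N w, c] ^+ 2) @ \oo --> '[c, w] ^+ 2.
  by rewrite dotC !expr2; apply: cvgM; apply: dot_cvg; exact: basis_proj_cvg.
rewrite -(cvg_lim _ cv)//; apply: limr_le; first by apply/cvg_ex; eexists; exact: cv.
near=> N.
have -> : '[basis_proj N w, c] = \sum_(a < N) '[w, e a] * '[c, e a].
  by rewrite dot_suml; apply: eq_bigr => a _; rewrite dotZl (dotC c).
apply: (le_trans (sum_CS N (fun a => '[w, e a]) (fun a => '[c, e a]) weight_gt0)).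
rewrite mulrC; apply: ler_pM => //.
- by apply: sumr_ge0 => a _; rewrite mulr_ge0 ?sqr_ge0// invr_ge0 ltW.
- by apply: sumr_ge0 => a _; rewrite mulr_ge0 ?sqr_ge0// ltW.
- exact: bessel_energy.
Unshelve. all: by end_near. Qed.

Local Notation sec := (rkhs_sec H).

Let lam_ge0 : 0 <= lam. Proof. exact: ltW. Qed.

Definition emp (J : seq X) f : H :=
  (size J)%:R^-1 *: \sum_(x <- J) '[f, sec x] *: sec x.

Lemma emp_dot J f g :
  '[emp J f, g] = (size J)%:R^-1 * \sum_(x <- J) '[f, sec x] * '[g, sec x].
Proof.
rewrite dotZl dot_suml; congr (_ * _); apply: eq_bigr => x _.
by rewrite dotZl (dotC (sec x)).
Qed.

Lemma emp_sym J f g : '[emp J f, g] = '[f, emp J g].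
Proof.
rewrite emp_dot (dotC f) emp_dot; congr (_ * _).
by apply: eq_bigr => x _; rewrite mulrC.
Qed.

Lemma emp_ge0 J f : 0 <= '[emp J f, f].
Proof.
rewrite emp_dot mulr_ge0 ?invr_ge0//; apply: sumr_ge0 => x _.
by rewrite -expr2 sqr_ge0.
Qed.

(* The squared Hilbert-Schmidt norm of [(T - emp J) (T + lam)^(-1/2)], truncated
   to [N] eigenvectors. *)
Definition dev N (J : seq X) : R :=
  \sum_(a < N) (mu a + lam)^-1 * '[T (e a) - emp J (e a), T (e a) - emp J (e a)].

(** The coefficient of [T v - emp J v] along [e a] is [<v, T (e a) - emp J (e a)>]; Cauchy-Schwarz
    on each coefficient makes [dev] appear. *)
Lemma dev_dot J D v w : (forall N, dev N J <= D) ->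
  ('[T v, w] - '[emp J v, w]) ^+ 2 <= D * '[v, v] * energy w.
Proof.
move=> JD; rewrite -dotBl; apply: dual_energy => N.
apply: (le_trans _ (ler_wpM2r (dot_ge0 v) (JD N))).
rewrite mulr_suml; apply: ler_sum => a _; rewrite -mulrA ler_wpM2l ?invr_ge0 ?(ltW (weight_gt0 a))//.
rewrite dotBl Tsym emp_sym -dotBr dotC; exact: dot_CS2.
Qed.

(* [Y] need not be small: a large deviation costs a factor, so no exceptional
   event has to be excluded. *)
Lemma energy_emp J Y v : (forall N, dev N J <= lam * Y) ->
  energy v <= (2 + Y) * ('[emp J v, v] + lam * '[v, v]).
Proof.
move=> JY; have := dev_dot v v JY.
have E0 := energy_ge0 v; have v0 := dot_ge0 v; have M0 := emp_ge0 J v.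
set M := '[emp J v, v] + _; rewrite (_ : '[T v, v] - _ = energy v - M); last first.
  by rewrite /energy /M; ring.
have Mv : lam * '[v, v] <= M by rewrite lerDr.
(* At truncation 0 the sum [dev] is empty, so the hypothesis gives the sign of [Y]. *)
have Y0 : 0 <= Y.
  by have := JY 0; rewrite /dev big_ord0 pmulr_rge0.
move=> EM; have {}EM : (energy v - M) ^+ 2 <= Y * M * energy v.
  apply: (le_trans EM); rewrite ler_wpM2r//.
  by rewrite [lam * Y]mulrC -mulrA ler_wpM2l.
(* The square is expanded and [M ^ 2] dropped; a factor [energy v] then cancels. *)
have {EM} : energy v * energy v <= (2 + Y) * M * energy v.
  by move: EM (sqr_ge0 M); rewrite !expr2; lra.
move: E0; rewrite le_eqVlt => /predU1P[<- _|E0]; last by rewrite ler_pM2r.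
by rewrite mulr_ge0// ?addr_ge0// mulr_ge0//.
Qed.

(* In the application [g] is the regression function, [g - z] its projection onto
   the span of the subsampled sections, [w] the difference between the estimator
   and that projection, and [xi] the empirical noise. *)
Section deterministic.
Variables (Jn Jl : seq X) (Yn Yl q rho : R) (g z w xi : H).
Hypothesis hYn : forall N, dev N Jn <= lam * Yn.
Hypothesis hYl : forall N, dev N Jl <= lam * Yl.
Hypothesis hq : forall N, \sum_(a < N) (mu a + lam)^-1 * '[xi, e a] ^+ 2 <= q.
Hypothesis hg : forall v, (lam * '[g, v]) ^+ 2 <= rho ^+ 2 * energy v.
Hypothesis rho0 : 0 <= rho.
Hypothesis zorth : '[z, g - z] = 0.
Hypothesis zJl : '[emp Jl z, z] = 0.
Hypothesis hw : '[emp Jn w, w] + lam * '[w, w] =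
  '[emp Jn z, w] - lam * '[g - z, w] + '[xi, w].

Let Yn0 : 0 <= Yn.
Proof. by have := hYn 0; rewrite /dev big_ord0 pmulr_rge0. Qed.
Let Yl0 : 0 <= Yl.
Proof. by have := hYl 0; rewrite /dev big_ord0 pmulr_rge0. Qed.
Let q0 : 0 <= q.
Proof. by have := hq 0; rewrite big_ord0. Qed.

Let sqrtM_le (t a b : R) : 0 <= a -> 0 <= b -> t ^+ 2 <= a * b ->
  t <= Num.sqrt a * Num.sqrt b.
Proof.
move=> a0 b0 tab; apply: (le_trans (ler_norm t)).
by rewrite -sqrtr_sqr -sqrtrM// ler_sqrt// mulr_ge0.
Qed.

Let zz : '[z, z] = '[g, z].
Proof. by move: zorth; rewrite dotBr (dotC z g) => /eqP; rewrite subr_eq0 eq_sym => /eqP. Qed.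

Let z_le_g : '[z, z] <= '[g, g].
Proof.
by have := dot_ge0 (g - z); rewrite dotBl zorth subr0 dotBr -zz subr_ge0.
Qed.

Let u_le_g : '[g - z, g - z] <= '[g, g].
Proof.
rewrite dotBl zorth subr0 dotBr -zz.
by rewrite lerBlDr lerDl dot_ge0.
Qed.

(** [z] is orthogonal to the subsampled sections, so its empirical energy reduces to
    [lam * <z, z>]. *)
Let z_energy_le : energy z <= lam * (2 + Yl) * '[z, z].
Proof. by have := energy_emp z hYl; rewrite zJl add0r mulrCA mulrA. Qed.

Let b := Num.sqrt (energy z).
Let a := Num.sqrt (energy w).
Let b2 : b ^+ 2 = energy z. Proof. by rewrite /b sqr_sqrtr ?energy_ge0. Qed.
Let a2 : a ^+ 2 = energy w. Proof. by rewrite /a sqr_sqrtr ?energy_ge0. Qed.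
Let b0 : 0 <= b. Proof. exact: sqrtr_ge0. Qed.
Let a0 : 0 <= a. Proof. exact: sqrtr_ge0. Qed.

Let hg' v : lam * `|'[g, v]| <= rho * Num.sqrt (energy v).
Proof.
have -> : lam * `|'[g, v]| = `|lam * '[g, v]| by rewrite normrM (gtr0_norm lam0).
rewrite -[leRHS]ger0_norm; last by rewrite mulr_ge0// sqrtr_ge0.
rewrite -ler_sqr ?nnegrE// !real_normK ?num_real//.
by apply: (le_trans (hg v)); rewrite [leRHS]exprMn sqr_sqrtr// energy_ge0.
Qed.

(** Since [<z, z> = <g, z>], the source bound on [<g, z>] returns a factor [b], which cancels
    against one of the two in [b * b = energy z]. *)
Let b_le : b <= (2 + Yl) * rho.
Proof.
have h1 := hg' z; have h2 := ler_norm '[g, z].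
have bb : b * b <= (2 + Yl) * rho * b.
  rewrite -expr2 b2; apply: (le_trans z_energy_le); rewrite zz.
  rewrite -/b in h1; rewrite [lam * _]mulrC -!mulrA ler_wpM2l ?addr_ge0//.
  by apply: le_trans h1; rewrite ler_wpM2l//.
move: (b0); rewrite le_eqVlt => /predU1P[<-|bp]; last by rewrite ler_pM2r in bb.
by rewrite mulr_ge0// addr_ge0.
Qed.

Let b_sq_le : b ^+ 2 <= (8 + 2 * Yl ^+ 2) * rho ^+ 2.
Proof.
have : b ^+ 2 <= ((2 + Yl) * rho) ^+ 2.
  by rewrite ler_sqr ?nnegrE// mulr_ge0// addr_ge0.
move=> /le_trans; apply; rewrite exprMn ler_wpM2r ?sqr_ge0//.
by have := sqr_ge0 (Yl - 2); rewrite !expr2; lra.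
Qed.

Let xi_le : '[xi, w] <= Num.sqrt q * a.
Proof. by apply: sqrtM_le; rewrite ?energy_ge0//; exact: dual_energy. Qed.

Let dev_le v : `|'[T v, w] - '[emp Jn v, w]| <= Num.sqrt Yn * Num.sqrt (energy v) * a.
Proof.
rewrite -sqrtrM// /a -sqrtrM; last by rewrite mulr_ge0// energy_ge0.
rewrite -sqrtr_sqr ler_sqrt; last by rewrite !mulr_ge0// energy_ge0.
apply: (le_trans (dev_dot v w hYn)); rewrite ler_wpM2r ?energy_ge0//.
by rewrite [lam * Yn]mulrC -mulrA ler_wpM2l// energy_ge.
Qed.

(** Here [sqrt Yn <= 1/2]: replacing [emp Jn] by [T] in the normal equations costs half of
    [energy w], absorbed on the left, and half of [b * a]. *)
Let good : Yn <= 4^-1 -> a ^+ 2 <= 27 * b ^+ 2 + 12 * rho ^+ 2 + 12 * q.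
Proof.
move=> Y4; have sY : Num.sqrt Yn <= 2^-1.
  rewrite -[2^-1]ger0_norm// -sqrtr_sqr ler_sqrt ?sqr_ge0//.
  by rewrite exprVn (_ : 2 ^+ 2 = 4 :> R) // -natrX.
have sY0 := sqrtr_ge0 Yn.
have dw : `|'[T w, w] - '[emp Jn w, w]| <= 2^-1 * a * a.
  by apply: (le_trans (dev_le w)); rewrite ler_wpM2r// ler_wpM2r.
have dz : `|'[T z, w] - '[emp Jn z, w]| <= 2^-1 * b * a.
  by apply: (le_trans (dev_le z)); rewrite ler_wpM2r// ler_wpM2r.
(* The part [lam * <z, w>] of the bias joins [<T z, w>] to form the energy product of [z] and [w],
   so that only [<g, w>] is left to the source bound. *)
have ez : '[T z, w] + lam * '[z, w] <= b * a.
  apply: sqrtM_le; rewrite ?energy_ge0//.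
  apply: psd_disc; first exact: energy_ge0.
  move=> t; have := energy_ge0 (t *: w + z); rewrite /energy Tlin.
  rewrite dotDl !dotDr !dotZl !dotZr (Tsym w z) (dotC w (T z)) (dotC w z).
  by congr (_ <= _); ring.
have hgw := hg' w; rewrite -/a in hgw.
have : a ^+ 2 <= 2^-1 * a * a + 2^-1 * b * a + b * a + rho * a + Num.sqrt q * a.
  rewrite a2 /energy; move: hw; rewrite dotBl.
  move: (ler_norm ('[T w, w] - '[emp Jn w, w])) (ler_norm (- ('[T z, w] - '[emp Jn z, w]))).
  rewrite normrN; have := ler_norm (- '[g, w]); rewrite normrN => gw.
  have : lam * - '[g, w] <= rho * a by apply: le_trans hgw; rewrite ler_wpM2l//.
  move: dw dz ez xi_le; lra.
set Q := Num.sqrt q; have Q0 : 0 <= Q by exact: sqrtr_ge0.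
have QE : Q ^+ 2 = q by rewrite sqr_sqrtr.
rewrite -QE => h.
have {}h : a <= 3 * b + 2 * rho + 2 * Q.
  move: (a0); rewrite le_eqVlt => /predU1P[<-|ap].
    by rewrite !addr_ge0// mulr_ge0.
  by rewrite -(ler_pM2r ap); move: h; rewrite !expr2; lra.
have : a ^+ 2 <= (3 * b + 2 * rho + 2 * Q) ^+ 2.
  by rewrite ler_sqr ?nnegrE// !addr_ge0// mulr_ge0.
have := sqr_ge0 (3 * b - 2 * rho); have := sqr_ge0 (3 * b - 2 * Q).
by have := sqr_ge0 (2 * rho - 2 * Q); rewrite !expr2; lra.
Qed.

(** No smallness is available here: [energy_emp] costs the factor [2 + Yn <= 9 * Yn], and it is this
    [Yn] that compensates for the larger quantity [lam * <g, g>]. *)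
Let bad : 4^-1 <= Yn -> a ^+ 2 <=
  450 * lam * '[g, g] * (Yn ^+ 2 + Yn * Yl) + 3 * (2 + Yn) ^+ 2 * q.
Proof.
move=> Y4.
set M := '[emp Jn w, w] + lam * '[w, w].
have Mge : lam * '[w, w] <= M by rewrite lerDr emp_ge0.
have Mge' : '[emp Jn w, w] <= M by rewrite lerDl mulr_ge0 ?dot_ge0//.
have M0 : 0 <= M by apply: le_trans Mge; rewrite mulr_ge0 ?dot_ge0//.
have aM : a ^+ 2 <= (2 + Yn) * M by rewrite a2; exact: energy_emp.
set N := Num.sqrt M; have N0 : 0 <= N := sqrtr_ge0 M.
have NM : N ^+ 2 = M by rewrite sqr_sqrtr.
set p := '[emp Jn z, z].
have p0 : 0 <= p := emp_ge0 _ _.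
have zw : '[emp Jn z, w] <= Num.sqrt p * N.
  apply: sqrtM_le => //; apply: (@le_trans _ _ (p * '[emp Jn w, w])); last first.
    by rewrite ler_wpM2l.
  apply: psd_disc; first exact: emp_ge0.
  move=> t; have := emp_ge0 Jn (z + t *: w).
  rewrite emp_sym dotDl dotZl -!emp_sym !dotDr !dotZr.
  by rewrite (emp_sym Jn w z) (dotC w (emp Jn z)); congr (_ <= _); ring.
have uG := u_le_g; set G := '[g, g] in uG *; have G0 : 0 <= G by exact: dot_ge0.
have uw : - (lam * '[g - z, w]) <= Num.sqrt (lam * G) * N.
  apply: sqrtM_le => //; first by rewrite mulr_ge0//.
  rewrite sqrrN exprMn.
  apply: (@le_trans _ _ ((lam * '[g - z, g - z]) * (lam * '[w, w]))).
    have -> : (lam * '[g - z, g - z]) * (lam * '[w, w]) =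
      lam ^+ 2 * ('[g - z, g - z] * '[w, w]) by ring.
    by rewrite ler_wpM2l ?sqr_ge0//; exact: dot_CS2.
  by rewrite ler_pM ?mulr_ge0 ?dot_ge0// ler_wpM2l.
have lG0 : 0 <= lam * G by rewrite mulr_ge0//.
set S := Num.sqrt (2 + Yn).
have aN : a <= S * N.
  by apply: sqrtM_le => //; rewrite addr_ge0.
have S0 : 0 <= S := sqrtr_ge0 _.
have S2 : S ^+ 2 = 2 + Yn by rewrite sqr_sqrtr// addr_ge0.
set Q := Num.sqrt q; have Q0 : 0 <= Q := sqrtr_ge0 _.
have Q2 : Q ^+ 2 = q by rewrite sqr_sqrtr.
set P := Num.sqrt p; have P0 : 0 <= P := sqrtr_ge0 _.
have P2 : P ^+ 2 = p by rewrite sqr_sqrtr.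
set L := Num.sqrt (lam * G) in uw; have L0 : 0 <= L := sqrtr_ge0 _.
have L2 : L ^+ 2 = lam * G by rewrite sqr_sqrtr.
have NN : N <= P + L + Q * S.
  have : N * N <= P * N + L * N + Q * S * N.
    rewrite -expr2 NM /M hw; apply: lerD; first exact: lerD.
    by apply: (le_trans xi_le); rewrite -mulrA ler_wpM2l.
  rewrite -!mulrDl; move: N0; rewrite le_eqVlt => /predU1P[<- _|Np].
    by rewrite !addr_ge0// mulr_ge0.
  by rewrite ler_pM2r.
have M3 : M <= 3 * (p + lam * G + q * (2 + Yn)).
  have : N ^+ 2 <= (P + L + Q * S) ^+ 2.
    by rewrite ler_sqr ?nnegrE// !addr_ge0// mulr_ge0.
  rewrite NM -P2 -L2 -Q2 -S2 -exprMn; set QS := Q * S.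
  have := sqr_ge0 (P - L); have := sqr_ge0 (P - QS); have := sqr_ge0 (L - QS).
  by rewrite !expr2; lra.
(* The sample form at [z] is compared with [T] through [dev_dot], and the energy of [z] is
   controlled by the subsample through [z_energy_le]. *)
have pE : p <= lam * G * (3 + 3 / 2 * Yl + Yn / 2).
  have := dev_dot z z hYn; set E := energy z => Ez.
  have E0 : 0 <= E := energy_ge0 z.
  have pT : p <= E + Num.sqrt (lam * Yn * '[z, z]) * Num.sqrt E.
    have : - ('[T z, z] - p) <= Num.sqrt (lam * Yn * '[z, z]) * Num.sqrt E.
      by apply: sqrtM_le => //; rewrite ?sqrrN// !mulr_ge0 ?dot_ge0//.
    have : '[T z, z] <= E by rewrite /E /energy lerDl mulr_ge0 ?dot_ge0//.
    lra.
  have zG : lam * '[z, z] <= lam * G by rewrite ler_wpM2l//.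
  have {}pT : p <= 3 / 2 * E + lam * Yn * '[z, z] / 2.
    apply: (le_trans pT).
    set s := lam * Yn * '[z, z]; have s0 : 0 <= s by rewrite !mulr_ge0 ?dot_ge0//.
    have := sqr_ge0 (Num.sqrt s - Num.sqrt E); rewrite sqrrB !sqr_sqrtr//.
    by rewrite -mulr_natr; lra.
  have h1 : E <= (2 + Yl) * (lam * G).
    apply: (le_trans z_energy_le).
    by rewrite [lam * (2 + Yl)]mulrC -mulrA ler_wpM2l// addr_ge0.
  have h2 : lam * Yn * '[z, z] <= Yn * (lam * G).
    by rewrite [lam * Yn]mulrC -mulrA ler_wpM2l.
  lra.
have S9 : 2 + Yn <= 9 * Yn by lra.
apply: (le_trans aM).
apply: (@le_trans _ _ ((2 + Yn) * (3 * (lam * G * (3 + 3 / 2 * Yl + Yn / 2) + lam * G + q * (2 + Yn))))).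
  by rewrite ler_wpM2l ?addr_ge0//; apply: (le_trans M3); lra.
rewrite (_ : _ * _ = (2 + Yn) * (lam * G * (12 + 9 / 2 * Yl + 3 / 2 * Yn)) + 3 * (2 + Yn) ^+ 2 * q); last by field.
rewrite lerD2r.
have k0 : 0 <= lam * G * (12 + 9 / 2 * Yl + 3 / 2 * Yn).
  by rewrite mulr_ge0// !addr_ge0// mulr_ge0.
apply: (le_trans (ler_wpM2r k0 S9)).
have -> : 450 * lam * G * (Yn ^+ 2 + Yn * Yl) = 9 * Yn * (lam * G * (50 * Yn + 50 * Yl)).
  by ring.
(* [12 <= 48 * Yn] leaves no term without a deviation; 50 is a common coefficient and
   [450 = 9 * 50]. *)
rewrite ler_wpM2l ?mulr_ge0// ler_wpM2l//.
by move: Yl0 Yn0 Y4; lra.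
Qed.

Lemma deterministic_bound : '[T (w - z), w - z] <=
  500 * (1 + Yl ^+ 2) * rho ^+ 2 + 900 * lam * '[g, g] * (Yn ^+ 2 + Yn * Yl)
  + 24 * (2 + Yn) ^+ 2 * q.
Proof.
have : '[T (w - z), w - z] <= 2 * a ^+ 2 + 2 * b ^+ 2.
  rewrite a2 b2; apply: (@le_trans _ _ (energy (w - z))).
    by rewrite lerDl mulr_ge0 ?dot_ge0//.
  have := energy_ge0 (w + z).
  have -> : w + z = 1 *: z + w by rewrite scale1r addrC.
  have -> : w - z = (-1) *: z + w by rewrite scaleN1r addrC.
  rewrite /energy !Tlin.
  by rewrite !dotDl !dotDr !dotZl !dotZr; lra.
move=> /le_trans; apply.
have lG0 : 0 <= lam * '[g, g] by rewrite mulr_ge0 ?dot_ge0//.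
have h1 : 0 <= lam * '[g, g] * (Yn ^+ 2 + Yn * Yl).
  by rewrite mulr_ge0// addr_ge0 ?sqr_ge0// mulr_ge0.
have h2 : 4 * q <= (2 + Yn) ^+ 2 * q.
  rewrite ler_wpM2r// expr2; have : 0 <= Yn * Yn by exact: mulr_ge0.
  by move: Yn0; lra.
have h3 : 0 <= Yl ^+ 2 * rho ^+ 2 by rewrite mulr_ge0// sqr_ge0.
have h4 := sqr_ge0 rho.
(* In the first regime there are [2 * 27 + 2 = 56] copies of [b ^ 2], and
   [56 * 8 + 24 = 472 <= 500]; in the second, 900 is twice 450. *)
move: b_sq_le q0; have [Y4|/ltW Y4] := leP Yn 4^-1.
  by have := good Y4; lra.
by have := bad Y4; lra.
Qed.

End deterministic.

End positive_operator.
End hilbert.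

(** * Normal equations of the estimator *)

Section estimator.
Context {R : realType} {X : Type} (H : rkhs R X).
Local Notation "''[' f , g ]" := (rkhs_dot H f g) : ring_scope.
Local Notation sec := (rkhs_sec H).

(** The residual [c = b - A (mpinv A b)] lies in the kernel of [A], hence is orthogonal both to [b]
    and to the range of [A], so to itself. *)
Lemma mpinv_solve n (A : 'M[R]_n) (b : 'cV[R]_n) : A^T = A ->
  (forall c : 'cV[R]_n, A *m c = 0 -> c^T *m b = 0) -> A *m (mpinv A *m b) = b.
Proof.
move=> At Ab; have [ABA BAB tAB tBA] := mpinvP A; set B := mpinv A in ABA BAB tAB tBA *.
pose c := b - A *m (B *m b).
have AAB : A *m (A *m B) = A.
  by rewrite -[LHS]trmxK trmx_mul tAB At ABA At.
have Ac : A *m c = 0.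
  by rewrite /c mulmxBr (mulmxA A B) (mulmxA A (A *m B)) AAB subrr.
have cA : c^T *m A = 0 by rewrite -At -trmx_mul Ac trmx0.
have cc : c^T *m c = 0.
  have cE : c = b - A *m (B *m b) by [].
  by rewrite [X in c^T *m X]cE mulmxBr (Ab _ Ac) (mulmxA c^T A) cA mul0mx subr0.
have c0 : c = 0.
  apply/colP => i; rewrite !mxE.
  have /eqP := congr1 (fun M : 'M[R]_1 => M 0 0) cc.
  rewrite !mxE psumr_eq0; last by move=> k _; rewrite !mxE -expr2 sqr_ge0.
  by move=> /allP /(_ i (mem_index_enum _)) /=; rewrite !mxE mulf_eq0 orbb => /eqP.
by apply/esym/eqP; rewrite -subr_eq0 -/c c0.
Qed.

Lemma rkhs_kernelE (x y : X) : rkhs_kernel H x y = '[sec x, sec y].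
Proof. by rewrite /rkhs_kernel rkhs_reproducing. Qed.

Definition lincomb (I : finType) (x : I -> X) (c : I -> R) : H := \sum_j c j *: sec (x j).

Lemma lincomb_dot (I : finType) (x : I -> X) c f : '[lincomb x c, f] = \sum_j c j * '[f, sec (x j)].
Proof. by rewrite dot_suml; apply: eq_bigr => j _; rewrite dotZl dotC. Qed.

(** The Gram matrix may be singular, but a vector of its kernel is the coefficient vector of the
    zero function, so the system is compatible. The solution gives the orthogonal projection of [g]
    onto the span of the sections. *)
Lemma interpolant l (x : 'I_l -> X) (g : H) :
  exists c, forall j, '[lincomb x c, sec (x j)] = '[g, sec (x j)].
Proof.
pose K := \matrix_(i < l, j < l) '[sec (x i), sec (x j)].
pose b := \col_(i < l) '[g, sec (x i)].
have Kt : K^T = K by apply/matrixP => i j; rewrite !mxE dotC.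
have Kb (c : 'cV_l) : K *m c = 0 -> c^T *m b = 0.
  move=> Kc; pose v := lincomb x (fun j => c j 0).
  have v0 : v = 0.
    apply: (@dot_eq0 _ _ H); rewrite {1}/v lincomb_dot big1// => j _.
    have := congr1 (fun M : 'cV_l => M j 0) Kc; rewrite !mxE => Kj.
    rewrite lincomb_dot (_ : \sum_(_ < _) _ = 0) ?mulr0// -[RHS]Kj.
    by apply: eq_bigr => k _; rewrite !mxE mulrC.
  apply/matrixP => i j; rewrite !ord1 !mxE.
  have := congr1 (fun v => '[v, g]) v0; rewrite /v lincomb_dot dot0l => vg.
  by rewrite -[RHS]vg; apply: eq_bigr => k _; rewrite !mxE.
have := mpinv_solve Kt Kb; set c := mpinv K *m b => cE.
exists (fun j => c j 0) => j.
have := congr1 (fun M : 'cV_l => M j 0) cE; rewrite !mxE => <-.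
by rewrite lincomb_dot; apply: eq_bigr => k _; rewrite !mxE mulrC.
Qed.

Section normal_equations.
Variables (n l : nat) (lam : R) (x : 'I_n -> X) (y : 'I_n -> R) (s : 'I_l -> 'I_n).
Hypothesis lam0 : 0 < lam.
Hypothesis n0 : (0 < n)%N.
Let nR : 0 < n%:R :> R. Proof. by rewrite ltr0n. Qed.
Let J := [seq x i | i <- enum 'I_n].

Lemma big_sample (F : X -> R) : \sum_(t <- J) F t = \sum_i F (x i).
Proof. by rewrite big_map big_enum. Qed.

Lemma size_sample : size J = n.
Proof. by rewrite size_map size_enum_ord. Qed.

(** The pseudo-inverse solves the normal equations exactly even if [M] is singular: [M c = 0] makes
    [c^T M c], a sum of squared values at the data plus [n lam |v|^2], vanish, so [c] is orthogonal
    to the right-hand side. *)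
Lemma nystrom_normal : exists c,
  (forall t, nystrom (rkhs_kernel H) lam x y s t = rkhs_fun (lincomb (x \o s) c) t) /\
  forall j, '[emp J (lincomb (x \o s) c), sec (x (s j))]
            + lam * '[lincomb (x \o s) c, sec (x (s j))]
     = n%:R^-1 * '[lincomb x y, sec (x (s j))].
Proof.
pose N := \matrix_(i < n, j < l) rkhs_kernel H (x i) (x (s j)).
pose G := \matrix_(i < l, j < l) rkhs_kernel H (x (s i)) (x (s j)).
pose M := N^T *m N + (n%:R * lam) *: G.
have Mt : M^T = M.
  rewrite /M linearD/= linearZ/= trmx_mul trmxK; congr (_ + _ *: _).
  by apply/matrixP => i j; rewrite !mxE !rkhs_kernelE dotC.
have NE (c : 'cV_l) i : (N *m c) i 0 = '[lincomb (x \o s) (fun j => c j 0), sec (x i)].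
  by rewrite lincomb_dot mxE; apply: eq_bigr => k _; rewrite mxE rkhs_kernelE mulrC.
have ME (c : 'cV_l) j : (M *m c) j 0 =
    \sum_i '[lincomb (x \o s) (fun j => c j 0), sec (x i)] * '[sec (x (s j)), sec (x i)]
    + n%:R * lam * '[lincomb (x \o s) (fun j => c j 0), sec (x (s j))].
  rewrite /M mulmxDl mxE -mulmxA -scalemxAl; congr (_ + _).
    rewrite mxE; apply: eq_bigr => i _.
    by rewrite NE !mxE rkhs_kernelE mulrC (dotC (sec (x i))).
  rewrite mxE lincomb_dot; congr (_ * _); rewrite mxE.
  by apply: eq_bigr => k _; rewrite !mxE rkhs_kernelE mulrC.
have Mb (c : 'cV_l) : M *m c = 0 -> c^T *m (N^T *m \col_i y i) = 0.
  move=> Mc; set v := lincomb (x \o s) (fun j => c j 0).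
  have vJ : \sum_i '[v, sec (x i)] ^+ 2 + n%:R * lam * '[v, v] = 0.
    transitivity (\sum_j c j 0 * (M *m c) j 0); last first.
      by rewrite Mc big1// => j _; rewrite mxE mulr0.
    apply/esym; under eq_bigr do rewrite ME mulrDr -/v mulr_sumr.
    rewrite big_split/= exchange_big/=; congr (_ + _).
      apply: eq_bigr => i _; rewrite expr2 {3}/v lincomb_dot mulr_sumr.
      by apply: eq_bigr => j _; rewrite /= (dotC (sec (x i))) mulrCA.
    rewrite {3}/v lincomb_dot mulr_sumr.
    by apply: eq_bigr => j _; rewrite /= mulrCA.
  have vx i : '[v, sec (x i)] = 0.
    move/eqP: vJ; rewrite paddr_eq0; last 2 first.
      by apply: sumr_ge0 => k _; exact: sqr_ge0.
      by rewrite !mulr_ge0 ?dot_ge0// ltW.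
    move=> /andP[]; rewrite psumr_eq0; last by move=> k _; exact: sqr_ge0.
    by move=> /allP /(_ i (mem_index_enum _)) /=; rewrite sqrf_eq0 => /eqP.
  rewrite mulmxA -trmx_mul (_ : N *m c = 0) ?trmx0 ?mul0mx//.
  by apply/colP => i; rewrite NE vx mxE.
have := mpinv_solve Mt Mb; set a := mpinv M *m _ => aE.
exists (fun j => a j 0); split.
  move=> t; rewrite rkhs_reproducing lincomb_dot /nystrom -/N -/G -/M -mulmxA -/a.
  by apply: eq_bigr => j _; rewrite rkhs_kernelE dotC.
move=> j; have := congr1 (fun M : 'cV_l => M j 0) aE; rewrite ME => h.
apply: (mulfI (lt0r_neq0 nR)).
rewrite mulrDr emp_dot size_sample big_sample !mulrA mulfV ?gt_eqF// !mul1r h.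
rewrite mxE lincomb_dot; apply: eq_bigr => i _.
by rewrite !mxE rkhs_kernelE mulrC dotC.
Qed.

End normal_equations.
End estimator.

Section excess.
Context {R : realType} {X : Type} (H : rkhs R X).
Local Notation "''[' f , g ]" := (rkhs_dot H f g) : ring_scope.
Local Notation sec := (rkhs_sec H).
Variables (T : H -> H) (e : nat -> H) (mu : nat -> R) (lam : R).
Hypothesis Tsym : forall f g, '[T f, g] = '[f, T g].
Hypothesis Tpos : forall f, 0 <= '[T f, f].
Hypothesis eb : eigenbasis T e mu.
Hypothesis lam0 : 0 < lam.

Lemma emp_dotB J f g h : '[emp J (f - g), h] = '[emp J f, h] - '[emp J g, h].
Proof. by rewrite emp_sym dotBl -!emp_sym. Qed.

Lemma excess_bound n l (x : 'I_n -> X) (y : 'I_n -> R) (s : 'I_l -> 'I_n)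
    (g : H) (Yn Yl q rho : R) : (0 < n)%N ->
  (forall N, dev T e mu lam N [seq x i | i <- enum 'I_n] <= lam * Yn) ->
  (forall N, dev T e mu lam N [seq x (s j) | j <- enum 'I_l] <= lam * Yl) ->
  (forall N, \sum_(a < N) (mu a + lam)^-1 *
    (n%:R^-1 * \sum_i (y i - '[g, sec (x i)]) * '[e a, sec (x i)]) ^+ 2 <= q) ->
  (forall v, (lam * '[g, v]) ^+ 2 <= rho ^+ 2 * energy T lam v) -> 0 <= rho ->
  exists2 fh : H,
    forall t, nystrom (rkhs_kernel H) lam x y s t = rkhs_fun fh t &
    '[T (fh - g), fh - g] <=
      500 * (1 + Yl ^+ 2) * rho ^+ 2 + 900 * lam * '[g, g] * (Yn ^+ 2 + Yn * Yl)
      + 24 * (2 + Yn) ^+ 2 * q.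
Proof.
move=> n0 hYn hYl hq hg rho0.
have [c cE] := interpolant (x \o s) g.
have [al [fhE fhN]] := @nystrom_normal R X H n l lam x y s lam0 n0.
set fh := lincomb H (x \o s) al in fhE fhN; set u := lincomb H (x \o s) c in cE.
exists fh => //.
pose z := g - u; pose w := fh - u.
pose eps i := y i - '[g, sec (x i)].
pose xi := n%:R^-1 *: lincomb H x eps.
have zs j : '[z, sec (x (s j))] = 0 by rewrite /z dotBl cE subrr.
have zu : g - z = u by rewrite /z opprB addrC subrK.
have wE : w = lincomb H (x \o s) (fun j => al j - c j).
  by rewrite /w /fh /u -sumrB; apply: eq_bigr => j _; rewrite scalerBl.
have -> : fh - g = w - z by rewrite /w /z opprB addrA subrK.
apply: (@deterministic_bound _ _ _ T e mu lam Tsym Tpos eb lam0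
  [seq x i | i <- enum 'I_n] [seq x (s j) | j <- enum 'I_l] Yn Yl q rho g z w xi) => //.
- move=> N; apply: le_trans (hq N); rewrite le_eqVlt; apply/orP; left; apply/eqP.
  apply: eq_bigr => a _; congr (_ * _ ^+ 2); rewrite dotZl lincomb_dot.
  by congr (_ * _); apply: eq_bigr => i _.
- by rewrite zu dotC lincomb_dot big1// => j _; rewrite zs mulr0.
- by rewrite emp_dot big_map big1 ?mulr0// => j _; rewrite zs mul0r.
- rewrite zu; set J := [seq x i | i <- enum 'I_n].
  (* [w] lies in the span of the subsampled sections, so the normal equations may be tested against
     it. *)
  have fw : '[emp J fh, w] + lam * '[fh, w] = n%:R^-1 * '[lincomb H x y, w].
    rewrite wE -/w dotC lincomb_dot (dotC fh) lincomb_dot (dotC (lincomb H x y)) lincomb_dot.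
    rewrite !mulr_sumr -big_split/=; apply: eq_bigr => j _.
    by rewrite mulrCA -mulrDr fhN mulrCA.
  (* Each label splits as [g (x i) + eps i]. *)
  have yw : n%:R^-1 * '[lincomb H x y, w] = '[emp J g, w] + '[xi, w].
    rewrite emp_dot dotZl !lincomb_dot size_sample big_sample -mulrDr -big_split/=.
    congr (_ * _); apply: eq_bigr => i _; rewrite /eps dotC.
    by rewrite mulrBl (dotC w); ring.
  rewrite {1}/w {2}/w emp_dotB dotBl /z emp_dotB.
  by move: fw; rewrite yw; lra.
Qed.

End excess.

(** * Source condition *)

Section source.
Context {R : realType} {X : Type} (H : rkhs R X).
Local Notation "''[' f , g ]" := (rkhs_dot H f g) : ring_scope.
Variables (T : H -> H) (e : nat -> H) (mu : nat -> R).
Hypothesis Tsym : forall f g, '[T f, g] = '[f, T g].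
Hypothesis Tpos : forall f, 0 <= '[T f, f].
Hypothesis eb : eigenbasis T e mu.

(** This is [bessel_energy] for the zero operator and [lam = 1]. *)
Lemma bessel N h : \sum_(a < N) '[h, e a] ^+ 2 <= '[h, h].
Proof.
have eb0 : eigenbasis (fun=> 0 : H) e (fun=> 0).
  by case: eb => ob _ _; split => // i; rewrite scale0r.
have sym0 (f g : H) : '[0, g] = '[f, 0] by rewrite dot0l dot0r.
have pos0 (f : H) : 0 <= '[0, f] by rewrite dot0l.
have := bessel_energy sym0 pos0 eb0 ltr01 N h.
rewrite /energy dot0l !add0r mul1r; apply: le_trans.
by apply: ler_sum => a _; rewrite mul1r.
Qed.

Lemma oppow_coef (r : R) (h g : H) a :
  series (fun i => (mu i `^ r * '[h, e i]) *: e i) @ \oo --> g ->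
  '[g, e a] = mu a `^ r * '[h, e a].
Proof.
move=> gh; have := dot_cvg (g := e a) gh.
move=> /(cvg_lim (@Rhausdorff R)) <-.
apply: lim_near_cst => //; near=> N.
case: (eb) => -[orth _ _] _ _.
have aN : (a < N)%N by near: N; exists a.+1.
rewrite /series/= big_mkord dot_suml (bigD1 (Ordinal aN))//= big1 ?addr0.
  by rewrite dotZl -mulrA (basis_dot eb).
by move=> i /eqP ia; rewrite dotZl orth ?mulr0//; apply/eqP => iE; apply: ia; exact/val_inj.
Unshelve. all: by end_near. Qed.

(** The larger of [m] and [l] carries the bound; for [m > l] the exponent [2 * r - 1] is
    nonpositive, which is where [r <= 1/2] enters. *)
Lemma powR_interpolation (m l r : R) : 0 <= m -> 0 < l -> 0 <= r <= 1 / 2 ->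
  (m `^ r) ^+ 2 <= l `^ (2 * r - 1) * (m + l).
Proof.
move=> m0 l0 /andP[r0 r2].
have -> : (m `^ r) ^+ 2 = m `^ (2 * r) by rewrite -powR_mulrn ?powR_ge0// -powRrM mulrC.
have [ml|lm] := leP m l.
  apply: (@le_trans _ _ (l `^ (2 * r))).
    by apply: ge0_ler_powR; rewrite ?nnegrE ?mulr_ge0// ltW.
  rewrite mulrDr; have -> : l `^ (2 * r) = l `^ (2 * r - 1) * l.
    rewrite -{3}(powRr1 (ltW l0)) -powRD ?subrK//.
    by apply/implyP => _; exact: lt0r_neq0.
  by rewrite lerDr mulr_ge0// powR_ge0.
have mp : 0 < m by exact: lt_trans lm.
have -> : m `^ (2 * r) = m `^ (2 * r - 1) * m.
  rewrite -{3}(powRr1 m0) -powRD ?subrK//.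
  by apply/implyP => _; exact: lt0r_neq0.
apply: ler_pM; rewrite ?powR_ge0//; last by rewrite lerDl ltW.
rewrite -[2 * r - 1]opprK (powRN m) (powRN l) lef_pV2 ?posrE ?powR_gt0//.
by apply: ge0_ler_powR; rewrite ?nnegrE ?(ltW mp) ?(ltW l0) ?(ltW lm)//; lra.
Qed.

(** The coefficients of [g] are [mu^r <h, e>], and [mu^(2r) / (mu + lam) <= lam^(2r-1)]. This
    controls the squared norm of [A^(-1/2) g] and supplies the [rho] of the deterministic bound. *)
Lemma source_condition (r lam Rad : R) (h g v : H) :
  0 < lam -> 0 <= r <= 1 / 2 -> `|h| <= Rad ->
  series (fun i => (mu i `^ r * '[h, e i]) *: e i) @ \oo --> g ->
  '[g, v] ^+ 2 <= lam `^ (2 * r - 1) * Rad ^+ 2 * energy T lam v.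
Proof.
move=> lam0 hr hRad gh; apply: (dual_energy Tsym Tpos eb lam0) => N.
have mu0 a : 0 <= mu a by case: eb.
have ml a : 0 < mu a + lam by rewrite ltr_wpDl.
apply: (@le_trans _ _ (\sum_(a < N) lam `^ (2 * r - 1) * '[h, e a] ^+ 2)).
  apply: ler_sum => a _; rewrite (oppow_coef a gh) exprMn mulrA ler_wpM2r ?sqr_ge0//.
  rewrite mulrC ler_pdivrMr//; exact: powR_interpolation.
rewrite -mulr_sumr ler_wpM2l ?powR_ge0//; apply: (le_trans (bessel N h)).
by rewrite -rkhs_norm ler_sqr ?nnegrE//; apply: le_trans hRad.
Qed.

(** Taking [lam = 1] and [v = g] in [source_condition] bounds [|g|] without estimating the norm of
    [T^r]. *)
Lemma source_norm (r K2 Rad : R) (h g : H) :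
  0 <= K2 -> 0 <= r <= 1 / 2 -> `|h| <= Rad -> (forall f, '[T f, f] <= K2 * '[f, f]) ->
  series (fun i => (mu i `^ r * '[h, e i]) *: e i) @ \oo --> g ->
  '[g, g] <= (1 + K2) * Rad ^+ 2.
Proof.
move=> K0 hr hRad TK gh; have := source_condition g ltr01 hr hRad gh.
rewrite powR1 mul1r /energy mul1r => gg.
have {gg} : '[g, g] * '[g, g] <= (1 + K2) * Rad ^+ 2 * '[g, g].
  rewrite -expr2; apply: (le_trans gg).
  rewrite [leRHS]mulrAC [leRHS]mulrC ler_wpM2l ?sqr_ge0//.
  by rewrite mulrDl mul1r addrC lerD2l TK.
have := dot_ge0 g; rewrite le_eqVlt => /predU1P[g0 _|g0]; last by rewrite ler_pM2r.
by rewrite -g0 mulr_ge0 ?sqr_ge0// addr_ge0.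
Qed.

End source.

(** * Hilbert projection and measurability of the elements of the space *)

Section projection.
Context {R : realType} {X : Type} (H : rkhs R X).
Implicit Types (f g h : H).
Local Notation "''[' f , g ]" := (rkhs_dot H f g) : ring_scope.

(** A minimizing sequence for the distance to [f], with errors [1 / (n + 1)], is Cauchy. *)
Lemma closed_projection (M : set H) f : M 0 ->
  (forall a g h, M g -> M h -> M (a *: g + h)) ->
  (forall (u : nat -> H) h, (forall n, M (u n)) -> u @ \oo --> h -> M h) ->
  exists2 p, M p & forall m, M m -> '[f - p, m] = 0.
Proof.
move=> M0 Mlin Mcl.
pose E := [set '[f - m, f - m] | m in M].
have E0 : lbound E 0 by move=> _ [m _ <-]; exact: dot_ge0.
have hE : has_inf E by split; [exists '[f - 0, f - 0], 0|exists 0].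
set D := inf E.
have DE m : M m -> D <= '[f - m, f - m].
  by move=> Mm; apply: ge_inf; [exists 0|exists m].
have ex_u n : exists m, M m /\ '[f - m, f - m] < D + n.+1%:R^-1.
  have : 0 < n.+1%:R^-1 :> R by rewrite invr_gt0.
  by move=> /inf_adherent -/(_ _ hE) [_ [m Mm <-] mD]; exists m.
have [u uP] := choice ex_u.
(* Parallelogram law: the midpoint of [u i] and [u j] lies in [M], so its squared distance to [f] is
   at least [D]. *)
have par i j : `|u i - u j| ^+ 2 <= 2 * i.+1%:R^-1 + 2 * j.+1%:R^-1.
  have [Mi ui] := uP i; have [Mj uj] := uP j.
  have Mm : M (2^-1 *: (u i) + 2^-1 *: u j).
    by apply: (Mlin _ _ _ _ _) => //; rewrite -[_ *: u j]addr0; exact: Mlin.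
  have := DE _ Mm; rewrite rkhs_norm.
  move: ui uj; rewrite !(dotBl, dotBr, dotDl, dotDr, dotZl, dotZr).
  rewrite (dotC (u j) (u i)) (dotC (u i) f) (dotC (u j) f).
  move: (i.+1%:R^-1) (j.+1%:R^-1) => a b.
  by lra.
have /cvg_ex[p up] : cvgn u.
  apply/cauchy_cvgP/cauchy_ballP => eps eps0; near_simpl.
  have e4 : 0 < eps ^+ 2 / 4 by rewrite divr_gt0// exprn_gt0.
  have [N _ NP] := near_infty_natSinv_lt (PosNum e4).
  exists ([set n | (N <= n)%N], [set n | (N <= n)%N]); first by split; exists N.
  move=> [i j]/= [/NP/= Ni /NP/= Nj].
  rewrite -ball_normE/= -ltr_sqr ?nnegrE//; last exact: ltW.
  apply: (le_lt_trans (par _ _)).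
  by move: (i.+1%:R^-1) (j.+1%:R^-1) Ni Nj => a b ? ?; lra.
have Mp : M p by apply: Mcl up => n; case: (uP n).
exists p => // m Mm.
have pD : '[f - p, f - p] <= D.
  apply/ler_addgt0Pr => eps eps0.
  have fp : (fun n => `|f - u n| ^+ 2) @ \oo --> `|f - p| ^+ 2.
    rewrite !expr2; apply: cvgM; apply: cvg_norm; apply: cvgB => //; exact: cvg_cst.
  rewrite -rkhs_norm -(cvg_lim _ fp)//; apply: limr_le.
    by apply/cvg_ex; eexists; exact: fp.
  near=> n; rewrite rkhs_norm; apply: ltW; have [_ un] := uP n.
  apply: (lt_le_trans un); rewrite lerD2l ltW//; near: n.
  exact: near_infty_natSinv_lt (PosNum eps0).
(* Minimality along the line [p - t m] is the hypothesis of [psd_disc] with constant term 0. *)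
apply/eqP; rewrite -sqrf_eq0 eq_le sqr_ge0 andbT -[leRHS](mul0r '[m, m]).
apply: psd_disc; first exact: dot_ge0.
move=> t; have Mt : M ((- t) *: m + p) by exact: Mlin.
have := le_trans pD (DE _ Mt).
rewrite !(dotBl, dotBr, dotDl, dotDr, dotZl, dotZr, dotNl, dotNr).
by rewrite (dotC m f) (dotC p f) (dotC p m) !expr2; lra.
Unshelve. all: by end_near. Qed.

End projection.

Section rkhs_measurability.
Context {R : realType} {d : measure_display} {X : measurableType d} (H : rkhs R X).
Local Notation "''[' f , g ]" := (rkhs_dot H f g) : ring_scope.
Local Notation sec := (rkhs_sec H).
Hypothesis mH : rkhs_measurable H.

Lemma measurable_rkhs_kernel : measurable_fun setT (fun z : X * X => '[sec z.1, sec z.2]).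
Proof.
rewrite (_ : (fun z => _) = (fun z => rkhs_kernel H z.1 z.2))//.
by apply/funext => z; rewrite rkhs_kernelE.
Qed.

(* The measurable elements form a closed subspace containing all sections; a
   vector orthogonal to it vanishes pointwise. *)
Lemma measurable_rkhs (f : H) : measurable_fun setT (fun x => '[f, sec x]).
Proof.
pose M := [set f : H | measurable_fun setT (fun x => '[f, sec x])].
have [] := @closed_projection _ _ H M f.
- rewrite /M/= (_ : (fun x => _) = cst 0); first exact: measurable_cst.
  by apply/funext => x; rewrite dot0l.
- move=> a g h mg mh; rewrite /M/=.
  rewrite (_ : (fun x => _) = (fun x => a * '[g, sec x] + '[h, sec x])); last first.
    by apply/funext => x; rewrite dotDl dotZl.
  by apply: measurable_funD => //; exact: measurable_funM.
- move=> u h mu uh; apply: (measurable_fun_cvg (h := fun n x => '[u n, sec x])) => //.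
  by move=> x _; exact: dot_cvg.
move=> p Mp fp; rewrite (_ : f = p)//.
apply: (@rkhs_fun_inj _ _ H); apply/funext => x.
rewrite !rkhs_reproducing; apply/eqP; rewrite -subr_eq0 -dotBl; apply/eqP/fp.
exact: (measurable_fun_pair2 x measurable_rkhs_kernel).
Qed.

End rkhs_measurability.

(** * Regression noise and excess risk *)

Section expectation_bounds.
Context {d} {T : measurableType d} {R : realType} (m : probability T R).
Implicit Types (f g : T -> R).

Lemma integral_cst_prob c : (\int[m]_x c%:E = c%:E)%E.
Proof. by rewrite integral_cst// [X in (_ * X)%E](_ : _ = 1%E) ?mule1//; exact: probability_setT. Qed.

(** Measurability and sign are bundled with the bound, so that sums, multiples and limits of bounds
    need no integrability argument. *)
Definition expect_le f A := [/\ measurable_fun setT f, forall x, 0 <= f x &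
  (\int[m]_x (f x)%:E <= A%:E)%E].

Lemma expect_le_ge0 f A : expect_le f A -> 0 <= A.
Proof.
move=> [_ f0 fA]; rewrite -lee_fin; apply: le_trans fA.
by apply: integral_ge0 => x _; rewrite lee_fin.
Qed.

Lemma expect_leD f g A B : expect_le f A -> expect_le g B ->
  expect_le (fun x => f x + g x) (A + B).
Proof.
move=> [mf f0 fA] [mg g0 gB]; split; first exact: measurable_funD.
  by move=> x; rewrite addr_ge0.
under eq_integral do rewrite EFinD.
rewrite ge0_integralD//; last 4 first.
- by move=> x _; rewrite lee_fin.
- exact/measurable_EFinP.
- by move=> x _; rewrite lee_fin.
- exact/measurable_EFinP.
by rewrite EFinD leeD.
Qed.

Lemma expect_leZ c f A : 0 <= c -> expect_le f A ->
  expect_le (fun x => c * f x) (c * A).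
Proof.
move=> c0 [mf f0 fA]; split; first exact: measurable_funM.
  by move=> x; rewrite mulr_ge0.
under eq_integral do rewrite EFinM.
rewrite ge0_integralZl//; last 2 first.
- exact/measurable_EFinP.
- by move=> x _; rewrite lee_fin.
by rewrite EFinM lee_wpmul2l// lee_fin.
Qed.

Lemma expect_le_cst c : 0 <= c -> expect_le (fun=> c) c.
Proof.
by move=> c0; split => //; rewrite integral_cst_prob.
Qed.

Lemma expect_le_mono f g A : expect_le g A -> measurable_fun setT f ->
  (forall x, 0 <= f x <= g x) -> expect_le f A.
Proof.
move=> [mg g0 gA] mf fg; split => //; first by move=> x; case/andP: (fg x).
apply: le_trans gA; apply: ge0_le_integral => //.
- by move=> x _; rewrite lee_fin; case/andP: (fg x).
- exact/measurable_EFinP.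
- exact/measurable_EFinP.
- by move=> x _; rewrite lee_fin; case/andP: (fg x).
Qed.

Lemma expect_le_trans f A B : expect_le f A -> A <= B -> expect_le f B.
Proof. by move=> [mf f0 fA] AB; split => //; apply: (le_trans fA); rewrite lee_fin. Qed.

Lemma integral_sum_fin N (f : nat -> T -> R) (A : nat -> R) :
  (forall a, m.-integrable setT (fun x => (f a x)%:E)) ->
  (forall a, (\int[m]_x (f a x)%:E = (A a)%:E)%E) ->
  m.-integrable setT (fun x => (\sum_(a < N) f a x)%:E) /\
  (\int[m]_x (\sum_(a < N) f a x)%:E = (\sum_(a < N) A a)%:E)%E.
Proof.
move=> fi fA; elim: N => [|N [IH1 IH2]].
  rewrite big_ord0 (_ : (fun x => _) = cst 0%E); last first.
    by apply/funext => x; rewrite big_ord0.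
  by rewrite integral0; split => //; exact: integrable0.
rewrite big_ord_recr/= (_ : (fun x => _) =
    (fun x => (\sum_(a < N) f a x)%:E + (f N x)%:E)%E); last first.
  by apply/funext => x; rewrite big_ord_recr.
by rewrite integralD// IH2 fA; split => //; exact: integrableD.
Qed.

Lemma bounded_integrable f B : measurable_fun setT f -> (forall x, `|f x| <= B) ->
  m.-integrable setT (fun x => (f x)%:E).
Proof.
move=> mf fB; apply: measurable_bounded_integrable => //.
  by rewrite [X in (X < _)%E](_ : _ = 1%E) ?ltry//; exact: probability_setT.
exists B; split; first exact: num_real.
by move=> r Br x _; apply: le_trans (ltW Br); exact: fB.
Qed.

End expectation_bounds.

Section fatou_bound.
Context {d} {T : measurableType d} {R : realType} (m : probability T R).

(** Fatou's lemma: a bound uniform in the truncation passes to the limit, together with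
    measurability. *)
Lemma expect_le_lim (f : nat -> T -> R) (g : T -> R) A :
  (forall N, expect_le m (f N) A) -> (forall x, f ^~ x @ \oo --> g x) ->
  expect_le m g A.
Proof.
move=> fA fg.
have g0 x : 0 <= g x.
  rewrite -(cvg_lim _ (fg x))//; apply: limr_ge; first by apply/cvg_ex; eexists; exact: fg.
  by apply: nearW => N; have [_ + _] := fA N; exact.
split => //.
  apply: (measurable_fun_cvg (h := f)) => [N|x _]; last exact: fg.
  by have [] := fA N.
have gE x : (g x)%:E = limn_einf (fun N => (f N x)%:E).
  have fgE : (fun N => (f N x)%:E) @ \oo --> (g x)%:E by apply: cvg_EFin => //; [exact: nearW|exact: fg].
  by rewrite is_cvg_limn_einfE; [apply/esym/cvg_lim|apply/cvg_ex; eexists; exact: fgE].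
under eq_integral do rewrite gE.
apply: (le_trans (fatou m measurableT (f := fun N x => (f N x)%:E) _ _)).
- by move=> N; apply/measurable_EFinP; have [] := fA N.
- by move=> N x _; rewrite lee_fin; have [_ + _] := fA N; exact.
rewrite limn_einf_lim; apply: lime_le; first exact: is_cvg_einfs.
apply: nearW => N; have [_ _] := fA N; apply: le_trans.
by apply: ereal_inf_lbound; exists N => /=.
Qed.

End fatou_bound.

(** * Disintegration of the joint law *)

Section pushforward.
Context {d1 d2} {X : measurableType d1} {Y : measurableType d2} {R : realType}.

Definition pushm (m : {measure set X -> \bar R}) (f : X -> Y) (mf : measurable_fun setT f) :
  {measure set Y -> \bar R}.
Proof. by refine (pushforward m f : {measure set Y -> \bar R}). Defined.

Lemma ge0_integral_pushm (m : {measure set X -> \bar R}) (f : X -> Y)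
    (mf : measurable_fun setT f) (F : Y -> \bar R) :
  measurable_fun setT F -> (forall y, 0 <= F y)%E ->
  (\int[pushm m mf]_y F y = \int[m]_x F (f x))%E.
Proof.
move=> mF F0; rewrite -[LHS]/(\int[pushforward m f]_y F y)%E.
rewrite ge0_integral_pushforward ?preimage_setT//.
Qed.

End pushforward.

Section graph_kernel.
Context {d} {X : measurableType d} {R : realType} (k : R.-pker X ~> R).

Let mpair (x : X) : measurable_fun [set: R] (pair x : R -> X * R).
Proof. exact: pair1_measurable. Qed.

(** The kernel sending [x] to the law of [(x, Y)] with [Y] drawn from [k x]. The factor [unit]
    appears because [nu] enters the composition as a kernel with source [unit]. *)
Definition graph_kernel (ux : unit * X) : {measure set (X * R) -> \bar R} :=
  pushm (k ux.2) (mpair ux.2).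

Let measurable_graph U : measurable U ->
  measurable_fun [set: unit * X] (graph_kernel ^~ U).
Proof.
move=> mU.
have h : measurable_fun setT (kfcomp k (EFin \o \1_U)).
  apply: measurable_kfcomp => [|t]; last by rewrite lee_fin.
  by apply/measurable_EFinP; exact: measurable_indic.
rewrite kfcompkindic// in h.
rewrite (_ : (fun ux => _) = (fun x => k x (xsection U x)) \o snd).
  exact: measurableT_comp h measurable_snd.
by apply/funext => -[u x] /=; rewrite xsectionE.
Qed.

HB.instance Definition _ := isKernel.Build _ _ _ _ R graph_kernel measurable_graph.

Let graph_prob x : graph_kernel x [set: X * R] = 1%E.
Proof. exact: prob_kernel. Qed.

HB.instance Definition _ := Kernel_isProbability.Build _ _ _ _ R graph_kernel graph_prob.

End graph_kernel.

Section disintegration.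
Context {d} {X : measurableType d} {R : realType}.
Variables (rho : probability (X * R)%type R) (nu : probability X R) (k : R.-pker X ~> R).
Hypothesis rhoE : is_conditional rho nu k.

(** [is_conditional] prescribes [rho] on rectangles, which form a generating family stable under
    intersection; hence [rho] is the composition of [nu] with [graph_kernel], and integrals against
    a composed kernel iterate. *)
Lemma disintegration (F : X * R -> \bar R) : measurable_fun setT F ->
  (forall z, 0 <= F z)%E ->
  (\int[rho]_z F z = \int[nu]_x \int[k x]_y F (x, y))%E.
Proof.
move=> mF F0.
pose l : R.-pker unit ~> X := kprobability (measurable_cst (nu : pprobability X R)).
transitivity (\int[mkcomp l (graph_kernel k) tt]_z F z)%E; last first.
  rewrite [LHS]integral_kcomp//; apply: eq_integral => x _.
  by rewrite ge0_integral_pushm.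
apply: eq_measure_integral => A mA _.
pose C : set (set (X * R)) :=
  [set B | exists A1, measurable A1 /\ exists A2, measurable A2 /\ B = A1 `*` A2].
apply: (measure_unique C (fun=> setT)) => //.
- rewrite measurable_prod_measurableType; congr (<<s _ >>).
  rewrite predeqE; split => [[A1 mA1 [A2 mA2 <-]]|[A1 [mA1 [A2 [mA2 ->]]]]].
    by exists A1; split => //; exists A2.
  by exists A1 => //; exists A2.
- move=> /= _ _ [X1 [mX1 [X2 [mX2 ->]]]] [Y1 [mY1 [Y2 [mY2 ->]]]].
  rewrite -setXI; exists (X1 `&` Y1); split; first exact: measurableI.
  by exists (X2 `&` Y2); split => //; exact: measurableI.
- by move=> _; exists setT; split => //; exists setT; split => //; rewrite setXTT.
- by rewrite bigcup_const//; exists 0.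
- move=> _ [A1 [mA1 [A2 [mA2 ->]]]]; rewrite /=.
  rewrite [LHS](rhoE mA1 mA2)/= /kcomp/=.
  rewrite integral_mkcond; apply: eq_integral => x _.
  rewrite /patch/= /graph_kernel/= /pushforward/=; case: ifPn => [|] xA.
    by congr (k x _); apply/seteqP; split => y //=; [rewrite inE in xA|case].
  rewrite (_ : _ @^-1` _ = set0) ?measure0//; apply/seteqP; split => y //= -[A1x _].
  by move/negP: xA; apply; exact: mem_set.
- by move=> _; rewrite [X in (X < _)%E](_ : _ = 1%E) ?ltry//; exact: probability_setT.
Qed.

End disintegration.

Section regression_noise.
Context {d} {X : measurableType d} {R : realType}.
Variables (rho : probability (X * R)%type R) (nu : probability X R) (k : R.-pker X ~> R).
Hypothesis nuE : is_marginal rho nu.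
Hypothesis rhoE : is_conditional rho nu k.

Lemma integral_marginal (F : X -> \bar R) : measurable_fun setT F ->
  (forall x, 0 <= F x)%E -> (\int[rho]_z F z.1 = \int[nu]_x F x)%E.
Proof.
move=> mF F0; rewrite -(ge0_integral_pushm rho measurable_fst)//.
apply: eq_measure_integral => A mA _; rewrite /= nuE//.
by congr (rho _); apply/seteqP; split => -[x y]//= [].
Qed.

Lemma integrable_marginal (f : X -> R) : nu.-integrable setT (EFin \o f) ->
  rho.-integrable setT (EFin \o (fun z => f z.1)).
Proof.
move=> /integrableP[mf foo]; apply/integrableP; split.
  exact: measurableT_comp mf measurable_fst.
rewrite (integral_marginal (F := fun x => `|(f x)%:E|%E))//.
exact: measurableT_comp.
Qed.

Lemma integral_marginal_EFin (f : X -> R) : measurable_fun setT f ->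
  (\int[rho]_z (f z.1)%:E = \int[nu]_x (f x)%:E)%E.
Proof.
move=> mf; have mf' : measurable_fun setT (EFin \o f) by exact/measurable_EFinP.
rewrite [LHS]integralE [RHS]integralE; congr (_ - _)%E.
  rewrite -(integral_marginal (measurable_funepos mf'))//.
  by apply: eq_integral => z _; rewrite !funeposE.
rewrite -(integral_marginal (measurable_funeneg mf'))//.
by apply: eq_integral => z _; rewrite !funenegE.
Qed.

Variables (g : X -> R) (s2 : R).
Hypothesis mg : measurable_fun setT g.
Hypothesis gE : {ae nu, forall x, regression k x = g x}.
Hypothesis s20 : 0 <= s2.
Hypothesis var : {ae nu, forall x, (\int[k x]_y ((y - g x) ^+ 2)%:E <= s2%:E)%E}.

Let eps (z : X * R) : R := z.2 - g z.1.

Lemma measurable_noise : measurable_fun setT eps.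
Proof. by apply: measurable_funB => //; exact: measurableT_comp mg measurable_fst. Qed.

Lemma noise_variance (phi : X -> R) : measurable_fun setT phi -> (forall x, 0 <= phi x) ->
  (\int[rho]_z (eps z ^+ 2 * phi z.1)%:E <= s2%:E * \int[nu]_x (phi x)%:E)%E.
Proof.
move=> mphi phi0.
have me := measurable_noise.
have meps2 : measurable_fun setT (fun z => ((eps z) ^+ 2)%:E).
  by apply/measurable_EFinP; exact: measurable_funX.
rewrite (disintegration rhoE); last 2 first.
- apply/measurable_EFinP; apply: measurable_funM; first exact: measurable_funX.
  exact: measurableT_comp mphi measurable_fst.
- by move=> z; rewrite lee_fin mulr_ge0// sqr_ge0.
have mcond : measurable_fun setT (fun x => (\int[k x]_y (eps (x, y) ^+ 2)%:E)%E).
  by apply: (measurable_kfcomp k meps2) => z; rewrite lee_fin sqr_ge0.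
have mphiE : measurable_fun setT (fun x => (phi x)%:E) by exact/measurable_EFinP.
have innerE x : (\int[k x]_y (eps (x, y) ^+ 2 * phi x)%:E =
    (phi x)%:E * \int[k x]_y (eps (x, y) ^+ 2)%:E)%E.
  under eq_integral do rewrite mulrC EFinM.
  rewrite ge0_integralZl ?lee_fin//.
  + exact: (measurable_fun_pair2 x meps2).
  + by move=> y _; rewrite lee_fin sqr_ge0.
rewrite -ge0_integralZl//; last by move=> x _; rewrite lee_fin.
apply: ae_ge0_le_integral => //.
- by move=> x _; apply: integral_ge0 => y _; rewrite lee_fin mulr_ge0// sqr_ge0.
- rewrite (_ : (fun x => _) = (fun x => (phi x)%:E * \int[k x]_y (eps (x, y) ^+ 2)%:E)%E).
    exact: emeasurable_funM.
  exact/funext.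
- by move=> x _; rewrite mule_ge0// lee_fin.
- exact: measurable_funeM.
- move: var; apply: filterS => x /= vx _; rewrite innerE muleC.
  by rewrite lee_wpmul2r// lee_fin.
Qed.

Lemma integrable_noise2 : rho.-integrable setT (fun z => (eps z ^+ 2)%:E).
Proof.
apply/integrableP; split.
  by apply/measurable_EFinP; apply: measurable_funX; exact: measurable_noise.
rewrite (_ : (fun x => _) = (fun z => (eps z ^+ 2 * (cst 1 z.1))%:E)); last first.
  by apply/funext => z; rewrite mulr1 gee0_abs// lee_fin sqr_ge0.
apply: (le_lt_trans (noise_variance (phi := cst 1) _ _)) => //.
by rewrite integral_cst_prob mule1 ltry.
Qed.

Lemma integrable_noiseM (phi : X -> R) (B : R) : measurable_fun setT phi ->
  (forall x, `|phi x| <= B) -> rho.-integrable setT (fun z => (eps z * phi z.1)%:E).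
Proof.
move=> mphi phiB.
have B0 : 0 <= B by apply: le_trans (phiB point).
have := integrableD measurableT integrable_noise2 (finite_measure_integrable_cst rho 1 measurableT).
move=> /(integrableZl measurableT B); apply: le_integrable => //.
  apply/measurable_EFinP; apply: measurable_funM; first exact: measurable_noise.
  exact: measurableT_comp mphi measurable_fst.
move=> z _; rewrite /= lee_fin normrM mulrC [leRHS]ger0_norm; last first.
  by rewrite mulr_ge0// addr_ge0// sqr_ge0.
apply: ler_pM => //; rewrite -[X in _ <= X + _]real_normK ?num_real//.
(* [|eps| <= eps ^ 2 + 1/4], so square integrability suffices. *)
by move: `|eps z| => e; have := sqr_ge0 (e - 2^-1); rewrite !expr2; lra.
Qed.

(** [disintegration] wants nonnegative integrands, so the positive and negative parts are treated
    separately. Their conditional integrals agree at almost every [x], where finite variance makes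
    [y] integrable under [k x] with mean [g x]. *)
Lemma noise_centered (phi : X -> R) (B : R) : measurable_fun setT phi ->
  (forall x, `|phi x| <= B) -> (\int[rho]_z (eps z * phi z.1)%:E = 0)%E.
Proof.
move=> mphi phiB.
have int := integrable_noiseM mphi phiB.
pose F z := (eps z * phi z.1)%:E.
have {}int : rho.-integrable setT F by [].
have [mF _] := integrableP _ _ _ int.
rewrite -/(\int[rho]_z F z)%E.
have condE : {ae nu, forall x, (\int[k x]_y (F^\+ (x, y)) = \int[k x]_y (F^\- (x, y)))%E}.
  move: gE var; apply: filterS2 => x gx vx.
  have icst c : (k x).-integrable setT (fun=> c%:E).
    apply/integrableP; split; first exact: measurable_cst.
    under eq_integral do rewrite /=.
    by rewrite integral_cst// prob_kernel mule1 ltry.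
  have mkx : (k x).-integrable setT (fun y => (y - g x)%:E).
    have h2 : (k x).-integrable setT (fun y => ((y - g x) ^+ 2)%:E).
      apply/integrableP; split.
        apply/measurable_EFinP; apply: measurable_funX.
        by apply: measurable_funB => //; exact: measurable_cst.
      under eq_integral do rewrite gee0_abs ?lee_fin ?sqr_ge0//.
      by apply: (le_lt_trans vx); rewrite ltry.
    have := integrableD measurableT h2 (icst 1).
    apply: le_integrable => //.
      by apply/measurable_EFinP; apply: measurable_funB => //; exact: measurable_cst.
    move=> y _; rewrite /= lee_fin [leRHS]ger0_norm; last by rewrite addr_ge0// sqr_ge0.
    rewrite -[X in _ <= X + _]real_normK ?num_real//.
    by move: `|y - g x| => e; have := sqr_ge0 (e - 2^-1); rewrite !expr2; lra.
  have my : (k x).-integrable setT (fun y => y%:E).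
    have := integrableD measurableT mkx (icst (g x)).
    by apply: eq_integrable => // y _ /=; rewrite -EFinD subrK.
  have mean0 : (\int[k x]_y (y - g x)%:E = 0)%E.
    under eq_integral do rewrite EFinB.
    rewrite integralB_EFin//; last exact: icst.
    rewrite integral_cst// prob_kernel mule1 -gx /regression /Rintegral fineK ?subee//.
      exact: integrable_fin_num.
    exact: integrable_fin_num.
  have FE : (\int[k x]_y F (x, y) = 0)%E.
    rewrite /F/=; under eq_integral do rewrite mulrC EFinM.
    by rewrite integralZl// mean0 mule0.
  have Fint : (k x).-integrable setT (fun y => F (x, y)).
    have := integrableZl measurableT (phi x) mkx.
    by apply: eq_integrable => // y _ /=; rewrite /F/= mulrC EFinM.
  move: FE; rewrite integralE => /eqP; rewrite sube_eq ?add0e.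
  - move=> /eqP h; transitivity (\int[k x]_y (fun y => F (x, y))^\+ y)%E.
      by apply: eq_integral => y _; rewrite !funeposE.
    by rewrite h; apply: eq_integral => y _; rewrite !funenegE.
  - exact: integrable_pos_fin_num.
  - exact: fin_num_adde_defr.
rewrite integralE (disintegration rhoE (measurable_funepos mF))//.
rewrite (disintegration rhoE (measurable_funeneg mF))//.
have mk G : measurable_fun setT G -> (forall z, 0 <= G z)%E ->
    measurable_fun setT (fun x => \int[k x]_y G (x, y))%E.
  by move=> mG G0; exact: (measurable_kfcomp k mG G0).
rewrite (ae_eq_integral (fun x => \int[k x]_y F^\- (x, y))%E)//.
- rewrite subee//.
  rewrite -(disintegration rhoE (measurable_funeneg mF))//.
  exact: integrable_neg_fin_num.
- by apply: mk => //; exact: measurable_funepos.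
- by apply: mk => //; exact: measurable_funeneg.
- by move: condE; apply: filterS => x Fx _.
Qed.

Lemma measurable_regression : measurable_fun setT (regression k).
Proof.
rewrite /regression /Rintegral.
apply: (measurableT_comp (f := fine) (fine_measurable measurableT)).
rewrite (_ : (fun x => _) = (fun x => \int[k x]_y (EFin : R -> \bar R)^\+ y
    - \int[k x]_y (EFin : R -> \bar R)^\- y)%E); last first.
  by apply/funext => x; rewrite integralE.
apply: emeasurable_funB; apply: measurable_fun_integral_kernel => //.
- by move=> U; exact: measurable_kernel.
- by apply: measurable_funepos; exact: EFin_measurable.
- by move=> U; exact: measurable_kernel.
- by apply: measurable_funeneg; exact: EFin_measurable.
Qed.

Lemma risk_regression : risk rho (regression k) = (\int[rho]_z (eps z ^+ 2)%:E)%E.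
Proof.
apply: ae_eq_integral => //.
- apply/measurable_EFinP; apply: measurable_funX; apply: measurable_funB => //.
  exact: measurableT_comp measurable_regression measurable_fst.
- by apply/measurable_EFinP; apply: measurable_funX; exact: measurable_noise.
- case: gE => A [mA nuA gA]; exists (A `*` setT); split.
  + exact: measurableX.
  + by rewrite -[LHS](nuE mA).
  + move=> -[x y] /= nE; split => //; apply: gA => /= gx; apply: nE => _.
    by rewrite /eps/= gx -sqrrN opprB.
Qed.

(** Bias-variance decomposition: the cross term is centered noise against a bounded function of the
    input, and the noise term, being finite, may be subtracted. *)
Lemma excess_riskE (f : X -> R) (B : R) : measurable_fun setT f ->
  (forall x, `|f x - g x| <= B) ->
  (risk rho f - risk rho (regression k) = \int[nu]_x ((f x - g x) ^+ 2)%:E)%E.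
Proof.
move=> mf fB.
have md : measurable_fun setT (fun x => f x - g x) by exact: measurable_funB.
have int2 := integrable_noise2.
have i2 : rho.-integrable setT (fun z => (-2 * (eps z * (f z.1 - g z.1)))%:E).
  by have := integrableZl measurableT (-2) (integrable_noiseM md fB).
have nud : nu.-integrable setT (fun x => ((f x - g x) ^+ 2)%:E).
  apply: (@bounded_integrable _ _ _ _ _ (B ^+ 2)); first exact: measurable_funX.
  move=> x; rewrite normrX ler_sqr ?nnegrE//.
  exact: le_trans (fB x).
have i3 := integrable_marginal nud.
rewrite risk_regression /risk.
rewrite (_ : (fun z => _) = (fun z => (eps z ^+ 2)%:E +
   ((-2 * (eps z * (f z.1 - g z.1)))%:E + ((f z.1 - g z.1) ^+ 2)%:E))%E); last first.
  apply/funext => z; rewrite -!EFinD; congr EFin; rewrite /eps; ring.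
rewrite integralD//; last exact: integrableD.
rewrite integralD//.
rewrite (_ : (\int[rho]_z (-2 * (eps z * (f z.1 - g z.1)))%:E = 0)%E); last first.
  under eq_integral do rewrite EFinM.
  by rewrite integralZl ?(noise_centered md fB) ?mule0//; exact: integrable_noiseM fB.
rewrite add0e addeAC subee ?add0e; last exact: integrable_fin_num.
rewrite (integral_marginal (F := fun x => ((f x - g x) ^+ 2)%:E))//.
- by apply/measurable_EFinP; exact: measurable_funX.
- by move=> x; rewrite lee_fin sqr_ge0.
Qed.

End regression_noise.

(** * Resampling one coordinate of an i.i.d. tuple *)

Section resampling.
Context {d} {Z : measurableType d} {R : realType} (n : nat).
Variables (rho : probability Z R) (mu : probability (n.-tuple Z) R).

Definition box (A : 'I_n -> set Z) : set (n.-tuple Z) :=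
  [set w | forall i, A i (tnth w i)].

Lemma measurable_box A : (forall i, measurable (A i)) -> measurable (box A).
Proof.
move=> mA; rewrite (_ : box A = \bigcap_(i in [set: 'I_n]) ((@tnth n Z ^~ i) @^-1` A i)).
  apply: fin_bigcap_measurable => // i _.
  rewrite -[X in measurable X]setTI; exact: measurable_tnth.
by apply/seteqP; split => w /= wA i; [move=> _; exact: wA|exact: wA].
Qed.

Definition boxes := [set box A | A in [set A | forall i, measurable (A i)]].

Lemma boxT : box (fun=> setT) = setT.
Proof. by apply/seteqP; split. Qed.

Lemma measurable_boxes : @measurable _ (n.-tuple Z) = <<s boxes >>.
Proof.
apply/seteqP; split => [A mA|]; last first.
  apply: smallest_sub; first exact: sigma_algebra_measurable.
  by move=> _ [A mA <-]; exact: measurable_box.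
pose W := g_sigma_algebraType boxes.
have mid : measurable_fun [set: W] (id : W -> n.-tuple Z).
  apply/measurable_fun_tnthP => i _ B mB; rewrite setTI; apply: sub_sigma_algebra.
  exists (fun j => if j == i then B else setT); first by move=> j /=; case: ifP.
  apply/seteqP; split => w /= wB; first by have := wB i; rewrite eqxx.
  by move=> j; case: eqP => // ->.
by have := mid measurableT A mA; rewrite setTI.
Qed.

Lemma boxes_setI : setI_closed boxes.
Proof.
move=> _ _ [A mA <-] [B mB <-]; exists (fun i => A i `&` B i).
  by move=> i; apply: measurableI; [exact: mA|exact: mB].
by apply/seteqP; split => w /= wAB; [split => i; case: (wAB i)|move: wAB => -[wA wB] i; split].
Qed.

Lemma boxes_unique (m1 m2 : {measure set (n.-tuple Z) -> \bar R}) :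
  (forall A, (forall i, measurable (A i)) -> m1 (box A) = m2 (box A)) ->
  (m1 setT < +oo)%E -> forall A, measurable A -> m1 A = m2 A.
Proof.
move=> m12 m1oo A mA; apply: (measure_unique boxes (fun=> setT)) => //.
- exact: measurable_boxes.
- exact: boxes_setI.
- by move=> _; exists (fun=> setT) => //; exact: boxT.
- by rewrite bigcup_const//; exists 0.
- by move=> _ [B mB <-]; exact: m12.
Qed.

Definition upd (k : 'I_n) (w : n.-tuple Z) (z : Z) : n.-tuple Z :=
  [tuple if i == k then z else tnth w i | i < n].

Lemma tnth_upd k w z i : tnth (upd k w z) i = if i == k then z else tnth w i.
Proof. by rewrite tnth_mktuple. Qed.

Lemma measurable_upd k : measurable_fun [set: n.-tuple Z * Z] (fun p => upd k p.1 p.2).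
Proof.
apply/measurable_fun_tnthP => i.
rewrite (_ : _ \o _ = if i == k then snd else (@tnth n Z ^~ i) \o fst).
  case: ifP => _ //; apply: measurableT_comp => //; exact: measurable_tnth.
by apply/funext => p /=; rewrite tnth_upd; case: ifP.
Qed.

Hypothesis muE : forall A : 'I_n -> set Z, (forall i, measurable (A i)) ->
  mu (box A) = (\prod_(i < n) rho (A i))%E.

(** Overwriting one coordinate by a fresh draw preserves the law. Independence enters the moment
    estimates in this form: a coordinate is integrated out with the others frozen, without splitting
    the tuple. *)
Lemma resample k (F : n.-tuple Z -> \bar R) : measurable_fun setT F ->
  (forall w, 0 <= F w)%E ->
  (\int[mu]_w F w = \int[mu]_w \int[rho]_z F (upd k w z))%E.
Proof.
move=> mF F0; rewrite -(fubini_tonelli1 (fun p => F (upd k p.1 p.2)))//; last first.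
  exact: measurableT_comp mF (measurable_upd k).
rewrite -(ge0_integral_pushm (mu \x rho)%E (measurable_upd k))//.
apply: eq_measure_integral => A mA _; apply: boxes_unique mA => [B mB|]; last first.
  by rewrite [X in (X < _)%E](_ : _ = 1%E) ?ltry//; exact: probability_setT.
rewrite [LHS]muE//= /pushforward.
rewrite (_ : _ @^-1` _ = box (fun i => if i == k then setT else B i) `*` B k).
  rewrite product_measure1E//; last first.
    by apply: measurable_box => i; case: ifP.
  rewrite [X in (_ = X * _)%E](_ : _ = \prod_(i < n) rho (if i == k then setT else B i))%E; last first.
    by apply: muE => i; case: ifP.
  rewrite (bigD1 k)//= [in RHS](bigD1 k)//= eqxx probability_setT mul1e muleC.
  by congr (_ * _)%E; apply: eq_bigr => i /negbTE ->.
apply/seteqP; split => -[w z]/=.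
  move=> wB; split; last by have := wB k; rewrite tnth_upd eqxx.
  by move=> i; have := wB i; rewrite tnth_upd; case: eqP.
by move=> [wB zB] i; rewrite tnth_upd; have := wB i; case: eqP => // ->.
Qed.

Lemma le_resample k (F G : n.-tuple Z -> \bar R) :
  measurable_fun setT F -> measurable_fun setT G ->
  (forall w, 0 <= F w)%E -> (forall w, 0 <= G w)%E ->
  (forall w, \int[rho]_z F (upd k w z) <= \int[rho]_z G (upd k w z))%E ->
  (\int[mu]_w F w <= \int[mu]_w G w)%E.
Proof.
move=> mF mG F0 G0 FG; rewrite (resample k mF F0) (resample k mG G0).
have mr (P : n.-tuple Z -> \bar R) : measurable_fun setT P -> (forall w, 0 <= P w)%E ->
    measurable_fun setT (fun w => \int[rho]_z P (upd k w z))%E.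
  move=> mP P0; apply: (measurable_fun_fubini_tonelli_F (fun p => P (upd k p.1 p.2))) => //.
  exact: measurableT_comp mP (measurable_upd k).
apply: ge0_le_integral => //.
- by move=> w _; exact: integral_ge0.
- exact: mr.
- exact: mr.
Qed.

Lemma integral_coord k (f : Z -> \bar R) : measurable_fun setT f ->
  (forall z, 0 <= f z)%E -> (\int[mu]_w f (tnth w k) = \int[rho]_z f z)%E.
Proof.
move=> mf f0; rewrite (resample k (F := fun w => f (tnth w k)))//; last first.
  exact: measurableT_comp mf (measurable_tnth k).
under eq_integral do under eq_integral do rewrite tnth_upd eqxx.
by rewrite integral_cst// [X in (_ * X)%E](_ : _ = 1%E) ?mule1//; exact: probability_setT.
Qed.

End resampling.

(** * Moments of degenerate quadratic forms *)

Section psd_kernels.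
Context {R : realType} {Z : Type}.
Implicit Types (K : Z -> Z -> R) (s : seq Z).

(** The list may repeat points, so it can be the sample itself. *)
Definition psd_kernel K := (forall a b, K a b = K b a) /\
  forall s : seq (R * Z), 0 <= \sum_(p <- s) \sum_(q <- s) p.1 * q.1 * K p.2 q.2.

(** An unnormalised V-statistic: the diagonal is included, which keeps it nonnegative for a psd
    kernel. *)
Definition quad K s : R := \sum_(a <- s) \sum_(b <- s) K a b.
Definition lin K s z : R := \sum_(a <- s) K a z.

Lemma quad_nil K : quad K [::] = 0.
Proof. by rewrite /quad big_nil. Qed.

Lemma quad_bounded K C s : (forall a b, `|K a b| <= C) -> quad K s <= (size s)%:R ^+ 2 * C.
Proof.
move=> KC; rewrite /quad expr2 -mulrA -sum1_size natr_sum mulr_suml; apply: ler_sum => z _.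
rewrite mul1r mulr_suml; apply: ler_sum => z' _; rewrite mul1r.
exact: le_trans (ler_norm _) _.
Qed.

Variable K : Z -> Z -> R.
Hypothesis Kpsd : psd_kernel K.

Lemma psd_sym a b : K a b = K b a. Proof. by case: Kpsd. Qed.

Lemma quad_cons z s : quad K (z :: s) = quad K s + 2 * lin K s z + K z z.
Proof.
rewrite /quad big_cons big_cons; under [in X in _ + X]eq_bigr do rewrite big_cons.
rewrite big_split/= -/(quad K s) -/(lin K s z).
rewrite (_ : \sum_(j <- s) K z j = lin K s z); first by ring.
by apply: eq_bigr => a _; exact: psd_sym.
Qed.

Lemma quad_ge0 s : 0 <= quad K s.
Proof.
case: Kpsd => _ /(_ [seq (1, z) | z <- s]); rewrite big_map; congr (_ <= _).
by apply: eq_bigr => a _; rewrite big_map; apply: eq_bigr => b _ /=; rewrite !mul1r.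
Qed.

Lemma psd_diag z : 0 <= K z z.
Proof. by have := quad_ge0 [:: z]; rewrite /quad !big_cons !big_nil !addr0. Qed.

(** Positivity of [K] on the list [s] with unit weights, enlarged by [z] with weight [t]. *)
Lemma lin_CS s z : lin K s z ^+ 2 <= quad K s * K z z.
Proof.
apply: psd_disc; first exact: psd_diag.
move=> t; case: Kpsd => _ /(_ ((t, z) :: [seq (1, z) | z <- s])).
rewrite !big_cons !big_map; congr (_ <= _).
under [in X in _ + X]eq_bigr do rewrite big_cons big_map/=.
rewrite big_split/=.
rewrite (_ : \sum_(j <- s) t * 1 * K z j = t * lin K s z); last first.
  by rewrite mulr_sumr; apply: eq_bigr => a _; rewrite mulr1 psd_sym.
rewrite (_ : \sum_(i <- s) 1 * t * K i z = t * lin K s z); last first.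
  by rewrite mulr_sumr; apply: eq_bigr => a _; rewrite mul1r.
rewrite (_ : \sum_(i <- s) \sum_(j <- s) 1 * 1 * K i j = quad K s); last first.
  by apply: eq_bigr => a _; apply: eq_bigr => b _; rewrite !mul1r.
by ring.
Qed.

Lemma psd_CS a b : K a b ^+ 2 <= K a a * K b b.
Proof.
by have := lin_CS [:: a] b; rewrite /lin /quad !big_cons !big_nil !addr0.
Qed.

Lemma quad_cons_le z s : quad K (z :: s) <= 2 * quad K s + 2 * K z z.
Proof.
rewrite quad_cons; have := lin_CS s z; have := quad_ge0 s; have := psd_diag z.
move: (quad K s) (lin K s z) (K z z) => V L k k0 V0 LVk.
have : L <= (V + k) / 2.
  have [L0|L0] := leP L 0; first by apply: (le_trans L0); rewrite divr_ge0// addr_ge0.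
  rewrite -ler_sqr ?nnegrE ?divr_ge0 ?addr_ge0// ?(ltW L0)//.
  by apply: (le_trans LVk); have := sqr_ge0 (V - k); rewrite !expr2; lra.
lra.
Qed.

(** The term [4 V L] is kept exact because it averages to zero over [z]; the others use
    [L ^ 2 <= V k] and [4 L k <= 2 V k + 2 k ^ 2]. *)
Lemma quad_cons_sq_le z s : quad K (z :: s) ^+ 2 <=
  quad K s ^+ 2 + 4 * quad K s * lin K s z + 8 * quad K s * K z z + 3 * K z z ^+ 2.
Proof.
rewrite quad_cons; have := lin_CS s z; have := quad_ge0 s; have := psd_diag z.
move: (quad K s) (lin K s z) (K z z) => V L k k0 V0 LVk.
have Lk : 4 * L * k <= 2 * V * k + 2 * k ^+ 2.
  suff : L <= (V + k) / 2.
    by move=> /(ler_wpM2r k0); rewrite expr2; lra.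
  have [L0|L0] := leP L 0; first by apply: (le_trans L0); rewrite divr_ge0// addr_ge0.
  rewrite -ler_sqr ?nnegrE ?divr_ge0 ?addr_ge0// ?(ltW L0)//.
  by apply: (le_trans LVk); have := sqr_ge0 (V - k); rewrite !expr2; lra.
have -> : (V + 2 * L + k) ^+ 2 = V ^+ 2 + 4 * V * L + 2 * V * k + 4 * L ^+ 2 + 4 * L * k + k ^+ 2.
  by ring.
by move: LVk Lk; rewrite !expr2; lra.
Qed.

End psd_kernels.

Section tuple_moments.
Context {d} {Z : measurableType d} {R : realType} (n : nat).
Variables (rho : probability Z R) (mu : probability (n.-tuple Z) R).
Hypothesis muE : forall A : 'I_n -> set Z, (forall i, measurable (A i)) ->
  mu (box A) = (\prod_(i < n) rho (A i))%E.
Implicit Types (J : seq 'I_n) (w : n.-tuple Z).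

Definition pts J w : seq Z := [seq tnth w i | i <- J].

Lemma pts_upd k J w z : k \notin J -> pts J (upd k w z) = pts J w.
Proof.
move=> kJ; apply/eq_in_map => i iJ; rewrite tnth_upd.
by case: eqP => // ik; move: kJ; rewrite -ik iJ.
Qed.

Lemma pts_cons_upd k J w z : k \notin J -> pts (k :: J) (upd k w z) = z :: pts J w.
Proof. by move=> kJ; rewrite /= tnth_upd eqxx -/(pts _ _) pts_upd. Qed.

Lemma expect_le_step k (F G : n.-tuple Z -> R) A :
  measurable_fun setT F -> (forall w, 0 <= F w) -> expect_le mu G A ->
  (forall w, \int[rho]_z (F (upd k w z))%:E <= \int[rho]_z (G (upd k w z))%:E)%E ->
  expect_le mu F A.
Proof.
move=> mF F0 [mG G0 GA] FG; split => //; apply: le_trans GA.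
apply: (le_resample muE (k := k) (F := EFin \o F) (G := EFin \o G)) => //.
- exact/measurable_EFinP.
- exact/measurable_EFinP.
Qed.

Lemma expect_le_coord k f A : expect_le rho f A ->
  expect_le mu (fun w => f (tnth w k)) A.
Proof.
move=> [mf f0 fA]; split => //.
  exact: measurableT_comp mf (measurable_tnth k).
rewrite (integral_coord muE k (f := EFin \o f))//.
exact/measurable_EFinP.
Qed.

Lemma expect_le_coordM k F f A B : expect_le mu F A -> expect_le rho f B ->
  (forall w z, F (upd k w z) = F w) ->
  expect_le mu (fun w => F w * f (tnth w k)) (A * B).
Proof.
move=> FA fB Fk; have B0 := expect_le_ge0 fB.
have [mF F0 _] := FA; have [mf f0 fBi] := fB.
apply: (expect_le_step (k := k) (G := fun w => B * F w)) => //.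
- by apply: measurable_funM => //; exact: measurableT_comp mf (measurable_tnth k).
- by move=> w; rewrite mulr_ge0.
- by rewrite mulrC; exact: expect_leZ.
- move=> w; under eq_integral do rewrite Fk tnth_upd eqxx EFinM.
  under [leRHS]eq_integral do rewrite Fk.
  rewrite ge0_integralZl//; last 3 first.
  + exact/measurable_EFinP.
  + by move=> z _; rewrite lee_fin.
  + by rewrite lee_fin.
  rewrite integral_cst_prob mulrC EFinM.
  by rewrite lee_wpmul2l// lee_fin.
Qed.

Section kernel_moments.
Variables (K : Z -> Z -> R) (B m1 : R).
Hypothesis mK : measurable_fun setT (fun p : Z * Z => K p.1 p.2).
Hypothesis Kpsd : psd_kernel K.

Lemma measurable_diag : measurable_fun setT (fun z => K z z).
Proof.
apply: (measurableT_comp mK (g := fun z => (z, z))).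
by apply: measurable_fun_pair; exact: measurable_id.
Qed.

Lemma measurable_quad J : measurable_fun setT (fun w => quad K (pts J w)).
Proof.
rewrite (_ : (fun w => _) = (fun w => \sum_(i <- J) \sum_(j <- J) K (tnth w i) (tnth w j))).
  apply: measurable_sum => i; apply: measurable_sum => j.
  apply: (measurableT_comp mK (g := fun w => (tnth w i, tnth w j))).
  by apply: measurable_fun_pair; exact: measurable_tnth.
apply/funext => w; rewrite /quad /pts big_map; apply: eq_bigr => i _.
by rewrite big_map.
Qed.

Hypothesis KB : forall z, K z z <= B.
Hypothesis Km1 : expect_le rho (fun z => K z z) m1.
Hypothesis Kdeg : forall a, (\int[rho]_z (K a z)%:E = 0)%E.

Let B0 : 0 <= B. Proof. exact: le_trans (psd_diag Kpsd point) (KB point). Qed.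

Lemma psd_bounded a z : `|K a z| <= B.
Proof.
rewrite -ler_sqr ?nnegrE// real_normK ?num_real//.
apply: (le_trans (psd_CS Kpsd a z)).
by rewrite expr2; apply: ler_pM => //; exact: psd_diag.
Qed.

Lemma integrable_lin s : rho.-integrable setT (fun z => (lin K s z)%:E).
Proof.
apply: (@bounded_integrable _ _ _ _ _ ((size s)%:R * B)).
  apply: measurable_sum => a; exact: (measurable_fun_pair2 a mK).
move=> z; apply: (le_trans (ler_norm_sum _ _ _)).
rewrite -sum1_size natr_sum mulr_suml; apply: ler_sum => a _.
by rewrite mul1r psd_bounded.
Qed.

Lemma integral_lin s : (\int[rho]_z (lin K s z)%:E = 0)%E.
Proof.
elim: s => [|a s IH].
  by rewrite (_ : (fun z => _) = cst 0%E) ?integral0//; apply/funext => z; rewrite /lin big_nil.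
rewrite (_ : (fun z => _) = (fun z => (K a z)%:E + (lin K s z)%:E)%E); last first.
  by apply/funext => z; rewrite /lin big_cons EFinD.
rewrite integralD ?Kdeg ?IH ?adde0//; last exact: integrable_lin.
apply: (@bounded_integrable _ _ _ _ _ B); last exact: psd_bounded.
exact: (measurable_fun_pair2 a mK).
Qed.

(* Adding a multiple of the centered [lin K s] does not change an integral. *)
Lemma lin_expect_le s (c : R) (f g : Z -> R) A : expect_le rho g A ->
  measurable_fun setT f -> (forall z, 0 <= f z) -> rho.-integrable setT (EFin \o g) ->
  (forall z, f z <= c * lin K s z + g z) -> expect_le rho f A.
Proof.
move=> [mg g0 gA] mf f0 ig fg; split => //; apply: le_trans gA.
have il := integrableZl measurableT c (integrable_lin s).
have iS := integrableD measurableT il ig.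
have -> : (\int[rho]_z (g z)%:E = \int[rho]_z (c%:E * (lin K s z)%:E + (g z)%:E))%E.
  by rewrite integralD// integralZl ?integral_lin ?mule0 ?add0e//; exact: integrable_lin.
apply: ge0_le_integral => //.
- by move=> z _; rewrite lee_fin.
- exact/measurable_EFinP.
- by have [] := integrableP _ _ _ iS.
- by move=> z _; rewrite -EFinM -EFinD lee_fin.
Qed.

Let integrable_diag : rho.-integrable setT (EFin \o (fun z => K z z)).
Proof.
apply: (@bounded_integrable _ _ _ _ _ B); first exact: measurable_diag.
by move=> z; exact: psd_bounded.
Qed.

(** Induction on the index list, integrating out the new point: by degeneracy the terms linear in
    [lin] vanish, so the mean grows by [m1] and the second moment by [8 m1] times the mean plus
    [3 B m1]. *)
Lemma quad_moments J : uniq J ->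
  expect_le mu (fun w => quad K (pts J w)) ((size J)%:R * m1) /\
  expect_le mu (fun w => quad K (pts J w) ^+ 2)
    (4 * (size J)%:R ^+ 2 * m1 ^+ 2 + 3 * (size J)%:R * B * m1).
Proof.
have m10 := expect_le_ge0 Km1.
elim: J => [_|k J IH /andP[kJ uJ]].
  split.
    rewrite (_ : (fun w => _) = (fun=> 0)) ?mul0r; last first.
      by apply/funext => w; rewrite quad_nil.
    exact: expect_le_cst.
  rewrite (_ : (fun w => _) = (fun=> 0)); last first.
    by apply/funext => w; rewrite quad_nil expr0n.
  by apply: (expect_le_trans (expect_le_cst mu (lexx 0))); rewrite expr0n/= !(mulr0, mul0r) addr0.
have [E1 E2] := IH uJ.
have mq := measurable_quad.
have size_cons : (size (k :: J))%:R = (size J)%:R + 1 :> R by rewrite /= natr1.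
have mz w : measurable_fun setT (fun z => quad K (z :: pts J w)).
  rewrite (_ : (fun z => _) = (fun z => quad K (pts J w) + 2 * lin K (pts J w) z + K z z)).
    apply: measurable_funD; last exact: measurable_diag.
    apply: measurable_funD; first exact: measurable_cst.
    apply: measurable_funM; first exact: measurable_cst.
    by apply: measurable_sum => a; exact: (measurable_fun_pair2 a mK).
  by apply/funext => z; rewrite quad_cons.
have q0 := quad_ge0 Kpsd.
split.
  apply: (expect_le_step (k := k) (G := fun w => quad K (pts J w) + m1)) => //.
    by rewrite size_cons mulrDl mul1r; apply: expect_leD => //; exact: expect_le_cst.
  move=> w; under eq_integral do rewrite pts_cons_upd//.
  under [leRHS]eq_integral do rewrite pts_upd//.
  rewrite integral_cst_prob.
  have [] // := @lin_expect_le (pts J w) 2 (fun z => quad K (z :: pts J w))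
    (fun z => quad K (pts J w) + K z z) (quad K (pts J w) + m1).
  - by apply: expect_leD => //; exact: expect_le_cst.
  - apply: (@bounded_integrable _ _ _ _ _ (quad K (pts J w) + B)).
      by apply: measurable_funD => //; exact: measurable_diag.
    move=> z; rewrite ger0_norm; first by rewrite lerD2l.
    by rewrite addr_ge0//; exact: psd_diag.
  - by move=> z; rewrite (quad_cons Kpsd); lra.
set V := fun w => quad K (pts J w).
apply: (expect_le_step (k := k)
    (G := fun w => V w ^+ 2 + (8 * m1) * V w + 3 * B * m1)) => //.
- exact: measurable_funX.
- by move=> w; exact: sqr_ge0.
- apply: (@expect_le_trans _ _ _ _ _ (4 * (size J)%:R ^+ 2 * m1 ^+ 2 + 3 * (size J)%:R * B * m1
    + (8 * m1) * ((size J)%:R * m1) + 3 * B * m1)).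
    apply: expect_leD; last by apply: expect_le_cst; rewrite !mulr_ge0.
    by apply: expect_leD => //; apply: expect_leZ => //; rewrite mulr_ge0.
  (* The induction closes because [4 c ^ 2 + 8 c <= 4 (c + 1) ^ 2]. *)
  rewrite size_cons; have := sqr_ge0 m1; rewrite !expr2.
  by move: (size J)%:R => c; lra.
- move=> w; under eq_integral do rewrite pts_cons_upd//.
  rewrite /V; under [leRHS]eq_integral do rewrite pts_upd//.
  rewrite integral_cst_prob -/(V w).
  have V0 : 0 <= V w by exact: q0.
  have c0 : 0 <= 8 * V w + 3 * B by rewrite addr_ge0// mulr_ge0.
  have [] // := @lin_expect_le (pts J w) (4 * V w) (fun z => quad K (z :: pts J w) ^+ 2)
    (fun z => V w ^+ 2 + (8 * V w + 3 * B) * K z z) (V w ^+ 2 + (8 * m1) * V w + 3 * B * m1).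
  + rewrite -addrA (_ : 8 * m1 * V w + 3 * B * m1 = (8 * V w + 3 * B) * m1); last by ring.
    by apply: expect_leD; [apply: expect_le_cst; exact: sqr_ge0|exact: expect_leZ].
  + exact: measurable_funX.
  + by move=> z; exact: sqr_ge0.
  + apply: (@bounded_integrable _ _ _ _ _ (V w ^+ 2 + (8 * V w + 3 * B) * B)).
      apply: measurable_funD => //; apply: measurable_funM => //; exact: measurable_diag.
    have K0 := psd_diag Kpsd.
    move=> z; rewrite ger0_norm; first by rewrite lerD2l ler_wpM2l.
    by rewrite addr_ge0 ?sqr_ge0// mulr_ge0.
  + move=> z; apply: (le_trans (quad_cons_sq_le Kpsd z (pts J w))).
    rewrite -/(V w); have : K z z ^+ 2 <= B * K z z.
      by rewrite expr2 ler_wpM2r//; exact: psd_diag.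
    by lra.
Qed.

End kernel_moments.
End tuple_moments.

Section leave_one_out.
Context {d} {Z : measurableType d} {R : realType} (n : nat).
Variables (rho : probability Z R) (mu : probability (n.-tuple Z) R).
Hypothesis muE : forall A : 'I_n -> set Z, (forall i, measurable (A i)) ->
  mu (box A) = (\prod_(i < n) rho (A i))%E.
Variables (K : Z -> Z -> R) (B m1 : R).
Hypothesis mK : measurable_fun setT (fun p : Z * Z => K p.1 p.2).
Hypothesis Kpsd : psd_kernel K.
Hypothesis KB : forall z, K z z <= B.
Hypothesis Km1 : expect_le rho (fun z => K z z) m1.
Hypothesis Kdeg : forall a, (\int[rho]_z (K a z)%:E = 0)%E.

Lemma quad_pts_perm J1 J2 w : perm_eq J1 J2 ->
  quad K (pts (n := n) J1 w) = quad K (pts J2 w).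
Proof.
move=> J12; rewrite /quad /pts !big_map (perm_big _ J12)/=.
by apply: eq_bigr => i _; rewrite !big_map (perm_big _ J12).
Qed.

(* Leaving out [k] makes the quadratic form independent of [f (tnth w k)], at the
   cost of a constant factor and a bounded term. *)
Lemma quad_loo_moment J k f A : uniq J -> k \in J -> expect_le rho f A ->
  expect_le mu (fun w => quad K (pts J w) ^+ 2 * f (tnth w k))
    ((32 * (size J)%:R ^+ 2 * m1 ^+ 2 + 24 * (size J)%:R * B * m1 + 8 * B ^+ 2) * A).
Proof.
move=> uJ kJ fA; have [mf f0 _] := fA; have A0 := expect_le_ge0 fA.
have m10 := expect_le_ge0 Km1.
have B0 : 0 <= B by exact: le_trans (psd_diag Kpsd point) (KB point).
pose J' := rem k J.
have uJ' : uniq J' by exact: rem_uniq.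
have kJ' : k \notin J' by rewrite mem_rem_uniqF.
have JJ' : perm_eq J (k :: J') by exact: perm_to_rem.
have [_ E2] := quad_moments muE mK Kpsd KB Km1 Kdeg uJ'.
have F2 : expect_le mu (fun w => 8 * quad K (pts J' w) ^+ 2 + 8 * B ^+ 2)
    (8 * (4 * (size J')%:R ^+ 2 * m1 ^+ 2 + 3 * (size J')%:R * B * m1) + 8 * B ^+ 2).
  apply: expect_leD; first exact: expect_leZ.
  by apply: expect_le_cst; rewrite mulr_ge0// sqr_ge0.
have inv w z : 8 * quad K (pts J' (upd k w z)) ^+ 2 + 8 * B ^+ 2 =
    8 * quad K (pts J' w) ^+ 2 + 8 * B ^+ 2 by rewrite pts_upd.
have {}F2 := expect_le_coordM muE F2 fA inv.
have sJ : (size J')%:R <= (size J)%:R :> R by rewrite (perm_size JJ') ler_nat.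
apply: (expect_le_mono (g := fun w => (8 * quad K (pts J' w) ^+ 2 + 8 * B ^+ 2) * f (tnth w k))).
- apply: (expect_le_trans F2); rewrite ler_wpM2r//.
  have -> : 32 * (size J)%:R ^+ 2 * m1 ^+ 2 + 24 * (size J)%:R * B * m1 + 8 * B ^+ 2 =
    8 * (4 * (size J)%:R ^+ 2 * m1 ^+ 2 + 3 * (size J)%:R * B * m1) + 8 * B ^+ 2 by ring.
  rewrite lerD2r ler_wpM2l// lerD//.
    rewrite ler_wpM2r ?sqr_ge0// ler_wpM2l//.
    by rewrite ler_sqr ?nnegrE.
  by rewrite ler_wpM2r// ler_wpM2r// ler_wpM2l.
- apply: measurable_funM; last exact: measurableT_comp mf (measurable_tnth k).
  by apply: measurable_funX; exact: measurable_quad.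
move=> w; rewrite mulr_ge0 ?sqr_ge0//= ler_wpM2r//.
rewrite (quad_pts_perm w JJ') /=.
have := quad_cons_le Kpsd (tnth w k) (pts J' w).
have := quad_ge0 Kpsd (tnth w k :: pts J' w); have := psd_diag Kpsd (tnth w k).
have := quad_ge0 Kpsd (pts J' w); have := KB (tnth w k).
rewrite -/(pts J' w).
move: (quad K (pts J' w)) (quad K (_ :: _)) (K _ _) => V U c cB V0 c0 U0 UVc.
(* [U ^ 2 <= 8 V ^ 2 + 8 c ^ 2] turns the constants 4 and 3 of [quad_moments] into 32 and 24. *)
have : U ^+ 2 <= (2 * V + 2 * c) ^+ 2 by rewrite ler_sqr ?nnegrE// addr_ge0// mulr_ge0.
have : c ^+ 2 <= B ^+ 2 by rewrite ler_sqr ?nnegrE.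
by have := sqr_ge0 (V - c); rewrite !expr2; lra.
Qed.

End leave_one_out.

(** * Quadratic forms of the noise with input-dependent weights *)

Section noise_moments.
Context {d} {X : measurableType d} {R : realType} (n : nat).
Variables (rho : probability (X * R)%type R) (nu : probability X R) (k : R.-pker X ~> R).
Variable (mu : probability (n.-tuple (X * R)%type) R).
Hypothesis muE : forall A : 'I_n -> set (X * R), (forall i, measurable (A i)) ->
  mu (box A) = (\prod_(i < n) rho (A i))%E.
Hypothesis nuE : is_marginal rho nu.
Hypothesis rhoE : is_conditional rho nu k.
Variables (g : X -> R) (s2 : R).
Hypothesis mg : measurable_fun setT g.
Hypothesis gE : {ae nu, forall x, regression k x = g x}.
Hypothesis s20 : 0 <= s2.
Hypothesis var : {ae nu, forall x, (\int[k x]_y ((y - g x) ^+ 2)%:E <= s2%:E)%E}.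
Variables (a : X -> X -> R) (Ba : R).
Hypothesis ma : measurable_fun setT (fun p : X * X => a p.1 p.2).
Hypothesis apsd : psd_kernel a.
Hypothesis aB : forall x, a x x <= Ba.

Let eps (z : X * R) : R := z.2 - g z.1.

(** Its diagonal is unbounded, since labels are, so [quad_moments] does not apply; a weighted first
    moment is all that is required of it. *)
Definition noise_kernel (z z' : X * R) : R := eps z * eps z' * a z.1 z'.1.

Lemma noise_kernel_psd : psd_kernel noise_kernel.
Proof.
case: apsd => aC aP; split; first by move=> z z'; rewrite /noise_kernel aC (mulrC (eps z)).
move=> s; have := aP [seq (p.1 * eps p.2, p.2.1) | p <- s]; rewrite big_map.
congr (_ <= _); apply: eq_bigr => p _; rewrite big_map; apply: eq_bigr => q _ /=.
by rewrite /noise_kernel; ring.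
Qed.

Let meps : measurable_fun setT eps. Proof. exact: measurable_noise. Qed.

Lemma measurable_noise_kernel :
  measurable_fun setT (fun p : (X * R) * (X * R) => noise_kernel p.1 p.2).
Proof.
apply: measurable_funM.
  by apply: measurable_funM; exact: measurableT_comp meps _.
apply: (measurableT_comp ma (g := fun p : (X * R) * (X * R) => (p.1.1, p.2.1))).
by apply: measurable_fun_pair; apply: measurableT_comp.
Qed.

Lemma lin_noise_kernel s z :
  lin noise_kernel s z = eps z * \sum_(p <- s) eps p * a p.1 z.1.
Proof.
rewrite mulr_sumr; apply: eq_bigr => p _; rewrite /noise_kernel; ring.
Qed.

Let aB' x x' : `|a x x'| <= Ba.
Proof. exact: psd_bounded. Qed.

Variables (Phi : n.-tuple (X * R)%type -> R) (C A : R).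
Hypothesis mPhi : measurable_fun setT Phi.
Hypothesis Phi0 : forall w, 0 <= Phi w.
Hypothesis PhiC : forall w, Phi w <= C.
(* [Phi] depends on the inputs only, not on the labels. *)
Hypothesis Phix : forall i w x y y', Phi (upd i w (x, y)) = Phi (upd i w (x, y')).
Hypothesis PhiA : forall i, expect_le mu (fun w => Phi w * a (tnth w i).1 (tnth w i).1) A.

(** Given the inputs, the weight is constant, the term linear in the new noise is centered, and its
    square is bounded by the conditional variance. *)
Lemma noise_step i s w :
  (\int[rho]_z (Phi (upd i w z) * quad noise_kernel (z :: s))%:E <=
   \int[rho]_z (Phi (upd i w z) * (quad noise_kernel s + s2 * a z.1 z.1))%:E)%E.
Proof.
(* The label 0 is arbitrary, by [Phix]. *)
pose phi x := Phi (upd i w (x, 0)).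
have PhiE z : Phi (upd i w z) = phi z.1 by case: z => x y; exact: Phix.
have mphi : measurable_fun setT phi.
  apply: (measurableT_comp mPhi (g := fun x => upd i w (x, 0))).
  apply: (measurableT_comp (g := fun x => (x, 0)) (f := upd i w)).
    exact: (measurable_fun_pair2 w (measurable_upd i)).
  exact: pair2_measurable.
have phi0 x : 0 <= phi x by exact: Phi0.
have phiC x : phi x <= C by exact: PhiC.
pose V := quad noise_kernel s.
have V0 : 0 <= V by exact: quad_ge0 noise_kernel_psd _.
have Ba0 : 0 <= Ba by exact: le_trans (aB' point point).
have C0 : 0 <= C by apply: le_trans (PhiC w).
pose l x := \sum_(p <- s) eps p * a p.1 x.
have ml : measurable_fun setT l.
  apply: measurable_sum => p; apply: measurable_funM; first exact: measurable_cst.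
  exact: (measurable_fun_pair2 p.1 ma).
have lB x : `|phi x * l x| <= C * \sum_(p <- s) `|eps p| * Ba.
  rewrite normrM; apply: ler_pM => //; first by rewrite ger0_norm.
  apply: (le_trans (ler_norm_sum _ _ _)); apply: ler_sum => p _.
  by rewrite normrM ler_wpM2l.
have mpl : measurable_fun setT (fun x => phi x * l x) by exact: measurable_funM.
have mda : measurable_fun setT (fun x => a x x) by exact: measurable_diag.
have mpa : measurable_fun setT (fun x => phi x * a x x) by exact: measurable_funM.
have pa0 x : 0 <= phi x * a x x by rewrite mulr_ge0//; exact: psd_diag.
have ih : rho.-integrable setT (fun z => (2%:E * (eps z * (phi z.1 * l z.1))%:E)%E).
  by apply: integrableZl => //; exact: (integrable_noiseM rhoE mg s20 var mpl lB).
have h0 : (\int[rho]_z (2%:E * (eps z * (phi z.1 * l z.1))%:E) = 0)%E.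
  rewrite integralZl//; last exact: (integrable_noiseM rhoE mg s20 var mpl lB).
  by rewrite (noise_centered rhoE mg gE s20 var mpl lB) mule0.
have i1 : rho.-integrable setT (fun z => (phi z.1 * V)%:E).
  apply: (@bounded_integrable _ _ _ _ _ (C * V)).
    apply: measurable_funM => //; exact: measurableT_comp mphi measurable_fst.
  by move=> z; rewrite normrM (ger0_norm V0) ler_wpM2r// ger0_norm.
have i2 : rho.-integrable setT (fun z => (eps z ^+ 2 * (phi z.1 * a z.1 z.1))%:E).
  have := integrableZl measurableT (C * Ba) (integrable_noise2 rhoE mg s20 var).
  apply: le_integrable => //.
    apply/measurable_EFinP; apply: measurable_funM; first exact: measurable_funX.
    exact: measurableT_comp mpa measurable_fst.
  move=> z _; rewrite /= lee_fin !ger0_norm.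
  - rewrite mulrC ler_wpM2r ?sqr_ge0// ler_pM//; exact: psd_diag.
  - by rewrite mulr_ge0 ?sqr_ge0// mulr_ge0.
  - by rewrite mulr_ge0 ?sqr_ge0.
have -> : (\int[rho]_z (Phi (upd i w z) * quad noise_kernel (z :: s))%:E =
   \int[rho]_z (phi z.1 * V)%:E + \int[rho]_z (eps z ^+ 2 * (phi z.1 * a z.1 z.1))%:E)%E.
  rewrite -[RHS]adde0 -h0 -integralD// -integralD//; last exact: integrableD.
  apply: eq_integral => z _; rewrite PhiE (quad_cons noise_kernel_psd) lin_noise_kernel.
  by rewrite -!EFinM -!EFinD /noise_kernel /V /l; congr EFin; ring.
have -> : (\int[rho]_z (Phi (upd i w z) * (quad noise_kernel s + s2 * a z.1 z.1))%:E =
    \int[rho]_z (phi z.1 * V)%:E + s2%:E * \int[nu]_x (phi x * a x x)%:E)%E.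
  rewrite -(integral_marginal nuE (F := fun x => (phi x * a x x)%:E)); last 2 first.
  - exact/measurable_EFinP.
  - by move=> x; rewrite lee_fin.
  have mpaz : measurable_fun setT (fun z : X * R => (phi z.1 * a z.1 z.1)%:E).
    apply/measurable_EFinP; exact: measurableT_comp mpa measurable_fst.
  rewrite -ge0_integralZl//; last by move=> z _; rewrite lee_fin.
  rewrite -ge0_integralD//.
  - apply: eq_integral => z _; rewrite PhiE -EFinM -EFinD -/V; congr EFin; ring.
  - by move=> z _; rewrite lee_fin mulr_ge0.
  - by have [] := integrableP _ _ _ i1.
  - by move=> z _; rewrite mule_ge0// lee_fin.
  - exact: measurable_funeM.
exact: (leeD2l _ (noise_variance rhoE mg s20 var mpa pa0)).
Qed.

(** The points are added one at a time, each contributing [s2 * A]. The weight may depend on all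
    inputs, including those being integrated out. *)
Lemma noise_moment J : uniq J ->
  expect_le mu (fun w => Phi w * quad noise_kernel (pts J w)) ((size J)%:R * (s2 * A)).
Proof.
have q0 := quad_ge0 noise_kernel_psd.
have mq := measurable_quad (n := n) measurable_noise_kernel.
elim: J => [_|i J IH /andP[iJ uJ]].
  rewrite (_ : (fun w => _) = (fun=> 0)) ?mul0r; first exact: expect_le_cst.
  by apply/funext => w; rewrite quad_nil mulr0.
apply: (expect_le_step muE (k := i)
  (G := fun w => Phi w * quad noise_kernel (pts J w) + s2 * (Phi w * a (tnth w i).1 (tnth w i).1))).
- by apply: measurable_funM.
- by move=> w; rewrite mulr_ge0.
- rewrite /= -natr1 mulrDl mul1r; apply: expect_leD; first exact: IH.
  exact: expect_leZ.
move=> w; under eq_integral do rewrite pts_cons_upd//.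
apply: (le_trans (noise_step i (pts J w) w)); rewrite le_eqVlt; apply/orP; left; apply/eqP.
apply: eq_integral => z _; rewrite pts_upd// tnth_upd eqxx; congr EFin; ring.
Qed.

End noise_moments.

(** * Kernels attached to the covariance operator *)

Section covariance.
Context {R : realType} {d : measure_display} {X : measurableType d} (H : rkhs R X).
Local Notation "''[' f , g ]" := (rkhs_dot H f g) : ring_scope.
Local Notation sec := (rkhs_sec H).
Variables (nu : probability X R) (T : H -> H) (K2 : R).
Hypothesis mH : rkhs_measurable H.
Hypothesis secK2 : forall x, '[sec x, sec x] <= K2.
Hypothesis covT : is_covariance nu T.

Lemma K2_ge0 : 0 <= K2.
Proof. exact: le_trans (dot_ge0 _) (secK2 point). Qed.

Lemma eval_sq_le f x : '[f, sec x] ^+ 2 <= '[f, f] * K2.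
Proof. by apply: (le_trans (dot_CS2 _ _)); rewrite ler_wpM2l// dot_ge0. Qed.

Lemma evalM_bounded f g x : `|'[f, sec x] * '[g, sec x]| <= ('[f, f] + '[g, g]) * K2.
Proof.
have := eval_sq_le f x; have := eval_sq_le g x.
rewrite normrM -(real_normK (num_real '[f, sec x])) -(real_normK (num_real '[g, sec x])).
move: `|'[f, sec x]| `|'[g, sec x]| => a b.
have := sqr_ge0 (a - b); have := sqr_ge0 a; have := sqr_ge0 b.
by rewrite !expr2 mulrDl; lra.
Qed.

Lemma integrable_evalM f g : nu.-integrable setT (fun x => ('[f, sec x] * '[g, sec x])%:E).
Proof.
apply: bounded_integrable (evalM_bounded f g).
by apply: measurable_funM; exact: measurable_rkhs.
Qed.

Lemma covarianceE f g : (\int[nu]_x ('[f, sec x] * '[g, sec x])%:E = ('[T f, g])%:E)%E.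
Proof.
rewrite covT /Rintegral -[LHS]fineK; last exact: integrable_fin_num (integrable_evalM f g).
congr (fine _)%:E; apply: eq_integral => x _.
by rewrite /tensor dotZl (dotC (sec x)).
Qed.

Lemma covariance_sym f g : '[T f, g] = '[f, T g].
Proof.
apply: EFin_inj; rewrite -covarianceE dotC -covarianceE.
by apply: eq_integral => x _; rewrite mulrC.
Qed.

Lemma covariance_sq f : (\int[nu]_x ('[f, sec x] ^+ 2)%:E = ('[T f, f])%:E)%E.
Proof. by rewrite -covarianceE; apply: eq_integral => x _; rewrite expr2. Qed.

Lemma covariance_ge0 f : 0 <= '[T f, f].
Proof.
by rewrite -lee_fin -covariance_sq; apply: integral_ge0 => x _; rewrite lee_fin sqr_ge0.
Qed.

Let integrable_sq f : nu.-integrable setT (fun x => ('[f, sec x] ^+ 2)%:E).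
Proof. exact: integrable_evalM. Qed.

Let measurable_sq f : measurable_fun setT (fun x => '[f, sec x] ^+ 2).
Proof. by apply: measurable_funX; exact: measurable_rkhs. Qed.

Lemma covariance_le f : '[T f, f] <= K2 * '[f, f].
Proof.
rewrite -lee_fin -covariance_sq -[leRHS](integral_cst_prob nu).
apply: ge0_le_integral => //.
- by move=> x _; rewrite lee_fin sqr_ge0.
- exact/measurable_EFinP.
- by move=> x _; rewrite lee_fin mulrC eval_sq_le.
Qed.

Variables (e : nat -> H) (mu : nat -> R) (lam : R).
Hypothesis eb : eigenbasis T e mu.
Hypothesis lam0 : 0 < lam.

Let mu0 a : 0 <= mu a. Proof. by case: eb. Qed.
Let Te a : T (e a) = mu a *: e a. Proof. by case: eb. Qed.
Let ml a : 0 < mu a + lam. Proof. by rewrite ltr_wpDl. Qed.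

(** [mu a <e a, e a>] is the mean of [<e a, K_x>^2], and Bessel's inequality bounds the sum of these
    squares at each [x]. *)
Lemma partial_trace_le N : \sum_(a < N) mu a * '[e a, e a] <= K2.
Proof.
have [] := @integral_sum_fin _ _ _ nu N (fun a x => '[e a, sec x] ^+ 2)
  (fun a => mu a * '[e a, e a]) _ _ => //.
  by move=> a; rewrite covariance_sq Te dotZl.
move=> _ sE; rewrite -lee_fin -sE -(integral_cst_prob nu).
apply: ge0_le_integral => //.
- by move=> x _; rewrite lee_fin sumr_ge0// => a _; rewrite sqr_ge0.
- by apply/measurable_EFinP; apply: measurable_sum => a.
- move=> x _; rewrite lee_fin; under eq_bigr do rewrite dotC.
  by apply: (le_trans (bessel eb N (sec x))).
Qed.

Lemma eigenvalue_sq_le a : mu a ^+ 2 * '[e a, e a] <= K2 * (mu a * '[e a, e a]).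
Proof.
have := covariance_le (e a); rewrite Te dotZl => h.
by rewrite expr2 -mulrA mulrCA [leRHS]mulrCA ler_wpM2l.
Qed.

(** The operator [K_x tensor K_x - T] applied to [e a], a centered random vector. *)
Definition dev_feature a x : H := '[e a, sec x] *: sec x - mu a *: e a.

(** The Hilbert-Schmidt inner product of the operators [(K_x tensor K_x - T) A^(-1/2)] at [x] and
    [x'], truncated. *)
Definition dev_kernel N x x' : R :=
  \sum_(a < N) (mu a + lam)^-1 * '[dev_feature a x, dev_feature a x'].

(** The truncation of [<A^(-1) K_x, K_x'>]. *)
Definition eval_kernel N x x' : R :=
  \sum_(a < N) (mu a + lam)^-1 * ('[e a, sec x] * '[e a, sec x']).

Let inv_weight_ge0 a : 0 <= (mu a + lam)^-1.
Proof. by rewrite invr_ge0 ltW. Qed.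

Lemma dev_kernel_psd N : psd_kernel (dev_kernel N).
Proof.
split; first by move=> x x'; apply: eq_bigr => a _; rewrite dotC.
move=> s; pose v a := \sum_(p <- s) p.1 *: dev_feature a p.2.
have -> : \sum_(p <- s) \sum_(q <- s) p.1 * q.1 * dev_kernel N p.2 q.2 =
    \sum_(a < N) (mu a + lam)^-1 * '[v a, v a].
  transitivity (\sum_(p <- s) \sum_(q <- s) \sum_(a < N)
      (mu a + lam)^-1 * (p.1 * q.1 * '[dev_feature a p.2, dev_feature a q.2])).
    apply: eq_bigr => p _; apply: eq_bigr => q _; rewrite mulr_sumr.
    by apply: eq_bigr => a _; rewrite mulrCA.
  under eq_bigr do rewrite exchange_big/=.
  rewrite exchange_big/=; apply: eq_bigr => a _.
  rewrite {1}/v dot_suml mulr_sumr; apply: eq_bigr => p _.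
  rewrite dotZl dot_sumr !mulr_sumr; apply: eq_bigr => q _.
  by rewrite dotZr !mulrA.
by apply: sumr_ge0 => a _; rewrite mulr_ge0 ?dot_ge0.
Qed.

Lemma eval_kernel_psd N : psd_kernel (eval_kernel N).
Proof.
split; first by move=> x x'; apply: eq_bigr => a _; rewrite (mulrC '[e a, sec x]).
move=> s; pose v a := \sum_(p <- s) p.1 * '[e a, sec p.2].
have -> : \sum_(p <- s) \sum_(q <- s) p.1 * q.1 * eval_kernel N p.2 q.2 =
    \sum_(a < N) (mu a + lam)^-1 * v a ^+ 2.
  transitivity (\sum_(p <- s) \sum_(q <- s) \sum_(a < N)
      (mu a + lam)^-1 * (p.1 * q.1 * ('[e a, sec p.2] * '[e a, sec q.2]))).
    apply: eq_bigr => p _; apply: eq_bigr => q _; rewrite mulr_sumr.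
    by apply: eq_bigr => a _; rewrite mulrCA.
  under eq_bigr do rewrite exchange_big/=.
  rewrite exchange_big/=; apply: eq_bigr => a _.
  rewrite expr2 {1}/v mulr_suml mulr_sumr; apply: eq_bigr => p _.
  by rewrite !mulr_sumr; apply: eq_bigr => q _; ring.
by apply: sumr_ge0 => a _; rewrite mulr_ge0 ?sqr_ge0.
Qed.

Lemma dev_feature_dot a x x' : '[dev_feature a x, dev_feature a x'] =
  '[e a, sec x] * '[e a, sec x'] * '[sec x, sec x'] - mu a * '[e a, sec x] ^+ 2
  - mu a * '[e a, sec x'] ^+ 2 + mu a ^+ 2 * '[e a, e a].
Proof.
rewrite /dev_feature !(dotBl, dotBr, dotZl, dotZr) (dotC (sec x) (e a)).
ring.
Qed.

Lemma measurable_dev_kernel N :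
  measurable_fun setT (fun p : X * X => dev_kernel N p.1 p.2).
Proof.
have m1 f : measurable_fun setT (fun p : X * X => '[f, sec p.1]).
  exact: measurableT_comp (measurable_rkhs mH f) measurable_fst.
have m2 f : measurable_fun setT (fun p : X * X => '[f, sec p.2]).
  exact: measurableT_comp (measurable_rkhs mH f) measurable_snd.
apply: measurable_sum => a; apply: measurable_funM; first exact: measurable_cst.
rewrite (_ : (fun p => _) = (fun p : X * X =>
  '[e a, sec p.1] * '[e a, sec p.2] * '[sec p.1, sec p.2] - mu a * '[e a, sec p.1] ^+ 2
  - mu a * '[e a, sec p.2] ^+ 2 + mu a ^+ 2 * '[e a, e a])); last first.
  by apply/funext => p; rewrite dev_feature_dot.
apply: measurable_funD; last exact: measurable_cst.
apply: measurable_funB.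
  apply: measurable_funB.
    apply: measurable_funM; last exact: measurable_rkhs_kernel.
    exact: measurable_funM.
  by apply: measurable_funM; [exact: measurable_cst|exact: measurable_funX].
by apply: measurable_funM; [exact: measurable_cst|exact: measurable_funX].
Qed.

Lemma measurable_eval_kernel N :
  measurable_fun setT (fun p : X * X => eval_kernel N p.1 p.2).
Proof.
apply: measurable_sum => a; apply: measurable_funM; first exact: measurable_cst.
apply: measurable_funM.
  exact: measurableT_comp (measurable_rkhs mH _) measurable_fst.
exact: measurableT_comp (measurable_rkhs mH _) measurable_snd.
Qed.

Let inv_weight_le a : (mu a + lam)^-1 <= lam^-1.
Proof. by rewrite lef_pV2 ?posrE// lerDr. Qed.

Lemma eval_kernel_le N x : eval_kernel N x x <= lam^-1 * K2.
Proof.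
apply: (@le_trans _ _ (\sum_(a < N) lam^-1 * '[sec x, e a] ^+ 2)).
  by apply: ler_sum => a _; rewrite -expr2 dotC ler_wpM2r ?sqr_ge0.
rewrite -mulr_sumr ler_wpM2l ?invr_ge0 ?(ltW lam0)//.
exact: le_trans (bessel eb N (sec x)) (secK2 x).
Qed.

(** Each feature is a difference, bounded by twice the sum of the squared norms of its two terms.
    Bessel for [sec x] and the trace bound for the eigenvalues contribute [2 K2 ^ 2] each. *)
Lemma dev_kernel_le N x : dev_kernel N x x <= lam^-1 * (4 * K2 ^+ 2).
Proof.
have K20 := K2_ge0.
apply: (@le_trans _ _ (\sum_(a < N) lam^-1 *
    (2 * K2 * '[sec x, e a] ^+ 2 + 2 * K2 * (mu a * '[e a, e a])))).
  apply: ler_sum => a _; apply: ler_pM; rewrite ?dot_ge0//.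
  apply: (@le_trans _ _ (2 * ('[e a, sec x] ^+ 2 * '[sec x, sec x]) +
      2 * (mu a ^+ 2 * '[e a, e a]))).
    have := dot_ge0 ('[e a, sec x] *: sec x + mu a *: e a).
    rewrite dev_feature_dot !(dotDl, dotDr, dotZl, dotZr) (dotC (sec x) (e a)) !expr2.
    by lra.
  rewrite (dotC (sec x)); apply: lerD.
    rewrite -mulrA ler_wpM2l// mulrC ler_wpM2r ?sqr_ge0//.
  by rewrite -mulrA ler_wpM2l// eigenvalue_sq_le.
rewrite -mulr_sumr ler_wpM2l ?invr_ge0 ?(ltW lam0)//.
rewrite big_split/= -!mulr_sumr.
have h1 : \sum_(a < N) '[sec x, e a] ^+ 2 <= K2.
  exact: le_trans (bessel eb N (sec x)) (secK2 x).
have h2 := partial_trace_le N.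
have := ler_wpM2l K20 h1; have := ler_wpM2l K20 h2.
by rewrite expr2; lra.
Qed.

(** [mu a *: e a = T (e a)] is the weak mean of [<e a, K_x'> K_x']. *)
Lemma dev_kernel_degenerate N x : (\int[nu]_x' (dev_kernel N x x')%:E = 0)%E.
Proof.
pose f a x' := (mu a + lam)^-1 * ('[e a, sec x'] * '[dev_feature a x, sec x']
  - mu a * '[dev_feature a x, e a]).
have i1 a : nu.-integrable setT (fun x' => ('[e a, sec x'] * '[dev_feature a x, sec x'])%:E).
  exact: integrable_evalM.
have i2 a : nu.-integrable setT (fun x' : X => (mu a * '[dev_feature a x, e a])%:E).
  exact: finite_measure_integrable_cst.
have i3 a : nu.-integrable setT (fun x' : X => ('[e a, sec x'] * '[dev_feature a x, sec x']
  - mu a * '[dev_feature a x, e a])%:E).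
  by have := integrableB measurableT (i1 a) (i2 a).
have [] := @integral_sum_fin _ _ _ nu N f (fun=> 0).
- by move=> a; have := integrableZl measurableT (mu a + lam)^-1 (i3 a).
- move=> a; rewrite /f; under eq_integral do rewrite EFinM.
  rewrite integralZl//; under eq_integral do rewrite EFinB.
  rewrite integralB_EFin; [|by []|exact: i1|exact: i2].
  rewrite (covarianceE (e a) (dev_feature a x)) integral_cst_prob Te dotZl (dotC (e a)).
  by rewrite subee// mule0.
move=> _ sE; transitivity (\int[nu]_x' (\sum_(a < N) f a x')%:E)%E; last by rewrite sE big1.
apply: eq_integral => x' _; congr EFin.
apply: eq_bigr => a _; rewrite /f {2}/dev_feature dotBr !dotZr; congr (_ * _).
Qed.

(** The features are centered, so subtracting [mu a *: e a] lowers their second moment. Keeping the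
    weights [(mu a + lam)^-1] makes the mean of the order of the effective dimension, whereas the
    supremum is of order [1 / lam]. *)
Lemma dev_kernel_mean N D : \sum_(a < N) (mu a + lam)^-1 * (mu a * '[e a, e a]) <= D ->
  expect_le nu (fun x => dev_kernel N x x) (K2 * D).
Proof.
move=> ND; have K20 := K2_ge0.
pose f a x := (mu a + lam)^-1 * ((K2 - 2 * mu a) * '[e a, sec x] ^+ 2 + mu a ^+ 2 * '[e a, e a]).
have ic a : nu.-integrable setT (fun x : X => (mu a ^+ 2 * '[e a, e a])%:E).
  exact: finite_measure_integrable_cst.
have i1 a : nu.-integrable setT (fun x => ((K2 - 2 * mu a) * '[e a, sec x] ^+ 2)%:E).
  by have := integrableZl measurableT (K2 - 2 * mu a) (integrable_sq (e a)).
have i2 a : nu.-integrable setT (fun x => ((K2 - 2 * mu a) * '[e a, sec x] ^+ 2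
    + mu a ^+ 2 * '[e a, e a])%:E).
  by have := integrableD measurableT (i1 a) (ic a).
have [] := @integral_sum_fin _ _ _ nu N f
  (fun a => (mu a + lam)^-1 * ((K2 - mu a) * (mu a * '[e a, e a]))).
- by move=> a; have := integrableZl measurableT (mu a + lam)^-1 (i2 a).
- move=> a; rewrite /f; under eq_integral do rewrite EFinM.
  rewrite integralZl//; under eq_integral do rewrite EFinD.
  rewrite integralD// integral_cst_prob; under eq_integral do rewrite EFinM.
  rewrite integralZl// covariance_sq Te dotZl.
  by rewrite -(EFinM (K2 - 2 * mu a)) -EFinD -EFinM; congr EFin; ring.
move=> iF FE; split.
- exact: measurable_diag (measurable_dev_kernel N).
- by move=> x; exact: psd_diag (dev_kernel_psd N) x.
apply: (@le_trans _ _ (\int[nu]_x (\sum_(a < N) f a x)%:E)%E).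
  apply: ge0_le_integral => //.
  - by move=> x _; rewrite lee_fin; exact: psd_diag (dev_kernel_psd N) x.
  - by apply/measurable_EFinP; exact: measurable_diag (measurable_dev_kernel N).
  - by have [] := integrableP _ _ _ iF.
  move=> x _; rewrite lee_fin; apply: ler_sum => a _; rewrite /f ler_wpM2l//.
  rewrite dev_feature_dot -expr2.
  have : '[e a, sec x] ^+ 2 * '[sec x, sec x] <= '[e a, sec x] ^+ 2 * K2.
    by rewrite ler_wpM2l ?sqr_ge0.
  by lra.
rewrite FE lee_fin; apply: (le_trans _ (ler_wpM2l K20 ND)).
rewrite mulr_sumr; apply: ler_sum => a _.
by rewrite mulrCA ler_wpM2r ?gerBl// mulr_ge0// mulr_ge0// dot_ge0.
Qed.

Lemma eval_kernel_mean N D : \sum_(a < N) (mu a + lam)^-1 * (mu a * '[e a, e a]) <= D ->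
  expect_le nu (fun x => eval_kernel N x x) D.
Proof.
move=> ND; split.
- exact: measurable_diag (measurable_eval_kernel N).
- by move=> x; exact: psd_diag (eval_kernel_psd N) x.
have [] := @integral_sum_fin _ _ _ nu N
  (fun a x => (mu a + lam)^-1 * ('[e a, sec x] * '[e a, sec x]))
  (fun a => (mu a + lam)^-1 * (mu a * '[e a, e a])).
- by move=> a; have := integrableZl measurableT (mu a + lam)^-1 (integrable_sq (e a)).
- move=> a; under eq_integral do rewrite EFinM.
  by rewrite integralZl ?covarianceE ?Te ?dotZl//; exact: integrable_evalM.
by move=> _ sE; rewrite [leLHS]sE lee_fin.
Qed.

Lemma dev_quad N (J : seq X) : (0 < size J)%N ->
  dev T e mu lam N J = (size J)%:R^-1 ^+ 2 * quad (dev_kernel N) J.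
Proof.
move=> J0; have Jn : (size J)%:R != 0 :> R by rewrite pnatr_eq0 -lt0n.
rewrite /dev /quad mulr_sumr.
have TE a : T (e a) - emp J (e a) = (- (size J)%:R^-1) *: \sum_(x <- J) dev_feature a x.
  have -> : \sum_(x <- J) dev_feature a x =
      \sum_(x <- J) '[e a, sec x] *: sec x - (size J)%:R *: T (e a).
    by rewrite sumrB big_const_seq count_predT iter_addr_0 scaler_nat Te.
  by rewrite scaleNr scalerBr scalerA mulVf// scale1r opprB.
transitivity (\sum_(a < N) \sum_(x <- J) \sum_(x' <- J)
   (size J)%:R^-1 ^+ 2 * ((mu a + lam)^-1 * '[dev_feature a x, dev_feature a x'])).
  apply: eq_bigr => a _; rewrite TE dotZl dotZr mulrA mulrNN -expr2 mulrCA.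
  rewrite dot_suml mulrA mulrC mulr_suml; apply: eq_bigr => x _.
  rewrite dot_sumr mulr_suml; apply: eq_bigr => x' _; ring.
rewrite exchange_big/=; apply: eq_bigr => x _; rewrite exchange_big/= mulr_sumr.
by apply: eq_bigr => x' _; rewrite mulr_sumr.
Qed.

(** As a supremum over orthonormal bases, [effective_dim] dominates the trace along the
    eigenbasis. *)
Lemma effective_dim_bound N D : (effective_dim T lam <= D%:E)%E ->
  \sum_(a < N) (mu a + lam)^-1 * (mu a * '[e a, e a]) <= D.
Proof.
move=> TD; rewrite -lee_fin; apply: le_trans TD.
have Tlin f g : T (f - g) = T f - T g.
  apply/eqP; rewrite -subr_eq0; apply/eqP/dot_eq0; move: (X in '[_, X]) => v.
  by rewrite dotBl dotBl !covariance_sym dotBl subrr.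
have TZ c f : T (c *: f) = c *: T f.
  apply/eqP; rewrite -subr_eq0; apply/eqP/dot_eq0; move: (X in '[_, X]) => v.
  by rewrite dotBl dotZl !covariance_sym dotZl subrr.
have opE a : (opinv (fun f => T f + lam *: f) \o T) (e a) = ((mu a + lam)^-1 * mu a) *: e a.
  set v := RHS; have vE : T v + lam *: v = T (e a).
    rewrite /v TZ Te !scalerA -scalerDl; congr (_ *: _).
    by field; rewrite gt_eqF.
  (* [T + lam] is injective by positivity, so the chosen preimage is [v]. *)
  rewrite /= /opinv; case: xgetP => [f _ /= fE|/(_ v)//].
  apply/eqP; rewrite -subr_eq0; apply/eqP.
  apply: dot_eq0; apply/eqP; rewrite eq_le dot_ge0 andbT.
  have h : '[T (f - v) + lam *: (f - v), f - v] = 0.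
    by rewrite Tlin scalerBr addrACA -opprD fE vE subrr dot0l.
  have T0 := covariance_ge0 (f - v); move: h; rewrite dotDl dotZl => h.
  by rewrite -(pmulr_rle0 _ lam0); lra.
apply: (@le_trans _ _ (\sum_(0 <= i <oo)
    ('[(opinv (fun f => T f + lam *: f) \o T) (e i), e i])%:E)%E); last first.
  by apply: ereal_sup_ubound; exists e => //; case: eb.
have -> : (\sum_(a < N) (mu a + lam)^-1 * (mu a * '[e a, e a]))%:E =
    (\sum_(0 <= i < N) ('[(opinv (fun f => T f + lam *: f) \o T) (e i), e i])%:E)%E.
  rewrite sumEFin big_mkord; congr EFin; apply: eq_bigr => a _.
  by rewrite opE dotZl mulrA.
apply: nneseries_lim_ge => i _ _.
by rewrite opE dotZl lee_fin mulr_ge0 ?dot_ge0// mulr_ge0.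
Qed.

End covariance.

(** * Expectation of the error bound *)

Section random_bound.
Context {R : realType} {d : measure_display} {X : measurableType d} (H : rkhs R X).
Local Notation "''[' f , g ]" := (rkhs_dot H f g) : ring_scope.
Local Notation sec := (rkhs_sec H).
Variables (rho : probability (X * R)%type R) (nu : probability X R) (k : R.-pker X ~> R).
Variables (T : H -> H) (K2 : R) (e : nat -> H) (ev : nat -> R) (lam D : R).
Hypothesis nuE : is_marginal rho nu.
Hypothesis rhoE : is_conditional rho nu k.
Hypothesis mH : rkhs_measurable H.
Hypothesis secK2 : forall x, '[sec x, sec x] <= K2.
Hypothesis covT : is_covariance nu T.
Hypothesis eb : eigenbasis T e ev.
Hypothesis lam0 : 0 < lam.
Hypothesis dimD : (effective_dim T lam <= D%:E)%E.
Variables (g : H) (s2 : R).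
Hypothesis gE : {ae nu, forall x, regression k x = '[g, sec x]}.
Hypothesis s20 : 0 <= s2.
Hypothesis var : {ae nu, forall x, (\int[k x]_y ((y - '[g, sec x]) ^+ 2)%:E <= s2%:E)%E}.
Variables (n : nat) (mu : probability (n.-tuple (X * R)%type) R).
Hypothesis n0 : (0 < n)%N.
Hypothesis muE : forall A : 'I_n -> set (X * R), (forall i, measurable (A i)) ->
  mu (box A) = (\prod_(i < n) rho (A i))%E.

Let nR : 0 < n%:R :> R. Proof. by rewrite ltr0n. Qed.
Let K20 : 0 <= K2 := K2_ge0 secK2.
Let B := lam^-1 * (4 * K2 ^+ 2).
Let mg := measurable_rkhs mH g.

Let devZ N (z z' : X * R) := dev_kernel e ev lam N z.1 z'.1.
Let noiseZ N := noise_kernel (fun x => '[g, sec x]) (eval_kernel e ev lam N).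

Let dimN N : \sum_(a < N) (ev a + lam)^-1 * (ev a * '[e a, e a]) <= D.
Proof. exact: effective_dim_bound. Qed.

Let D0 : 0 <= D.
Proof. by have := dimN 0; rewrite big_ord0. Qed.

Let devZ_psd N : psd_kernel (devZ N).
Proof.
have [KC KP] := dev_kernel_psd eb lam0 N; split; first by move=> z z'; exact: KC.
move=> s; have := KP [seq (p.1, p.2.1) | p <- s]; rewrite big_map; congr (_ <= _).
by apply: eq_bigr => p _; rewrite big_map.
Qed.

Let mdevZ N : measurable_fun setT (fun p : (X * R) * (X * R) => devZ N p.1 p.2).
Proof.
apply: (measurableT_comp (measurable_dev_kernel mH e ev lam N)
  (g := fun p : (X * R) * (X * R) => (p.1.1, p.2.1))).
by apply: measurable_fun_pair; apply: measurableT_comp.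
Qed.

Let expect_le_marginal f A : expect_le nu f A -> expect_le rho (fun z => f z.1) A.
Proof.
move=> [mf f0 fA]; split => //; first exact: measurableT_comp mf measurable_fst.
by rewrite (integral_marginal_EFin nuE).
Qed.

Let devZ_B N z : devZ N z z <= B.
Proof. exact: dev_kernel_le. Qed.

Let devZ_mean N : expect_le rho (fun z => devZ N z z) (K2 * D).
Proof. by apply: (expect_le_marginal (f := fun x => dev_kernel e ev lam N x x)); exact: dev_kernel_mean. Qed.

Let devZ_deg N a : (\int[rho]_z (devZ N a z)%:E = 0)%E.
Proof.
rewrite /devZ (integral_marginal_EFin nuE (f := fun x => dev_kernel e ev lam N a.1 x)).
  exact: dev_kernel_degenerate.
exact: (measurable_fun_pair2 a.1 (measurable_dev_kernel mH e ev lam N)).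
Qed.

Let evalZ_mean N : expect_le rho (fun z => eval_kernel e ev lam N z.1 z.1) D.
Proof. by apply: (expect_le_marginal (f := fun x => eval_kernel e ev lam N x x)); exact: eval_kernel_mean. Qed.

(** The truncation of [Y_J] to [N] eigenvectors. *)
Definition ratio N (J : seq 'I_n) (w : n.-tuple (X * R)) : R :=
  lam^-1 * ((size J)%:R^-1 ^+ 2 * quad (devZ N) (pts J w)).

(** The truncation of [q] to [N] eigenvectors. *)
Definition noise_norm N (w : n.-tuple (X * R)) : R :=
  n%:R^-1 ^+ 2 * quad (noiseZ N) (pts (enum 'I_n) w).

Let invn_ge0 (m : nat) : 0 <= (m%:R^-1 : R) ^+ 2. Proof. exact: sqr_ge0. Qed.
Let lamV0 : 0 <= lam^-1. Proof. by rewrite invr_ge0 ltW. Qed.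

Lemma ratio_ge0 N J w : 0 <= ratio N J w.
Proof. by rewrite mulr_ge0// mulr_ge0//; exact: quad_ge0. Qed.

Lemma measurable_ratio N J : measurable_fun setT (ratio N J).
Proof.
apply: measurable_funM; first exact: measurable_cst.
by apply: measurable_funM; [exact: measurable_cst|exact: measurable_quad].
Qed.

(** The bound of [quad_moments] with mean [K2 * D] and supremum [B = 4 K2^2 / lam], multiplied by
    [lam^-2 m^-4]; thus [12 = 3 * 4]. *)
Definition ratio_moment (m : nat) : R :=
  4 * K2 ^+ 2 * (D / (lam * m%:R)) ^+ 2 + 12 * K2 ^+ 3 * (D / (lam * m%:R)) * (lam * m%:R)^-1 ^+ 2.

Lemma ratio_sq_expect N J : uniq J -> (0 < size J)%N ->
  expect_le mu (fun w => ratio N J w ^+ 2) (ratio_moment (size J)).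
Proof.
move=> uJ J0; have Jn : (size J)%:R != 0 :> R by rewrite pnatr_eq0 -lt0n.
have [_ E2] := quad_moments muE (mdevZ N) (devZ_psd N) (devZ_B N) (devZ_mean N) (devZ_deg N) uJ.
rewrite (_ : (fun w => _) = (fun w =>
    (lam^-1 * (size J)%:R^-1 ^+ 2) ^+ 2 * quad (devZ N) (pts J w) ^+ 2)); last first.
  by apply/funext => w; rewrite /ratio mulrA exprMn.
apply: (expect_le_trans (expect_leZ _ E2)); first exact: sqr_ge0.
rewrite le_eqVlt; apply/orP; left; apply/eqP; rewrite /ratio_moment /B.
by field; rewrite Jn gt_eqF.
Qed.

Lemma noise_expect N : expect_le mu (noise_norm N) (s2 * D / n%:R).
Proof.
pose Phi := fun _ : n.-tuple (X * R)%type => 1 : R.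
have mPhi : measurable_fun setT Phi by exact: measurable_cst.
have Phi0 w : 0 <= Phi w by exact: ler01.
have Phi1 w : Phi w <= 1 by [].
have Phix i w x y y' : Phi (upd i w (x, y)) = Phi (upd i w (x, y')) by [].
have PhiD i : expect_le mu (fun w => Phi w * eval_kernel e ev lam N (tnth w i).1 (tnth w i).1) D.
  rewrite (_ : (fun w => _) = (fun w => eval_kernel e ev lam N (tnth w i).1 (tnth w i).1)); last first.
    by apply/funext => w; rewrite mul1r.
  exact: (expect_le_coord muE i (evalZ_mean N)).
have E := noise_moment muE nuE rhoE mg gE s20 var (measurable_eval_kernel mH e ev lam N)
  (eval_kernel_psd eb lam0 N) (eval_kernel_le secK2 eb lam0 N) mPhi Phi0 Phi1 Phix PhiD
  (enum_uniq 'I_n).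
rewrite (_ : noise_norm N = (fun w => n%:R^-1 ^+ 2 * (Phi w * quad (noiseZ N) (pts (enum 'I_n) w)))); last first.
  by apply/funext => w; rewrite /noise_norm mul1r.
apply: (expect_le_trans (expect_leZ _ E)); first exact: sqr_ge0.
rewrite size_enum_ord le_eqVlt; apply/orP; left; apply/eqP.
by field; rewrite gt_eqF.
Qed.

(** [96 = 24 * 4] and [128 = 8 * 4 ^ 2]: the coefficients of [quad_loo_moment] combined with the 4
    in [B]. *)
Definition mixed_moment : R := s2 * D / n%:R * (32 * K2 ^+ 2 * (D / (lam * n%:R)) ^+ 2
   + 96 * K2 ^+ 3 * (D / (lam * n%:R)) * (lam * n%:R)^-1 ^+ 2
   + 128 * K2 ^+ 4 * (lam * n%:R)^-1 ^+ 4).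

(** The squared ratio depends on the inputs only, so it is an admissible weight [Phi] for
    [noise_moment]; [quad_loo_moment] decouples it from the diagonal of [eval_kernel] at one sample
    point. *)
Lemma mixed_expect N :
  expect_le mu (fun w => ratio N (enum 'I_n) w ^+ 2 * noise_norm N w) mixed_moment.
Proof.
have B0 : 0 <= B by rewrite mulr_ge0// mulr_ge0// sqr_ge0.
pose J := enum 'I_n; pose Phi w := ratio N J w ^+ 2.
have uJ : uniq J by exact: enum_uniq.
have sJ : size J = n by exact: size_enum_ord.
pose c : R := (lam^-1 * n%:R^-1 ^+ 2) ^+ 2.
have c0 : 0 <= c by exact: sqr_ge0.
have PhiE w : Phi w = c * quad (devZ N) (pts J w) ^+ 2.
  by rewrite /Phi /ratio sJ mulrA exprMn.
have q0 s := quad_ge0 (devZ_psd N) s.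
have quad_le s : quad (devZ N) s <= (size s)%:R ^+ 2 * B.
  by apply: quad_bounded => a b; exact: psd_bounded.
pose A := c * ((32 * n%:R ^+ 2 * (K2 * D) ^+ 2 + 24 * n%:R * B * (K2 * D) + 8 * B ^+ 2) * D).
have mPhi : measurable_fun setT Phi by apply: measurable_funX; exact: measurable_ratio.
have Phi0 w : 0 <= Phi w by exact: sqr_ge0.
have PhiC w : Phi w <= c * (n%:R ^+ 2 * B) ^+ 2.
  rewrite PhiE ler_wpM2l// ler_sqr ?nnegrE ?mulr_ge0 ?sqr_ge0//.
  by apply: (le_trans (quad_le _)); rewrite size_map sJ.
have Phix i w x y y' : Phi (upd i w (x, y)) = Phi (upd i w (x, y')).
  rewrite !PhiE; congr (_ * _ ^+ 2); rewrite /quad /pts !big_map.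
  apply: eq_bigr => j _; rewrite !big_map; apply: eq_bigr => j' _.
  by rewrite /devZ !tnth_upd; do !case: ifP.
have PhiA i : expect_le mu (fun w => Phi w * eval_kernel e ev lam N (tnth w i).1 (tnth w i).1) A.
  have := quad_loo_moment muE (mdevZ N) (devZ_psd N) (devZ_B N) (devZ_mean N) (devZ_deg N)
    uJ (mem_enum _ i) (evalZ_mean N).
  rewrite sJ => /(expect_leZ c0).
  rewrite (_ : (fun w => _) = (fun w => Phi w * eval_kernel e ev lam N (tnth w i).1 (tnth w i).1))//.
  by apply/funext => w; rewrite PhiE mulrA.
have E := noise_moment muE nuE rhoE mg gE s20 var (measurable_eval_kernel mH e ev lam N)
  (eval_kernel_psd eb lam0 N) (eval_kernel_le secK2 eb lam0 N) mPhi Phi0 PhiC Phix PhiA uJ.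
rewrite (_ : (fun w => _) = (fun w => n%:R^-1 ^+ 2 * (Phi w * quad (noiseZ N) (pts J w)))); last first.
  by apply/funext => w; rewrite /noise_norm -/J /Phi mulrCA.
apply: (expect_le_trans (expect_leZ _ E)); first exact: sqr_ge0.
rewrite sJ le_eqVlt; apply/orP; left; apply/eqP; rewrite /mixed_moment /A /c /B.
by field; rewrite !gt_eqF.
Qed.

Lemma ratio_dev N (J : seq 'I_n) (w : n.-tuple (X * R)) : (0 < size J)%N ->
  lam * ratio N J w = dev T e ev lam N [seq (tnth w i).1 | i <- J].
Proof.
move=> J0; rewrite (dev_quad lam eb) ?size_map//.
rewrite /ratio mulVKf ?gt_eqF//; congr (_ * _).
rewrite /quad /pts !big_map; apply: eq_bigr => i _.
by rewrite !big_map.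
Qed.

(** One more eigenvector adds a multiple of the squared norm of a sum of features. Monotonicity and
    boundedness in [N] give limits for every sample, which become the [Yn], [Yl] and [q] of the
    deterministic bound. *)
Lemma ratio_nd (J : seq 'I_n) w : {homo (fun N => ratio N J w) : a b / (a <= b)%N >-> a <= b}.
Proof.
apply/nondecreasing_seqP => N; rewrite /ratio ler_wpM2l// ler_wpM2l//.
rewrite /quad -subr_ge0 -sumrB (_ : \sum_(_ <- _) _ =
    quad (fun z z' : X * R => (ev N + lam)^-1 * '[dev_feature e ev N z.1, dev_feature e ev N z'.1])
      (pts J w)).
  rewrite /quad; under eq_bigr do rewrite -mulr_sumr -dot_sumr.
  rewrite -mulr_sumr -dot_suml mulr_ge0 ?dot_ge0// invr_ge0 addr_ge0 ?(ltW lam0)//.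
  by case: eb.
apply: eq_bigr => z _; rewrite -sumrB; apply: eq_bigr => z' _.
by rewrite /devZ /dev_kernel big_ord_recr/= addrAC subrr add0r.
Qed.

Lemma ratio_bounded (J : seq 'I_n) w : has_ubound (range (fun N => ratio N J w)).
Proof.
exists (lam^-1 * ((size J)%:R^-1 ^+ 2 * ((size (pts J w))%:R ^+ 2 * B))) => _ [N _ <-].
rewrite /ratio ler_wpM2l// ler_wpM2l//; apply: quad_bounded => a b.
exact: psd_bounded.
Qed.

Lemma noise_normE N w : noise_norm N w = \sum_(a < N) (ev a + lam)^-1 *
  (n%:R^-1 * \sum_i ((tnth w i).2 - '[g, sec (tnth w i).1]) * '[e a, sec (tnth w i).1]) ^+ 2.
Proof.
rewrite /noise_norm /quad /pts big_map big_enum/=.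
transitivity (\sum_i \sum_j \sum_(a < N) (ev a + lam)^-1 *
  ((n%:R^-1 * (((tnth w i).2 - '[g, sec (tnth w i).1]) * '[e a, sec (tnth w i).1])) *
   (n%:R^-1 * (((tnth w j).2 - '[g, sec (tnth w j).1]) * '[e a, sec (tnth w j).1])))).
  rewrite mulr_sumr; apply: eq_bigr => i _; rewrite big_map big_enum/= mulr_sumr.
  apply: eq_bigr => j _; rewrite /noiseZ /noise_kernel /eval_kernel !mulr_sumr.
  by apply: eq_bigr => a _; ring.
transitivity (\sum_i \sum_(a < N) \sum_j (ev a + lam)^-1 *
  ((n%:R^-1 * (((tnth w i).2 - '[g, sec (tnth w i).1]) * '[e a, sec (tnth w i).1])) *
   (n%:R^-1 * (((tnth w j).2 - '[g, sec (tnth w j).1]) * '[e a, sec (tnth w j).1])))).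
  by apply: eq_bigr => i _; exact: exchange_big.
rewrite exchange_big/=; apply: eq_bigr => a _.
rewrite [in RHS]mulr_sumr expr2 [in RHS]mulr_suml [RHS]mulr_sumr.
apply: eq_bigr => i _; rewrite [in RHS]mulr_sumr [RHS]mulr_sumr.
by apply: eq_bigr => j _.
Qed.

Lemma noise_norm_nd w : {homo (fun N => noise_norm N w) : a b / (a <= b)%N >-> a <= b}.
Proof.
apply/nondecreasing_seqP => N; rewrite !noise_normE big_ord_recr/= lerDl.
rewrite mulr_ge0 ?sqr_ge0// invr_ge0 addr_ge0 ?(ltW lam0)//.
by case: eb.
Qed.

(** The bound depends on the labels of the sample, which is enough for a pointwise limit. *)
Lemma noise_norm_bounded w : has_ubound (range (fun N => noise_norm N w)).
Proof.
pose f := n%:R^-1 *: lincomb H (fun i => (tnth w i).1)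
  (fun i => (tnth w i).2 - '[g, sec (tnth w i).1]).
exists (lam^-1 * '[f, f]) => _ [N _ <-]; rewrite noise_normE.
apply: (@le_trans _ _ (lam^-1 * \sum_(a < N) '[f, e a] ^+ 2)); last first.
  by rewrite ler_wpM2l//; exact: bessel eb N f.
rewrite mulr_sumr; apply: ler_sum => a _; rewrite /f dotZl lincomb_dot.
rewrite ler_wpM2r ?sqr_ge0// lef_pV2 ?posrE// ?lerDr ?ltr_wpDl//; by case: eb.
Qed.

Section pointwise.
Variables (l : nat) (s : 'I_l -> 'I_n) (sr theta : R).
Hypothesis l0 : (0 < l)%N.
Hypothesis sr0 : 0 <= sr.
Hypothesis theta0 : 0 < theta.
Hypothesis src : forall v, (lam * '[g, v]) ^+ 2 <= sr ^+ 2 * energy T lam v.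

Let Jn := enum 'I_n.
Let Jl := [seq s j | j <- enum 'I_l].

(** The right-hand side of [excess_bound] after two splittings: AM-GM with weight [theta] on
    [Yn * Yl], and [(2 + Yn) ^ 2 <= 8 + 2 Yn ^ 2], whence [192 = 24 * 8] and [48 = 24 * 2]. *)
Definition majorant N (w : n.-tuple (X * R)) : R :=
  500 * sr ^+ 2 + (500 * sr ^+ 2 + 450 * lam * '[g, g] * theta) * ratio N Jl w ^+ 2
  + 900 * lam * '[g, g] * (1 + theta^-1 / 2) * ratio N Jn w ^+ 2
  + 192 * noise_norm N w + 48 * (ratio N Jn w ^+ 2 * noise_norm N w).

Let sJn : (0 < size Jn)%N. Proof. by rewrite size_enum_ord. Qed.
Let sJl : (0 < size Jl)%N. Proof. by rewrite size_map size_enum_ord. Qed.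

Lemma excess_majorant w : exists G : R,
  (fun N => majorant N w) @ \oo --> G /\
  exists2 fh : H,
    forall t, nystrom (rkhs_kernel H) lam (fun i => (tnth w i).1) (fun i => (tnth w i).2) s t
      = rkhs_fun fh t &
    '[T (fh - g), fh - g] <= G.
Proof.
have cl := nondecreasing_cvgn (ratio_nd Jl w) (ratio_bounded Jl w).
have cn := nondecreasing_cvgn (ratio_nd Jn w) (ratio_bounded Jn w).
have cq := nondecreasing_cvgn (noise_norm_nd w) (noise_norm_bounded w).
have ul N : ratio N Jl w <= sup (range (fun N => ratio N Jl w)).
  by apply: ub_le_sup; [exact: ratio_bounded|exists N].
have un N : ratio N Jn w <= sup (range (fun N => ratio N Jn w)).
  by apply: ub_le_sup; [exact: ratio_bounded|exists N].
have uq N : noise_norm N w <= sup (range (fun N => noise_norm N w)).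
  by apply: ub_le_sup; [exact: noise_norm_bounded|exists N].
move: (sup _) (sup _) (sup _) cl cn cq ul un uq => q Yn Yl cl cn cq ul un uq.
exists (500 * sr ^+ 2 + (500 * sr ^+ 2 + 450 * lam * '[g, g] * theta) * Yl ^+ 2
  + 900 * lam * '[g, g] * (1 + theta^-1 / 2) * Yn ^+ 2 + 192 * q + 48 * (Yn ^+ 2 * q)); split.
  have sq (u : nat -> R) (a : R) : u @ \oo --> a -> (fun N => u N ^+ 2) @ \oo --> a ^+ 2.
    by move=> ua; rewrite expr2; apply: cvgM.
  apply: cvgD; last by apply: cvgMl_tmp; apply: cvgM => //; exact: sq.
  apply: cvgD; last exact: cvgMl_tmp.
  apply: cvgD; last by apply: cvgMl_tmp; exact: sq.
  by apply: cvgD; [exact: cvg_cst|apply: cvgMl_tmp; exact: sq].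
have Yn0 : 0 <= Yn by exact: le_trans (ratio_ge0 0 Jn w) (un 0).
have Yl0 : 0 <= Yl by exact: le_trans (ratio_ge0 0 Jl w) (ul 0).
have [|||fh fhE fhB] := @excess_bound _ _ H T e ev lam (covariance_sym mH secK2 covT)
  (covariance_ge0 mH secK2 covT) eb lam0 n l (fun i => (tnth w i).1) (fun i => (tnth w i).2) s
  g Yn Yl q sr n0 _ _ _ src sr0.
- by move=> N; rewrite -ratio_dev// ler_wpM2l// ltW.
- move=> N; have := ratio_dev N w sJl; rewrite /Jl -map_comp => <-.
  by rewrite ler_wpM2l// ltW.
- by move=> N; rewrite -noise_normE.
exists fh => //; apply: (le_trans fhB).
have q0 : 0 <= q.
  by apply: le_trans (uq 0); rewrite noise_normE big_ord0.
have lg0 : 0 <= lam * '[g, g] by rewrite mulr_ge0 ?dot_ge0// ltW.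
have amgm : Yn * Yl <= theta^-1 / 2 * Yn ^+ 2 + theta / 2 * Yl ^+ 2.
  have t0 : theta != 0 by rewrite gt_eqF.
  rewrite -subr_ge0; have -> : theta^-1 / 2 * Yn ^+ 2 + theta / 2 * Yl ^+ 2 - Yn * Yl =
    (Yn - theta * Yl) ^+ 2 * (theta^-1 / 2) by field.
  by rewrite mulr_ge0 ?sqr_ge0// divr_ge0// invr_ge0 ltW.
have h1 := ler_wpM2l lg0 amgm.
have h2 : (2 + Yn) ^+ 2 * q <= (8 + 2 * Yn ^+ 2) * q.
  by rewrite ler_wpM2r//; have := sqr_ge0 (Yn - 2); rewrite !expr2; lra.
by move: h1 h2; lra.
Qed.

(** Injectivity of [s] makes the subsampled indices distinct, so the subsample is itself i.i.d. and
    [ratio_sq_expect] applies with size [l]. *)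
Lemma majorant_expect N : injective s -> expect_le mu (majorant N)
  (500 * sr ^+ 2 + (500 * sr ^+ 2 + 450 * lam * '[g, g] * theta) * ratio_moment l
  + 900 * lam * '[g, g] * (1 + theta^-1 / 2) * ratio_moment n
  + 192 * (s2 * D / n%:R) + 48 * mixed_moment).
Proof.
move=> s_inj.
have lg0 : 0 <= lam * '[g, g] by rewrite mulr_ge0 ?dot_ge0// ltW.
have uJl : uniq Jl by rewrite map_inj_uniq// enum_uniq.
have El := ratio_sq_expect N uJl sJl; rewrite size_map size_enum_ord in El.
have En := ratio_sq_expect N (enum_uniq 'I_n) sJn; rewrite size_enum_ord in En.
have c0 : 0 <= 500 * sr ^+ 2 by exact: mulr_ge0 (ler0n _ _) (sqr_ge0 _).
have c1 : 0 <= 500 * sr ^+ 2 + 450 * lam * '[g, g] * theta.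
  apply: (addr_ge0 c0); apply: mulr_ge0; last exact: ltW.
  by rewrite -mulrA; exact: mulr_ge0 (ler0n _ _) lg0.
have c2 : 0 <= 900 * lam * '[g, g] * (1 + theta^-1 / 2).
  have t0 : 0 <= theta^-1 by rewrite invr_ge0 ltW.
  apply: mulr_ge0; last by rewrite addr_ge0// divr_ge0.
  by rewrite -mulrA; exact: mulr_ge0 (ler0n _ _) lg0.
have E3 := expect_leZ (ler0n R 192) (noise_expect N).
have E4 := expect_leZ (ler0n R 48) (mixed_expect N).
exact: (expect_leD (expect_leD (expect_leD (expect_leD (expect_le_cst mu c0)
  (expect_leZ c1 El)) (expect_leZ c2 En)) E3) E4).
Qed.

End pointwise.
End random_bound.

(* The integral of a nonnegative function is a lower integral, hence monotone
   even on nonmeasurable functions. *)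
Lemma ge0_le_lower_integral {d} {T : measurableType d} {R : realType}
    (m : {measure set T -> \bar R}) (f g : T -> \bar R) :
  (forall x, 0 <= f x)%E -> (forall x, f x <= g x)%E ->
  (\int[m]_x f x <= \int[m]_x g x)%E.
Proof.
move=> f0 fg; rewrite !ge0_integralTE//; last by move=> x; exact: le_trans (fg x).
apply: le_ereal_sup => _ [h hf <-]; exists h => // x.
exact: le_trans (hf x) (fg x).
Qed.

(** * Law of the sample and conditioning on the draw *)

Section sample_law.
Context {d d'} {Omega : measurableType d'} {Z : measurableType d} {R : realType}
  (P : probability Omega R) (n : nat).
Variable (z : 'I_n -> Omega -> Z).
Hypothesis mz : forall i, measurable_fun setT (z i).

Definition sample w : n.-tuple Z := [tuple z i w | i < n].

Lemma measurable_sample : measurable_fun setT sample.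
Proof.
apply/measurable_fun_tnthP => i; rewrite (_ : _ \o _ = z i)//.
by apply/funext => w /=; rewrite tnth_mktuple.
Qed.

Lemma preimage_box (A : 'I_n -> set Z) :
  sample @^-1` box A = \bigcap_(i in [set: 'I_n]) (z i @^-1` A i).
Proof.
apply/seteqP; split => w /= wA i.
  by move=> _; have := wA i; rewrite tnth_mktuple.
by rewrite tnth_mktuple; exact: wA.
Qed.

Lemma sample_law : exists mu : probability (n.-tuple Z) R,
  forall A, mu A = P (sample @^-1` A).
Proof.
pose X : {mfun Omega >-> n.-tuple Z} :=
  HB.pack sample (isMeasurableFun.Build _ _ _ _ _ measurable_sample).
by exists (distribution P X).
Qed.

(** On the event [D] the sample has law [c] times [mu], since by independence both measures agree on
    boxes. *)
Lemma integral_independent (mu : probability (n.-tuple Z) R) (D : set Omega) (c : R)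
    (G : n.-tuple Z -> R) (E : R) :
  (forall A, mu A = P (sample @^-1` A)) -> measurable D -> P D = c%:E ->
  (forall A, (forall i, measurable (A i)) ->
    P (\bigcap_(i in [set: 'I_n]) (z i @^-1` A i) `&` D) =
    (P (\bigcap_(i in [set: 'I_n]) (z i @^-1` A i)) * P D)%E) ->
  expect_le mu G E ->
  (\int[P]_(w in D) (G (sample w))%:E <= (c * E)%:E)%E.
Proof.
move=> muP mD Dc ind [mG G0 GE].
have c0 : 0 <= c by rewrite -lee_fin -Dc.
have mGs : measurable_fun setT (fun w => (G (sample w))%:E).
  by apply/measurable_EFinP; exact: measurableT_comp mG measurable_sample.
rewrite (@eq_measure_integral _ _ _ _ (mrestr P mD)); last first.
  by move=> A _ AD; rewrite /= /mrestr setIidl.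
apply: (le_trans (ge0_subset_integral _ mD measurableT mGs _ _)) => //.
  by move=> w _; rewrite lee_fin.
rewrite -(ge0_integral_pushm (mrestr P mD) measurable_sample
  (F := fun w => (G w)%:E))//; last first.
  exact/measurable_EFinP.
rewrite (@eq_measure_integral _ _ _ _ (mscale (NngNum c0) mu)); last first.
  move=> A mA _; apply: (@boxes_unique _ _ _ _ (pushm (mrestr P mD) measurable_sample)
    (mscale (NngNum c0) mu)) => // [B mB|].
    by rewrite /= /mscale/= /pushforward /mrestr/= muP preimage_box ind// Dc muleC.
  rewrite /= /pushforward /mrestr/= preimage_setT setTI.
  by rewrite Dc ltry.
rewrite ge0_integral_mscale//; last 2 first.
- exact/measurable_EFinP.
- by move=> w _; rewrite lee_fin.
by rewrite EFinM lee_wpmul2l// lee_fin.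
Qed.

End sample_law.

(** The probability space is cut along the values of [S]: on each piece the sample keeps its law, up
    to the weight of the draw, and these weights sum to at most 1. *)
Lemma nystrom_sampling_expect {d d'} {X : measurableType d} {R : realType}
    (rho : probability (X * R)%type R) {Omega : measurableType d'}
    (P : probability Omega R) (n l : nat) (Z : 'I_n -> Omega -> X * R)
    (S : Omega -> {ffun 'I_l -> 'I_n}) (mu : probability (n.-tuple (X * R)) R)
    (F : Omega -> \bar R) (G : {ffun 'I_l -> 'I_n} -> n.-tuple (X * R) -> R) (E : R) :
  nystrom_sampling rho P Z S -> (forall A, mu A = P (sample Z @^-1` A)) ->
  (forall w, 0 <= F w)%E -> (forall w, F w <= (G (S w) (sample Z w))%:E)%E ->
  0 <= E -> (forall s : {ffun 'I_l -> 'I_n}, injective s -> expect_le mu (G s) E) ->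
  (\int[P]_w F w <= E%:E)%E.
Proof.
move=> [[mZ mS] _ PS ind] muP F0 FG E0 GE.
pose draws := [set s : {ffun 'I_l -> 'I_n} | injectiveb s]%SET; rewrite -/draws in PS.
(* Outside [draws] no bound on [G s] is available; the value [+oo] preserves the pointwise
   inequality and integrates to 0 over a null event. *)
pose t s w := if s \in draws then (G s (sample Z w))%:E else +oo%E.
have inj (s : {ffun 'I_l -> 'I_n}) : s \in draws -> injective s by rewrite inE => /injectiveP.
have t0 s w : (0 <= t s w)%E.
  by rewrite /t; case: ifP => // /inj /GE[_ G0 _]; rewrite lee_fin.
have mt s : measurable_fun setT (t s).
  have [sd|/negbTE sd] := boolP (s \in draws); last first.
    by rewrite /t sd; exact: measurable_cst.
  rewrite /t sd; have [mG _ _] := GE s (inj s sd).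
  apply/measurable_EFinP; exact: measurableT_comp mG (measurable_sample mZ).
(* [F] is not assumed measurable, so it is dominated by a measurable function before additivity is
   used. *)
apply: (@le_trans _ _ (\int[P]_w \sum_s (t s \_ (S @^-1` [set s])) w)%E).
  apply: ge0_le_lower_integral => // w; rewrite (bigD1 (S w))//= patchE mem_set//.
  apply: le_trans (leeDl _ _); last first.
    by apply: sume_ge0 => s _; rewrite patchE; case: ifP.
  by rewrite /t; case: ifP; rewrite ?leey.
rewrite ge0_integral_sum//; last 2 first.
- move=> s; apply/(measurable_restrictT _ (mS s)).
  exact: measurable_funS (mt s).
- by move=> s w _; rewrite patchE; case: ifP.
apply: (@le_trans _ _ (\sum_s ((if s \in draws then #|draws|%:R^-1 else 0) * E)%:E)%E).
  apply: lee_sum => s _; rewrite -integral_mkcond /t; have := PS s; case: ifP => sd PD.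
    by apply: (integral_independent mZ muP (mS s) PD) => [A mA|]; [exact: ind|exact/GE/inj].
  by rewrite integral_cst// [X in (_ * X)%E]PD mul0r mule0.
rewrite sumEFin -mulr_suml lee_fin ler_piMl//.
rewrite -big_mkcond/= sumr_const.
case: (posnP #|draws|) => [->|d0]; first by rewrite mulr0n.
rewrite -[X in X <= _]mulr_natl mulfV// pnatr_eq0 -lt0n//.
Qed.

(** * Expected excess risk of the estimator *)

Section expected_risk.
Context {R : realType} {d d' : measure_display} {X : measurableType d} (H : rkhs R X).
Local Notation "''[' f , g ]" := (rkhs_dot H f g) : ring_scope.
Local Notation sec := (rkhs_sec H).
Variables (rho : probability (X * R)%type R) (nu : probability X R) (k : R.-pker X ~> R).
Variables (T : H -> H) (K2 : R) (e : nat -> H) (ev : nat -> R) (lam D : R).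
Hypothesis nuE : is_marginal rho nu.
Hypothesis rhoE : is_conditional rho nu k.
Hypothesis mH : rkhs_measurable H.
Hypothesis secK2 : forall x, '[sec x, sec x] <= K2.
Hypothesis covT : is_covariance nu T.
Hypothesis eb : eigenbasis T e ev.
Hypothesis lam0 : 0 < lam.
Hypothesis dimD : (effective_dim T lam <= D%:E)%E.
Variables (g : H) (s2 : R).
Hypothesis gE : {ae nu, forall x, regression k x = '[g, sec x]}.
Hypothesis s20 : 0 <= s2.
Hypothesis var : {ae nu, forall x, (\int[k x]_y ((y - '[g, sec x]) ^+ 2)%:E <= s2%:E)%E}.

Lemma excess_risk_rkhs (f : H) :
  (risk rho (rkhs_fun f) - risk rho (regression k) = ('[T (f - g), f - g])%:E)%E.
Proof.
have fE x : rkhs_fun f x - '[g, sec x] = '[f - g, sec x].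
  by rewrite dotBl rkhs_reproducing.
rewrite (excess_riskE nuE rhoE (measurable_rkhs mH g) gE s20 var
  (f := rkhs_fun f) (B := 1 + '[f - g, f - g] * K2)).
- by rewrite -(covariance_sq mH secK2 covT); apply: eq_integral => x _; rewrite fE.
- rewrite (_ : rkhs_fun f = fun x => '[f, sec x]); first exact: measurable_rkhs.
  by apply/funext => x; rewrite rkhs_reproducing.
move=> x; rewrite fE; have := eval_sq_le secK2 (f - g) x.
rewrite -(real_normK (num_real '[f - g, sec x])); move: (`|_|) (_ * _) => a b.
by have := sqr_ge0 (a - 1); rewrite !expr2; nra.
Qed.

Variables (Omega : measurableType d') (P : probability Omega R) (n l : nat)
  (Z : 'I_n -> Omega -> X * R) (S : Omega -> {ffun 'I_l -> 'I_n}).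
Hypothesis ZS : nystrom_sampling rho P Z S.
Variables sr theta : R.
Hypothesis n0 : (0 < n)%N.
Hypothesis l0 : (0 < l)%N.
Hypothesis ln : (l <= n)%N.
Hypothesis sr0 : 0 <= sr.
Hypothesis theta0 : 0 < theta.
Hypothesis src : forall v, (lam * '[g, v]) ^+ 2 <= sr ^+ 2 * energy T lam v.

Lemma expected_excess_risk_le : (expected_excess_risk rho k H P Z S lam <=
  (500 * sr ^+ 2 + (500 * sr ^+ 2 + 450 * lam * '[g, g] * theta) * ratio_moment K2 lam D l
  + 900 * lam * '[g, g] * (1 + theta^-1 / 2) * ratio_moment K2 lam D n
  + 192 * (s2 * D / n%:R) + 48 * mixed_moment K2 lam D s2 n)%:E)%E.
Proof.
have [[mZ _] ZA _ _] := ZS.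
have [mu muP] := sample_law P mZ.
have muE A : (forall i, measurable (A i)) -> mu (box A) = (\prod_(i < n) rho (A i))%E.
  by move=> mA; rewrite muP preimage_box ZA.
(* The limit of the majorants is chosen for each draw and sample; its measurability comes back from
   [expect_le_lim]. *)
have /choice[G GP] := fun p : {ffun 'I_l -> 'I_n} * n.-tuple (X * R) =>
  excess_majorant mH secK2 covT eb lam0 n0 p.1 l0 sr0 theta0 src p.2.
have Gle (s : {ffun 'I_l -> 'I_n}) : injective s -> expect_le mu (fun w => G (s, w)) _ :=
  fun si => expect_le_lim (fun N => majorant_expect nuE rhoE mH secK2 covT eb lam0 dimD gE s20
    var n0 muE sr l0 theta0 N si) (fun w => (GP (s, w)).1).
have riskE w : exists2 a : R, 0 <= a <= G (S w, sample Z w) &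
    (risk rho (nystrom (rkhs_kernel H) lam (fun i => (Z i w).1) (fun i => (Z i w).2) (S w))
     - risk rho (regression k) = a%:E)%E.
  have [_ [fh fhE fhG]] := GP (S w, sample Z w).
  exists '[T (fh - g), fh - g]; first by rewrite (covariance_ge0 mH secK2 covT).
  rewrite -excess_risk_rkhs; congr (risk rho _ - _)%E; apply/funext => t.
  rewrite -fhE.
  have -> : (fun i => (tnth (sample Z w) i).1) = (fun i => (Z i w).1).
    by apply/funext => i; rewrite tnth_mktuple.
  have -> : (fun i => (tnth (sample Z w) i).2) = (fun i => (Z i w).2).
    by apply/funext => i; rewrite tnth_mktuple.
  by [].
(* An injective draw exists because [l <= n]; it shows that the bound is nonnegative. *)
pose s0 : {ffun 'I_l -> 'I_n} := [ffun i => widen_ord ln i].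
have s0i : injective s0.
  by move=> i j; rewrite !ffunE => /(congr1 val) /= /val_inj.
have E0 := expect_le_ge0 (Gle s0 s0i).
apply: (nystrom_sampling_expect ZS muP (G := fun s w => G (s, w)) _ _ E0 Gle) => w.
  by have [a /andP[a0 _] ->] := riskE w; rewrite lee_fin.
by have [a /andP[_ aG] ->] := riskE w; rewrite lee_fin.
Qed.

End expected_risk.

(** * Rates *)

Section rates.
Context {R : realType}.
Variables (K2 s2 Rad2 Q1 cl c1 c2 c2r : R).
Hypotheses (K20 : 0 <= K2) (s20 : 0 <= s2) (Q10 : 0 <= Q1)
  (cl0 : 0 < cl) (c10 : 0 < c1).

(** This is [ratio_moment] with [u = D / (lam * m)] and [v = (lam * m)^-1]. *)
Definition moment_const (u v : R) : R := 4 * K2 ^+ 2 * u ^+ 2 + 12 * K2 ^+ 3 * u * v ^+ 2.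

Definition rate_const : R :=
  let E1 := moment_const (Q1 / (c1 * cl)) (c1 * cl)^-1 in
  let E2 := moment_const (Q1 / c1) c1^-1 in
  let E3 := 32 * K2 ^+ 2 * (Q1 / c1) ^+ 2 + 96 * K2 ^+ 3 * (Q1 / c1) * c1^-1 ^+ 2
    + 128 * K2 ^+ 4 * c1^-1 ^+ 4 in
  500 * (Rad2 * c2r) * (1 + E1) + 450 * (c2 * ((1 + K2) * Rad2)) * E1
  + 1350 * (c2 * ((1 + K2) * Rad2)) * E2 + 192 * (s2 * Q1) + 48 * (s2 * Q1 * E3).

Let mom_mono u v u' v' : 0 <= u <= u' -> 0 <= v <= v' ->
  0 <= moment_const u v <= moment_const u' v'.
Proof.
move=> /andP[u0 uu] /andP[v0 vv]; rewrite /moment_const.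
have p2 : 0 <= 4 * K2 ^+ 2 by apply: mulr_ge0 (ler0n _ _) _; exact: exprn_ge0.
have p3 : 0 <= 12 * K2 ^+ 3 by apply: mulr_ge0 (ler0n _ _) _; exact: exprn_ge0.
have hu : u ^+ 2 <= u' ^+ 2 by rewrite lerXn2r// nnegrE; exact: le_trans uu.
have hv : v ^+ 2 <= v' ^+ 2 by rewrite lerXn2r// nnegrE; exact: le_trans vv.
apply/andP; split.
  apply: addr_ge0; first exact: mulr_ge0 p2 (sqr_ge0 _).
  exact: mulr_ge0 (mulr_ge0 p3 u0) (sqr_ge0 _).
apply: lerD; first exact: ler_wpM2l.
rewrite -[leLHS]mulrA -[leRHS]mulrA; apply: ler_wpM2l => //.
by apply: ler_pM => //; exact: sqr_ge0.
Qed.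

(* [t], [a], [b] stand for [n^(-1/p)], [t^gamma], [t^(2r)], where [p = 2r+1+gamma]. *)
Variables (t a b n l lam D sr gg : R).
Hypotheses (t0 : 0 < t) (a01 : 0 < a <= 1) (b01 : 0 < b <= 1).
Hypotheses (n0 : 0 < n) (nE : n^-1 = t * a * b) (l0 : 0 < l) (lE : l^-1 <= t * a / cl).
Hypotheses (lamE : c1 * t <= lam <= c2 * t) (DE : 0 <= D <= Q1 / a).
Hypotheses (srE : sr ^+ 2 <= Rad2 * c2r * (t * b)) (ggE : 0 <= gg <= (1 + K2) * Rad2).

Let lam0 : 0 < lam.
Proof. by case/andP: lamE => + _; apply: lt_le_trans; exact: mulr_gt0. Qed.

Let lamV : 0 <= lam^-1 <= c1^-1 * t^-1.
Proof.
rewrite invr_ge0 (ltW lam0)/= -invfM lef_pV2 ?posrE//; last exact: mulr_gt0.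
by case/andP: lamE.
Qed.

Let a0 : 0 < a. Proof. by case/andP: a01. Qed.
Let b0 : 0 < b. Proof. by case/andP: b01. Qed.
Let D0 : 0 <= D. Proof. by case/andP: DE. Qed.
Let aN0 : a != 0. Proof. by rewrite gt_eqF. Qed.
Let tN0 : t != 0. Proof. by rewrite gt_eqF. Qed.
Let c1N0 : c1 != 0. Proof. by rewrite gt_eqF. Qed.
Let clN0 : cl != 0. Proof. by rewrite gt_eqF. Qed.

Let u_l : 0 <= D / (lam * l) <= Q1 / (c1 * cl).
Proof.
case/andP: lamV => v0 vv; case/andP: DE => _ DQ.
rewrite divr_ge0 ?mulr_ge0 ?(ltW lam0) ?(ltW l0)//=.
have -> : Q1 / (c1 * cl) = (Q1 / a) * ((c1^-1 * t^-1) * (t * a / cl)).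
  by field; rewrite ?aN0 ?tN0 ?c1N0 ?clN0.
rewrite invfM; apply: ler_pM => //; first by rewrite mulr_ge0// invr_ge0 ltW.
by apply: ler_pM => //; rewrite invr_ge0 ltW.
Qed.

Let v_l : 0 <= (lam * l)^-1 <= (c1 * cl)^-1.
Proof.
case/andP: lamV => v0 vv.
rewrite invr_ge0 mulr_ge0 ?(ltW lam0) ?(ltW l0)//= invfM.
have h : lam^-1 * l^-1 <= (c1^-1 * t^-1) * (t * a / cl).
  by apply: ler_pM => //; rewrite invr_ge0 ltW.
apply: (le_trans h).
have -> : (c1^-1 * t^-1) * (t * a / cl) = a * (c1 * cl)^-1.
  by field; rewrite ?aN0 ?tN0 ?c1N0 ?clN0.
by rewrite ler_piMl ?invr_ge0 ?mulr_ge0 ?(ltW c10) ?(ltW cl0)//; case/andP: a01.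
Qed.

Let u_n : 0 <= D / (lam * n) <= b * (Q1 / c1).
Proof.
case/andP: lamV => v0 vv; case/andP: DE => _ DQ.
rewrite divr_ge0 ?mulr_ge0 ?(ltW lam0) ?(ltW n0)//=.
have -> : b * (Q1 / c1) = (Q1 / a) * ((c1^-1 * t^-1) * (t * a * b)).
  by field; rewrite ?aN0 ?tN0 ?c1N0.
rewrite invfM nE; apply: ler_pM => //; first by rewrite !mulr_ge0// ltW.
by apply: ler_pM => //; rewrite !mulr_ge0// ltW.
Qed.

Let v_n : 0 <= (lam * n)^-1 <= b * c1^-1.
Proof.
case/andP: lamV => v0 vv.
rewrite invr_ge0 mulr_ge0 ?(ltW lam0) ?(ltW n0)//= invfM nE.
have h : lam^-1 * (t * a * b) <= (c1^-1 * t^-1) * (t * a * b).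
  by apply: ler_wpM2r => //; rewrite !mulr_ge0// ltW.
apply: (le_trans h).
have -> : (c1^-1 * t^-1) * (t * a * b) = a * (b * c1^-1).
  by field; rewrite ?aN0 ?tN0 ?c1N0.
by rewrite ler_piMl ?invr_ge0 ?mulr_ge0 ?invr_ge0 ?(ltW c10) ?(ltW b0)//; case/andP: a01.
Qed.

(** The second term gains [b ^ 3], one factor of which is dropped since [b <= 1]. *)
Let mom_scale u v : 0 <= u -> moment_const (b * u) (b * v) <= b ^+ 2 * moment_const u v.
Proof.
move=> u0; rewrite /moment_const mulrDr; apply: lerD; first by rewrite le_eqVlt; apply/orP; left; apply/eqP; ring.
have -> : 12 * K2 ^+ 3 * (b * u) * (b * v) ^+ 2 = b * (b ^+ 2 * (12 * K2 ^+ 3 * u * v ^+ 2)) by ring.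
rewrite ler_piMl//; last by case/andP: b01.
apply: mulr_ge0 (sqr_ge0 _) _; apply: mulr_ge0 (sqr_ge0 _).
by apply: mulr_ge0 _ u0; apply: mulr_ge0 (ler0n _ _) _; exact: exprn_ge0.
Qed.

(** The moment at [l] is bounded and the one at [n] is of order [b ^ 2]. With AM-GM weight [b], the
    two halves [b] and [b^-1 * b ^ 2] are both of order [b], so every summand is of order
    [t * b]. *)
Lemma rate_le :
  500 * sr ^+ 2 + (500 * sr ^+ 2 + 450 * lam * gg * b) *
    moment_const (D / (lam * l)) (lam * l)^-1
  + 900 * lam * gg * (1 + b^-1 / 2) * moment_const (D / (lam * n)) (lam * n)^-1
  + 192 * (s2 * D / n)
  + 48 * (s2 * D / n * (32 * K2 ^+ 2 * (D / (lam * n)) ^+ 2 +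
       96 * K2 ^+ 3 * (D / (lam * n)) * (lam * n)^-1 ^+ 2 + 128 * K2 ^+ 4 * (lam * n)^-1 ^+ 4))
  <= rate_const * (t * b).
Proof.
have /andP[El0 El] := mom_mono u_l v_l.
have /andP[En0 En] := mom_mono u_n v_n.
have Q1c1 : 0 <= Q1 / c1 by rewrite divr_ge0// ltW.
have {}En := le_trans En (mom_scale _ Q1c1).
rewrite /rate_const.
set E1 := moment_const (Q1 / (c1 * cl)) _ in El *.
set E2 := moment_const (Q1 / c1) _ in En *.
move: (moment_const _ _) El0 El => ml ml0 El.
move: (moment_const _ _) En0 En => mn mn0 En.
have tb0 : 0 <= t * b by rewrite mulr_ge0// ltW.
have b1 : b <= 1 by case/andP: b01.
have lg0 : 0 <= lam * gg by apply: (mulr_ge0 (ltW lam0)); case/andP: ggE.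
have lg : lam * gg <= t * (c2 * ((1 + K2) * Rad2)).
  case/andP: lamE => _ lamc; case/andP: ggE => g0 gg1.
  rewrite (_ : t * _ = c2 * t * ((1 + K2) * Rad2)); last by ring.
  by apply: ler_pM => //; exact: ltW.
have Sn0 : 0 <= s2 * D / n by rewrite !mulr_ge0// invr_ge0 ltW.
have Sn : s2 * D / n <= s2 * Q1 * (t * b).
  have -> : s2 * Q1 * (t * b) = s2 * (Q1 / a) * (t * a * b) by field.
  rewrite -nE; apply: ler_wpM2r; first by rewrite invr_ge0 ltW.
  by apply: ler_wpM2l => //; case/andP: DE.
set E3 := (X in 48 * (s2 * Q1 * X)).
set m3 := (X in 48 * (_ / n * X)).
have m3E : 0 <= m3 <= E3.
  case/andP: u_n => un0 un; case/andP: v_n => vn0 vn.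
  have {}un : D / (lam * n) <= Q1 / c1 by apply: (le_trans un); rewrite ler_piMl.
  have {}vn : (lam * n)^-1 <= c1^-1.
    by apply: (le_trans vn); rewrite ler_piMl// invr_ge0 ltW.
  rewrite /m3 /E3; move: (D / (lam * n)) un0 un => u u0 uu.
  move: ((lam * n)^-1) vn0 vn => v v0 vv.
  have p k j : 0 <= k%:R * K2 ^+ j by apply: mulr_ge0 (ler0n _ _) _; exact: exprn_ge0.
  apply/andP; split.
    apply: addr_ge0; last by apply: mulr_ge0 (p _ _) _; exact: exprn_ge0.
    apply: addr_ge0; first by apply: mulr_ge0 (p _ _) _; exact: exprn_ge0.
    by apply: mulr_ge0; [exact: mulr_ge0 (p _ _) u0|exact: exprn_ge0].
  have hv k : v ^+ k <= c1^-1 ^+ k by rewrite lerXn2r// nnegrE; exact: le_trans vv.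
  apply: lerD; last exact: ler_wpM2l (p _ _) _ _ (hv _).
  apply: lerD.
    by apply: ler_wpM2l (p _ _) _ _ _; rewrite lerXn2r// nnegrE; exact: le_trans uu.
  apply: ler_pM => //; first exact: mulr_ge0 (p _ _) u0.
    exact: exprn_ge0.
  exact: ler_wpM2l (p _ _) _ _ uu.
case/andP: m3E; move: m3 E3 => m3 E3 m30 m3E.
have h1 : sr ^+ 2 * (1 + ml) <= Rad2 * c2r * (t * b) * (1 + E1).
  by apply: ler_pM => //; [exact: sqr_ge0|rewrite addr_ge0|rewrite lerD2l].
have h2 : (lam * gg) * b * ml <= t * (c2 * ((1 + K2) * Rad2)) * b * E1.
  by apply: ler_pM => //; [rewrite mulr_ge0// ltW|rewrite ler_wpM2r// ltW].
have h3 : (lam * gg) * ((1 + b^-1 / 2) * mn) <=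
    t * (c2 * ((1 + K2) * Rad2)) * (3 / 2 * (b * E2)).
  have bV : 0 <= b^-1 by rewrite invr_ge0 ltW.
  have E20 : 0 <= b ^+ 2 * E2 by exact: le_trans En.
  apply: ler_pM => //; first by rewrite mulr_ge0// addr_ge0// divr_ge0.
  apply: (@le_trans _ _ ((1 + b^-1 / 2) * (b ^+ 2 * E2))).
    by rewrite ler_wpM2l// addr_ge0// divr_ge0.
  have -> : (1 + b^-1 / 2) * (b ^+ 2 * E2) = b * (b * E2) + b * E2 / 2.
    by field; rewrite gt_eqF.
  have bE : 0 <= b * E2.
    by move: E20; rewrite expr2 -mulrA pmulr_rge0.
  have := ler_piMl bE b1; lra.
have h4 : s2 * D / n * m3 <= s2 * Q1 * (t * b) * E3 by exact: ler_pM.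
have s1 := ler_wpM2l (ler0n R 500) h1.
have s2' := ler_wpM2l (ler0n R 450) h2.
have s3 := ler_wpM2l (ler0n R 900) h3.
have s4 := ler_wpM2l (ler0n R 192) Sn.
have s5 := ler_wpM2l (ler0n R 48) h4.
apply: le_trans (_ : _ <= 500 * (sr ^+ 2 * (1 + ml)) + 450 * (lam * gg * b * ml) +
  900 * (lam * gg * ((1 + b^-1 / 2) * mn)) + 192 * (s2 * D / n) + 48 * (s2 * D / n * m3)) _.
  by rewrite le_eqVlt; apply/orP; left; apply/eqP; ring.
apply: (le_trans (lerD (lerD (lerD (lerD s1 s2') s3) s4) s5)).
by rewrite le_eqVlt; apply/orP; left; apply/eqP; field.
Qed.

End rates.

Section rate_powers.
Context {R : realType}.
Variables (r gamma : R) (n : nat).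
Hypotheses (r0 : 0 <= r) (gamma0 : 0 < gamma) (n0 : (0 < n)%N).

Let p := 2 * r + 1 + gamma.
Let t := (1 / n%:R : R) `^ (1 / p).

Let p0 : 0 < p. Proof. by have h1 := r0; have h2 := gamma0; rewrite /p; lra. Qed.
Let nR : 0 < n%:R :> R. Proof. by rewrite ltr0n. Qed.
Let x01 : 0 < (1 / n%:R : R) <= 1.
Proof. by rewrite divr_gt0//= ler_pdivrMr// mul1r ler1n. Qed.

Lemma rate_base_gt0 : 0 < t.
Proof. by apply: powR_gt0; case/andP: x01. Qed.

Lemma rate_power q : 0 <= q -> 0 < t `^ q <= 1.
Proof.
move=> q0; rewrite powR_gt0 ?rate_base_gt0//= /t -powRrM -[leRHS](powRr0 (1 / n%:R)).
by rewrite ger_powR// mulr_ge0// divr_ge0// ltW.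
Qed.

Lemma rate_powerE q : (1 / n%:R) `^ (q / p) = t `^ q.
Proof. by rewrite /t -powRrM; congr (_ `^ _); rewrite div1r mulrC. Qed.

Lemma rate_powerD q q' : t `^ (q + q') = t `^ q * t `^ q'.
Proof. by rewrite powRD//; apply/implyP => _; rewrite gt_eqF ?rate_base_gt0. Qed.

Lemma rate_invn : n%:R^-1 = t * t `^ gamma * t `^ (2 * r).
Proof.
rewrite -[X in X * _ * _](powRr1 (ltW rate_base_gt0)) -!rate_powerD -rate_powerE (_ : _ / p = 1); last first.
  by rewrite (_ : 1 + _ + _ = p); [rewrite divff// gt_eqF|rewrite /p; ring].
by rewrite powRr1 ?mul1r// divr_ge0.
Qed.

(** [(t * t^gamma)^-1 = n^((1 + gamma) / p)], which is where the threshold on [beta] comes from. *)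
Lemma rate_subsample (cl beta l : R) : 0 < cl -> (1 + gamma) / p <= beta ->
  cl * n%:R `^ beta <= l -> 0 < l /\ l^-1 <= t * t `^ gamma / cl.
Proof.
move=> cl0 pb ll.
have nb0 : 0 < n%:R `^ beta :> R by exact: powR_gt0.
have l0 : 0 < l by apply: lt_le_trans ll; exact: mulr_gt0.
split => //; have ta0 : 0 < t * t `^ gamma.
  by apply: mulr_gt0; [|apply: powR_gt0]; exact: rate_base_gt0.
rewrite -lef_pV2 ?posrE ?invr_gt0 ?divr_gt0// invrK invf_div.
apply: le_trans ll; rewrite ler_wpM2l ?(ltW cl0)//.
have -> : t * t `^ gamma = t `^ (1 + gamma).
  by rewrite rate_powerD powRr1// ltW// rate_base_gt0.
rewrite -rate_powerE -powRN div1r -powR_inv1 ?ler0n// -powRrM mulN1r opprK.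
by apply: ler_powR => //; rewrite ler1n.
Qed.

End rate_powers.

Theorem theorem3 (R : realType)
    (r gamma kappa sigma M Rad Q beta cl c1 c2 : R)
    (hr : 0 <= r <= 1 / 2) (hgamma : 0 < gamma <= 1)
    (hsigma : 0 < sigma) (hM : 0 < M) (hRad : 0 < Rad)
    (hbeta : (1 + gamma) / (2 * r + 1 + gamma) <= beta)
    (hcl : 0 < cl) (hc1 : 0 < c1) :
  exists C : R,
  forall (d : measure_display) (X : measurableType d)
    (rho : probability (X * R)%type R) (nu : probability X R)
    (k : R.-pker X ~> R) (H : rkhs R X) (T : H -> H)
    (l : nat -> nat) (lambda : nat -> R),
  standard_borel R X ->
  is_marginal rho nu -> is_conditional rho nu k ->
  separable_space H -> rkhs_measurable H -> kernel_bound H kappa ->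
  is_covariance nu T ->
  regularity nu k T r Rad -> capacity T gamma Q ->
  bernstein_noise nu k sigma M ->
  (forall n : nat, (0 < n)%N ->
    (l n <= n)%N /\ cl * n%:R `^ beta <= (l n)%:R) ->
  (forall n : nat, (0 < n)%N ->
    c1 * (1 / n%:R) `^ (1 / (2 * r + 1 + gamma)) <= lambda n /\
    lambda n <= c2 * (1 / n%:R) `^ (1 / (2 * r + 1 + gamma))) ->
  forall (n : nat), (0 < n)%N ->
  forall (d' : measure_display) (Omega : measurableType d')
    (P : probability Omega R) (Z : 'I_n -> Omega -> X * R)
    (S : Omega -> {ffun 'I_(l n) -> 'I_n}),
  nystrom_sampling rho P Z S ->
  (expected_excess_risk rho k H P Z S (lambda n) <=
    (C * (Rad ^+ 2 *
      (1 / n%:R) `^ ((2 * r + 1) / (2 * r + 1 + gamma))))%:E)%E.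
Proof.
pose K2 := kappa ^+ 2; pose s2 := sigma ^+ 2; pose Rad2 := Rad ^+ 2.
(* [c1^(-gamma)] comes from [lambda >= c1 t] in the capacity bound, [c2^(2r+1)] from
   [lambda <= c2 t] in the source term. The noise terms of [rate_const] do not scale with [Rad2],
   hence the division. *)
exists (rate_const K2 s2 Rad2 (Q * c1 `^ (- gamma)) cl c1 c2 (c2 `^ (2 * r + 1)) / Rad2).
move=> d X rho nu k H T l lambda _ nuE rhoE _ mH [Kub KE] covT
  [g [h [gE [e [ev [eb gh]]] hRad2]]] cap bern lE lamE n n0 d' Omega P Z S ZS.
case/andP: (hr) => r0 _; case/andP: (hgamma) => g0 _.
have [ln ll] := lE n n0; have [laml lamu] := lamE n n0.
set p := 2 * r + 1 + gamma in hbeta laml lamu *.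
set t := (1 / n%:R) `^ (1 / p) in laml lamu *.
have t0 : 0 < t := rate_base_gt0 r gamma n0.
have a01 : 0 < t `^ gamma <= 1 := rate_power r0 g0 n0 (ltW g0).
have b01 : 0 < t `^ (2 * r) <= 1 := rate_power r0 g0 n0 (mulr_ge0 (ler0n R 2) r0).
have lam0 : 0 < lambda n by apply: lt_le_trans laml; exact: mulr_gt0.
have c20 : 0 < c2.
  by have := lt_le_trans lam0 lamu; rewrite pmulr_lgt0.
have [l0 lV] := rate_subsample n0 hcl hbeta ll.
have secK2 x : rkhs_dot H (rkhs_sec H x) (rkhs_sec H x) <= K2.
  by rewrite /K2 KE -rkhs_kernelE; apply: ub_le_sup => //; exists x, x.
have Tsym := covariance_sym mH secK2 covT.
have Tpos := covariance_ge0 mH secK2 covT.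
have K20 := K2_ge0 secK2.
pose D := Q * lambda n `^ (- gamma).
have dimD : (effective_dim T (lambda n) <= D%:E)%E := cap _ lam0.
have D0 : 0 <= D.
  by have := effective_dim_bound mH secK2 covT eb lam0 0 dimD; rewrite big_ord0.
have Q0 : 0 <= Q by move: D0; rewrite pmulr_lge0 ?powR_gt0.
have gE' : {ae nu, forall x, regression k x = rkhs_dot H g (rkhs_sec H x)}.
  by apply: filterS gE => x ->; rewrite rkhs_reproducing.
have var : {ae nu, forall x,
    (\int[k x]_y ((y - rkhs_dot H g (rkhs_sec H x)) ^+ 2)%:E <= s2%:E)%E}.
  (* The Bernstein bound at [m = 2] is the conditional variance bound [sigma ^ 2]. *)
  apply: filterS2 gE' bern => x <- /(_ 2%N isT).
  rewrite expr0 mulr1 (_ : 2^-1 * 2`!%:R = 1) ?mul1r ?mulVf// => xs.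
  by under eq_integral do rewrite -(real_normK (num_real _)).
have lamE2 : (lambda n `^ (r + 2^-1)) ^+ 2 = lambda n ^+ 2 * lambda n `^ (2 * r - 1).
  rewrite -powR_mulrn ?powR_ge0// -powRrM -(powR_mulrn 2 (ltW lam0)).
  rewrite -powRD; last by apply/implyP => _; rewrite gt_eqF.
  by congr (_ `^ _); field.
(* The deterministic [rho] is [Rad * lambda^(r + 1/2)]: the factor [lambda ^ 2] in front of
   [<g, v>^2] turns [lambda^(2r-1)] into [lambda^(2r+1)]. *)
have src v : (lambda n * rkhs_dot H g v) ^+ 2 <=
    (Rad * lambda n `^ (r + 2^-1)) ^+ 2 * energy T (lambda n) v.
  have -> : (Rad * lambda n `^ (r + 2^-1)) ^+ 2 * energy T (lambda n) v =
      lambda n ^+ 2 * (lambda n `^ (2 * r - 1) * Rad ^+ 2 * energy T (lambda n) v).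
    by rewrite exprMn lamE2; ring.
  rewrite exprMn ler_wpM2l ?sqr_ge0//.
  exact: (source_condition Tsym Tpos eb v lam0 hr hRad2 gh).
have b0 : 0 < t `^ (2 * r) by case/andP: b01.
have sr0 : 0 <= Rad * lambda n `^ (r + 2^-1).
  by rewrite mulr_ge0 ?powR_ge0// ltW.
have l0N : (0 < l n)%N by rewrite -(ltr_nat R).
(* Passing [b0] sets [theta] to [t^(2r)], the weight that balances [theta^-1 * t^(4r)] against
   [theta]. *)
apply: (le_trans (expected_excess_risk_le nuE rhoE mH secK2 covT eb lam0 dimD gE'
  (sqr_ge0 sigma) var ZS n0 l0N ln sr0 b0 src)).
have -> : (1 / n%:R) `^ ((2 * r + 1) / p) = t * t `^ (2 * r).
  by rewrite rate_powerE (rate_powerD _ _ n0) mulrC powRr1// ltW.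
rewrite lee_fin [leRHS]mulrA divfK; last by rewrite sqrf_eq0 gt_eqF.
have Q10 : 0 <= Q * c1 `^ (- gamma) by rewrite mulr_ge0 ?powR_ge0.
have nR : 0 < n%:R :> R by rewrite ltr0n.
apply: (rate_le K20 (sqr_ge0 sigma) Q10 hcl hc1 t0 a01 b01 nR (rate_invn r0 g0 n0) l0 lV) => //.
- by rewrite laml lamu.
- rewrite D0 /D -mulrA -powRN -powRM ?(ltW t0) ?(ltW hc1)// ler_wpM2l//.
  rewrite !powRN lef_pV2 ?posrE ?powR_gt0 ?mulr_gt0//.
  by apply: ge0_ler_powR; rewrite ?nnegrE ?(ltW g0) ?(ltW lam0) ?mulr_ge0 ?(ltW t0) ?(ltW hc1).
- rewrite exprMn -mulrA ler_wpM2l ?sqr_ge0//.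
  have -> : t * t `^ (2 * r) = t `^ (2 * r + 1).
    by rewrite (rate_powerD _ _ n0) mulrC powRr1// ltW.
  rewrite -powRM ?(ltW c20) ?(ltW t0)// -powR_mulrn ?powR_ge0// -powRrM.
  rewrite (_ : _ * 2 = 2 * r + 1); last by field.
  by apply: ge0_ler_powR; rewrite ?nnegrE ?addr_ge0 ?mulr_ge0 ?(ltW c20) ?(ltW t0) ?(ltW lam0).
rewrite dot_ge0/=.
exact: (source_norm Tsym Tpos eb K20 hr hRad2 (covariance_le mH secK2 covT) gh).
Qed.
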